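(* Let $d\geq 3$ and let $\{X_t\}_{t\ge 0}$ be the $d$-dimensional critical super-Brownian motion with binary branching mechanism $\psi(u)=u^2$. Let $\mathbb{P}$ denote its law when started from a Poisson random measure on $\mathbb{R}^d$ whose intensity is the Lebesgue measure, and let $\mathbb{P}_{\delta_x}$ denote its law when started from the Dirac mass $X_0=\delta_x$, $x\in\mathbb{R}^d$. Let $R_t:=\sup\{u>0: X_t(B(u))=0\}$, where $B(u)=\{x\in\mathbb{R}^d:|x|<u\}$ and $\sup\emptyset=0$. Then for any $r\in(0,\infty)$, $$\lim_{t\to\infty}\mathbb{P}(R_t\geq r)=e^{-\kappa_d r^{d-2}},$$ where $$\kappa_d:=-\lim_{t\to\infty}\int_{\mathbb{R}^d}\log\mathbb{P}_{\delta_x}(X_t(B(1))=0)\,dx\in(0,\infty)$$ (in particular, this limit exists, and it is finite and nonzero).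
   Context: Fix a constant $p>d$ and let $\phi_p(x):=(1+|x|^2)^{-p/2}$ for $x\in\mathbb{R}^d$. Let $M_p$ be the space of locally finite measures $\mu$ on $\mathbb{R}^d$ with $\int_{\mathbb{R}^d}\phi_p(x)\,\mu(dx)<\infty$, with the topology in which $\mu_n\to\mu$ iff $\int f\,d\mu_n\to\int f\,d\mu$ for all $f\in\{g+\alpha\phi_p:\alpha\in\mathbb{R},\ g\in C_c(\mathbb{R}^d)\}$. The $d$-dimensional super-Brownian motion with branching mechanism $\psi(u)=u^2$ and initial value $X_0=\mu\in M_p$ (law $\mathbb{P}_\mu$, expectation $\mathbb{E}_\mu$) is the $M_p$-valued Markov process $\{X_t\}_{t\ge0}$ whose transition probabilities are characterized by $$\mathbb{E}_\mu\left[e^{-\langle X_t,\phi\rangle}\right]=e^{-\int_{\mathbb{R}^d}u(t,x)\,\mu(dx)},\qquad \langle X_t,\phi\rangle:=\int_{\mathbb{R}^d}\phi(x)\,X_t(dx),$$ for every nonnegative continuous $\phi$ with $\sup_x \phi(x)/\phi_p(x)<\infty$, where $u$ is the unique positive solution of $$\frac{\partial u(t,x)}{\partial t}=\frac12\Delta u(t,x)-u^2(t,x),\qquad u(0,x)=\phi(x).$$ $\mathrm{PRM}(\lambda)$ is the Poisson random measure on $\mathbb{R}^d$ with intensity the Lebesgue measure $\lambda$, and $\mathbb{P}:=\mathbb{P}_{\mathrm{PRM}(\lambda)}$ is the law of the super-Brownian motion when $X_0$ is distributed as $\mathrm{PRM}(\lambda)$ (so that, given $X_0=\mu$, the process has law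 $\mathbb{P}_\mu$). *)

(* Defs.v *)
From HB Require Import structures.
From mathcomp Require Import all_boot all_order all_algebra.
From mathcomp Require Import all_classical all_reals all_analysis.
From mathcomp Require Import measurable_realfun.

Set Implicit Arguments.
Unset Strict Implicit.
Unset Printing Implicit Defensive.
Import Order.TTheory GRing.Theory Num.Theory.
Import numFieldNormedType.Exports.
Local Open Scope classical_set_scope.
Local Open Scope ring_scope.

(** Borel sigma-algebra on spaces of matrices; R^d is ['rV[R]_d]. *)

HB.instance Definition _ (R : realType) (m n : nat) :=
  @isMeasurable.Build (sigma_display (@open 'M[R]_(m, n))) 'M[R]_(m, n)
    <<s open >> (@sigma_algebra0 _ setT open) (@sigma_algebraC _ open)
    (@sigma_algebra_bigcup _ setT open).

Section lebesgue_construction.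
Context {R : realType}.

Lemma measurable_open_mx m n (A : set 'M[R]_(m, n)) : open A -> measurable A.
Proof. by move=> oA; apply: sub_sigma_algebra. Qed.

Lemma measurable_coord m n i j :
  measurable_fun setT (fun M : 'M[R]_(m, n) => M i j).
Proof.
apply: (measurability _ (RGenOpens.measurableE R)).
move=> _ [_ [a [b ->] <-]]; rewrite setTI; apply: measurable_open_mx.
by apply: open_comp => [x _|]; [exact: coord_continuous|exact: interval_open].
Qed.

Lemma measurable_box n (A : 'I_n -> set R) : (forall i, measurable (A i)) ->
  measurable [set v : 'rV[R]_n | forall i, A i (v ord0 i)].
Proof.
move=> mA; rewrite (_ : mkset _ = \bigcap_(i in [set: 'I_n])
    [set v : 'rV[R]_n | A i (v ord0 i)]); last first.
  by apply/seteqP; split=> v /= h i; [move=> _; exact: h|exact: h].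
apply: fin_bigcap_measurable => // i _.
by rewrite -[X in measurable X]setTI; apply: (@measurable_coord 1 n ord0 i).
Qed.

(** [rcons0 (a, v)] is the row vector with first coordinate [a] followed by
    [v]. *)
Definition rcons0 n (av : R * 'rV[R]_n) : 'rV[R]_n.+1 :=
  row_mx (av.1%:M : 'rV_1) av.2.

Lemma measurable_rcons0 n : measurable_fun setT (@rcons0 n).
Proof.
apply: (measurability (@open 'rV[R]_n.+1)) => //.
move=> _ [U oU <-]; rewrite setTI.
pose ratv (w : 'rV[rat]_n) : 'rV[R]_n := map_mx ratr w.
pose box (q : rat * 'rV[rat]_n * nat) : set (R * 'rV[R]_n) :=
  ball (ratr q.1.1 : R) q.2.+1%:R^-1 `*`
  [set v : 'rV[R]_n |
      forall i, ball (ratv q.1.2 ord0 i) q.2.+1%:R^-1 (v ord0 i)].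
have mbox q : measurable (box q).
  apply: measurableX; first exact: measurable_ball.
  apply: (@measurable_box n
    (fun i => ball (ratv q.1.2 ord0 i) q.2.+1%:R^-1)) => i.
  exact: measurable_ball.
rewrite (_ : _ @^-1` U =
    \bigcup_(q in [set q | box q `<=` @rcons0 n @^-1` U]) box q); last first.
  apply/seteqP; split=> [[a v] Uav|x [q /= qU /qU]//].
  have : nbhs (rcons0 (a, v)) U by exact: open_nbhs_nbhs.
  move=> /nbhs_ballP[e /= e0 eU].
  have [k ke] : exists k : nat, k.+1%:R^-1 < e / 2 :> R.
    have e20 : 0 < e / 2 by rewrite divr_gt0.
    have [k _ /(_ k (leqnn k)) /= hk] := near_infty_natSinv_lt (PosNum e20).
    by exists k.
  have k0 : 0 < k.+1%:R^-1 :> R by rewrite invr_gt0.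
  have ratex (x : R) : exists q : rat, `|ratr q - x| < k.+1%:R^-1.
    have [|q] := @rat_in_itvoo R (x - k.+1%:R^-1) (x + k.+1%:R^-1).
      by rewrite ltrBlDr -addrA ltrDl addr_gt0.
    by rewrite in_itv/= => /andP[h1 h2]; exists q; rewrite ltr_distl h1 h2.
  have [qa hqa] := ratex a.
  have [w hw] : exists w : 'rV[rat]_n,
      forall i, `|ratr (w ord0 i) - v ord0 i| < k.+1%:R^-1.
    exists (\row_i sval (cid (ratex (v ord0 i)))) => i.
    by rewrite mxE; case: cid.
  exists (qa, w, k); last first.
    by split => /=; [exact: hqa|move=> i; rewrite /ratv mxE; exact: hw].
  move=> [b u] [/= hb hu]; apply: eU; split=> // i j.
  have close (x y q : R) : `|q - x| < k.+1%:R^-1 -> `|q - y| < k.+1%:R^-1 ->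
      `|x - y| < e.
    move=> qx qy; rewrite (_ : x - y = (q - y) - (q - x)); last first.
      by rewrite opprB [RHS]addrC addrA subrK.
    rewrite (le_lt_trans (ler_normB _ _))// (splitr e) ltrD//.
      exact: lt_trans ke.
    exact: lt_trans ke.
  rewrite /ball /= /rcons0 !mxE /=.
  case: splitP => l _; rewrite ?mxE/=.
    by rewrite (ord1 i) (ord1 l) !mulr1n; exact: close hqa hb.
  rewrite (ord1 i); apply: (close _ _ (ratr (w ord0 l))); first exact: hw.
  by have := hu l; rewrite /ratv mxE.
rewrite bigcup_mkcond; apply: countable_bigcupT_measurable => // q.
by case: ifPn.
Qed.

Lemma continuous_tail n :
  continuous (fun v : 'rV[R]_n.+1 => rsubmx (v : 'rV_(1 + n))).
Proof.
move=> v A /nbhs_ballP[e /= e0 eA]; apply/nbhs_ballP; exists e => // w [_ vw].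
by apply: eA; split=> // i j; rewrite !mxE; exact: vw.
Qed.

Definition uncons0 n (v : 'rV[R]_n.+1) : R * 'rV[R]_n :=
  (v ord0 ord0, rsubmx (v : 'rV_(1 + n))).

Lemma measurable_uncons0 n : measurable_fun setT (@uncons0 n).
Proof.
apply: measurable_fun_pair; first exact: measurable_coord.
apply: (measurability (@open 'rV[R]_n)) => //.
move=> _ [U oU <-]; rewrite setTI; apply: measurable_open_mx.
by apply: open_comp oU => v _; exact: continuous_tail.
Qed.

Lemma rcons0_head n (a : R) (v : 'rV[R]_n) : rcons0 (a, v) ord0 ord0 = a.
Proof.
rewrite [LHS](_ : _ = row_mx (a%:M : 'rV_1) v ord0 (lshift n ord0)).
  by rewrite row_mxEl mxE.
by congr (row_mx _ _ _ _); exact/val_inj.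
Qed.

Lemma rcons0_tail n (a : R) (v : 'rV[R]_n) i :
  rcons0 (a, v) ord0 (lift ord0 i) = v ord0 i.
Proof.
rewrite [LHS](_ : _ = row_mx (a%:M : 'rV_1) v ord0 (rshift 1 i)).
  by rewrite row_mxEr.
by congr (row_mx _ _ _ _); exact/val_inj.
Qed.

Lemma rcons0K n : cancel (@rcons0 n) (@uncons0 n).
Proof.
by move=> [a v]; rewrite /uncons0 rcons0_head /rcons0 row_mxKr.
Qed.

Section lebesgue_step.
Context n (mu : {sigma_finite_measure set 'rV[R]_n -> \bar R}).

Definition lebesgue_step :=
  pushforward (lebesgue_measure \x mu)%E (@rcons0 n).

Let step0 : lebesgue_step set0 = 0%E.
Proof. by rewrite /lebesgue_step /pushforward preimage_set0 measure0. Qed.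

Let step_ge0 A : (0 <= lebesgue_step A)%E.
Proof. by rewrite /lebesgue_step /pushforward measure_ge0. Qed.

Let step_sigma_additive : semi_sigma_additive lebesgue_step.
Proof.
apply: (@measure_semi_sigma_additive _ _ _
  (pushforward (lebesgue_measure \x mu)%E (@rcons0 n))).
exact: measurable_rcons0.
Qed.

HB.instance Definition _ := isMeasure.Build _ _ _ lebesgue_step
  step0 step_ge0 step_sigma_additive.

Let step_sigma_finite : sigma_finite setT lebesgue_step.
Proof.
have /sigma_finiteP[F [FT ndF mF]] := sigma_finiteT (@lebesgue_measure R).
have /sigma_finiteP[G [GT ndG mG]] := sigma_finiteT mu.
exists (fun k => @uncons0 n @^-1` (F k `*` G k)).
  apply/esym/seteqP; split=> // v _; rewrite -preimage_bigcup /=.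
  have [i _ Fi] : (\bigcup_i F i) (uncons0 v).1 by rewrite -FT.
  have [j _ Gj] : (\bigcup_i G i) (uncons0 v).2 by rewrite -GT.
  exists (maxn i j) => //; split=> /=.
    by move: Fi; exact/subsetPset/ndF/leq_maxl.
  by move: Gj; exact/subsetPset/ndG/leq_maxr.
move=> k; have [mFk Fkoo] := mF k; have [mGk Gkoo] := mG k; split.
  rewrite -[X in measurable X]setTI; apply: measurable_uncons0 => //.
  exact: measurableX.
rewrite /lebesgue_step /pushforward -comp_preimage.
rewrite (_ : _ \o _ = id) ?preimage_id; last first.
  by apply/funext => x; exact: rcons0K.
by rewrite product_measure1E// lte_mul_pinfty// ge0_fin_numE.
Qed.

HB.instance Definition _ := Measure_isSigmaFinite.Build _ _ _ lebesgue_step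
  step_sigma_finite.

End lebesgue_step.

(** d-dimensional Lebesgue measure, as an iterated product. *)
Fixpoint lebesgue_rV n : {sigma_finite_measure set 'rV[R]_n -> \bar R} :=
  if n is m.+1 then lebesgue_step (lebesgue_rV m) else \d_(0 : 'rV[R]_0).

Lemma lebesgue_rV_box n (A : 'I_n -> set R) : (forall i, measurable (A i)) ->
  lebesgue_rV n [set v | forall i, A i (v ord0 i)] =
  (\prod_(i < n) lebesgue_measure (A i))%E.
Proof.
elim: n A => [|n IH] A mA.
  by rewrite big_ord0 /= diracE mem_set// => -[].
rewrite big_ord_recl -IH => [|i]; last exact: mA.
rewrite -product_measure1E; [|exact: mA|]; last first.
  by apply: (@measurable_box n (fun i => A (lift ord0 i))) => i; exact: mA.
rewrite [LHS]/= /lebesgue_step /pushforward; congr (product_measure1 _ _ _).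
apply/seteqP; split=> -[a v] /=.
  move=> h; split=> [|i]; first by have := h ord0; rewrite rcons0_head.
  by have := h (lift ord0 i); rewrite rcons0_tail.
move=> [ha hv] i; case: (unliftP ord0 i) => [j ->|->].
  by rewrite rcons0_tail.
by rewrite rcons0_head.
Qed.

End lebesgue_construction.

Section spaces.
Context {R : realType} {d : nat}.

Definition enorm (x : 'rV[R]_d) : R := Num.sqrt (\sum_i x ord0 i ^+ 2).

(** Open Euclidean ball: the norm [`|x|] on matrices is the sup norm. *)
Definition eball (u : R) : set 'rV[R]_d := [set x | enorm x < u].

Definition phi_p (p : R) (x : 'rV[R]_d) : R :=
  (1 + enorm x ^+ 2) `^ (- p / 2).

Definition locally_finite (mu : set 'rV[R]_d -> \bar R) :=
  forall K : set 'rV[R]_d, compact K -> (mu K < +oo)%E.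

(** The space M_p.  Two elements that agree on Borel sets may differ as records
    (through their values on non-measurable sets), but no Borel subset of
    [tempered p] separates them. *)
Record tempered (p : R) := Tempered {
  tempered_measure :> {measure set 'rV[R]_d -> \bar R};
  tempered_locally_finite : locally_finite tempered_measure;
  tempered_integral :
    (\int[tempered_measure]_x (phi_p p x)%:E < +oo)%E }.

Definition Cc (g : 'rV[R]_d -> R) :=
  continuous g /\ compact (closure [set x | g x != 0]).

Definition test_fun (p : R) : set ('rV[R]_d -> R) :=
  [set f | exists g a, Cc g /\ f = (fun x => g x + a * phi_p p x)].

(** The topology of [tempered p] below is the initial one for this map, i.e. the
    coarsest making [mu |-> \int f dmu] continuous for every test function. *)
Definition pairing (p : R) (mu : tempered p) : {ptws test_fun p -> R} :=
  fun f => (\int[mu]_x val f x)%R.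

Lemma measurable_phi_p (p : R) : measurable_fun setT (phi_p p).
Proof.
rewrite (_ : phi_p p = (@powR R ^~ (- p / 2)) \o
    (fun x => 1 + \sum_i x ord0 i ^+ 2)); last first.
  apply/funext => x /=; rewrite /phi_p sqr_sqrtr// sumr_ge0// => i _.
  exact: sqr_ge0.
apply: (measurableT_comp (measurable_powR _)); apply: measurable_funD => //.
apply: measurable_sum => i; apply: measurable_funX; exact: measurable_coord.
Qed.

Lemma mzero_locally_finite : locally_finite (@mzero _ 'rV[R]_d R).
Proof. by move=> K _; rewrite /mzero ltry. Qed.

Lemma mzero_integral p :
  (\int[@mzero _ 'rV[R]_d R]_x (phi_p p x)%:E < +oo)%E.
Proof. by rewrite integral_measure_zero ltry. Qed.

Lemma dirac_locally_finite x : locally_finite (\d_x : set 'rV[R]_d -> \bar R).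
Proof. by move=> K _; rewrite diracE ltry. Qed.

Lemma dirac_integral p x :
  (\int[(\d_x : {measure set 'rV[R]_d -> \bar R})]_y (phi_p p y)%:E < +oo)%E.
Proof.
rewrite integral_dirac ?diracT ?mul1e ?ltry//.
by apply/measurable_EFinP; exact: measurable_phi_p.
Qed.

Definition tempered_dirac p (x : 'rV[R]_d) : tempered p :=
  Tempered (dirac_locally_finite x) (@dirac_integral p x).

HB.instance Definition _ p := gen_eqMixin (tempered p).
HB.instance Definition _ p := gen_choiceMixin (tempered p).
HB.instance Definition _ p := isPointed.Build (tempered p)
  (Tempered mzero_locally_finite (@mzero_integral p)).
HB.instance Definition _ p :=
  Topological.copy (tempered p) (initial_topology (@pairing p)).
HB.instance Definition _ p :=
  @isMeasurable.Build (sigma_display (@open (tempered p))) (tempered p)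
    <<s open >> (@sigma_algebra0 _ setT open) (@sigma_algebraC _ open)
    (@sigma_algebra_bigcup _ setT open).

End spaces.

Section heat.
Context {R : realType} {d : nat}.
Implicit Types (u : R -> 'rV[R]_d -> R) (phi : 'rV[R]_d -> R).

Definition pd (i : 'I_d) (f : 'rV[R]_d -> R) : 'rV[R]_d -> R :=
  'D_(delta_mx ord0 i) f.

Definition laplacian (f : 'rV[R]_d -> R) (x : 'rV[R]_d) : R :=
  \sum_i pd i (pd i f) x.

(** Joint continuity on the half-space [t > 0] of all the derivatives that
    appear, that is [u] is of class C^{1,2} there. *)
Definition C12 u := forall t x, 0 < t ->
  [/\ derivable (u ^~ x) t 1,
      {for (t, x), continuous (fun q => derive1 (u ^~ q.2) q.1)} &
      forall i,
      [/\ derivable (u t) x (delta_mx ord0 i),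
          {for (t, x), continuous (fun q => pd i (u q.1) q.2)} &
          forall j,
          derivable (pd i (u t)) x (delta_mx ord0 j) /\
          {for (t, x), continuous (fun q => pd j (pd i (u q.1)) q.2)}]].

(** Nonnegative classical solutions of u_t = (1/2) Laplacian(u) - u^2 with
    u(0, .) = phi; "positive" must allow [u = 0], the solution for [phi = 0]. *)
Definition is_solution phi u :=
  [/\ forall t x, 0 <= t -> 0 <= u t x,
      {within [set q : R * 'rV[R]_d | 0 <= q.1],
        continuous (fun q => u q.1 q.2)},
      C12 u,
      forall t x, 0 < t ->
        derive1 (u ^~ x) t = 2^-1 * laplacian (u t) x - u t x ^+ 2 &
      forall x, u 0 x = phi x].

(** Times [t < 0] are irrelevant. *)
Definition is_unique_solution phi u := is_solution phi u /\
  forall v, is_solution phi v -> forall t x, 0 <= t -> v t x = u t x.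

End heat.

Section super_brownian_motion.
Context {R : realType} {d : nat} {p : R} {d' : measure_display}
  {Omega : measurableType d'}.
(** A Markov family: [P mu] is the law P_mu, and [X t w] is only constrained for
    [t >= 0]. *)
Variables (X : R -> Omega -> @tempered R d p)
  (P : R.-pker (@tempered R d p) ~> Omega).

Definition filtration (t : R) : set (set Omega) :=
  <<s [set A | exists s B,
       [/\ 0 <= s <= t, measurable B & A = X s @^-1` B]] >>.

(** The second clause says that [X 0] has law the Dirac mass at [mu] under
    [P mu]. *)
Definition markov_process :=
  [/\ forall t, 0 <= t -> measurable_fun setT (X t),
      forall mu B, measurable B -> P mu (X 0 @^-1` B) = \d_mu B &
      forall mu s t A B, 0 <= s -> 0 <= t -> filtration s A -> measurable B ->
        P mu (A `&` X (s + t) @^-1` B) =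
        (\int[P mu]_(w in A) P (X s w) (X t @^-1` B))%E].

(** "u is the unique positive solution" is read as part of the definition. *)
Definition laplace_characterization :=
  forall phi : 'rV[R]_d -> R,
    (forall x, 0 <= phi x) -> continuous phi ->
    has_ubound (range (fun x => phi x / phi_p p x)) ->
  exists u, is_unique_solution phi u /\
    forall (mu : @tempered R d p) t, 0 <= t ->
      (\int[P mu]_w expeR (- \int[X t w]_x (phi x)%:E) =
       expeR (- \int[mu]_x (u t x)%:E))%E.

Definition is_super_brownian_motion := markov_process /\ laplace_characterization.

(** The law of the process when [X 0] is distributed as [Pi]. *)
Definition law_from (Pi : probability (@tempered R d p) R) (A : set Omega) :=
  (\int[Pi]_mu P mu A)%E.

(** The maximum with 0 only serves to make the supremum of the empty set 0; the
    value +oo is reached when [X t w] vanishes. *)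
Definition void_radius (t : R) (w : Omega) : \bar R :=
  maxe 0%E
    (ereal_sup [set u%:E | u in [set u | 0 < u /\ X t w (eball u) = 0%E]]).

End super_brownian_motion.

(** [Pi] is the law of a Poisson random measure with intensity [lambda]: Poisson
    counts, mutually independent over disjoint sets.  [poisson_prob] does not
    use its second argument; unlike [poisson_pmf], it is right at rate 0. *)
Definition is_PRM {R : realType} {d : nat} {p : R}
    (lambda : set 'rV[R]_d -> \bar R)
    (Pi : probability (@tempered R d p) R) :=
  (forall (A : set 'rV[R]_d) (k : nat), measurable A -> (lambda A < +oo)%E ->
     Pi [set mu : @tempered R d p | mu A = k%:R%:E] =
     poisson_prob (fine (lambda A)) 0 [set k]) /\
  (forall n (A : 'I_n -> set 'rV[R]_d) (B : 'I_n -> set (\bar R)),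
     (forall i, measurable (A i)) -> trivIset setT A ->
     (forall i, measurable (B i)) ->
     Pi [set mu : @tempered R d p | forall i, B i (mu (A i))] =
     (\prod_(i < n) Pi [set mu : @tempered R d p | B i (mu (A i))])%E).

(* Main.v *)
(** By the log-Laplace formula, the probability that X_t does not charge B(r)
    when started from mu is exp(-int U_r(t) dmu), where U_r is the increasing
    limit of the solutions started from k times a cutoff of B(r).  The Laplace
    functional of the Poisson random measure turns this into
    P(R_t >= r) = exp(-int (1 - exp(-U_r(t, x))) dx), where U_r <= 1/t makes the
    integrand asymptotic to U_r(t, x), and the parabolic scaling of the equation
    gives int U_r(t) = r^(d-2) int U_1(t / r^2).  It remains to see that
    int U_1(t) has a limit in (0, oo).

    Bounds on solutions come from comparison with explicit super- and
    subsolutions only: a barrier blowing up on the unit sphere shows that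
    int U_1(1) is finite, and for d >= 3 the Gaussian decay (1 + t)^(-3/2) makes
    the quadratic term harmless, so that solutions remain comparable to those of
    the linearized equation.  The linear semigroup itself is never constructed:
    it is represented by the mean measure Q_t of X_t under the law started from
    the Dirac mass at 0, as int f(z + x) Q_t(dz) is the limit of
    n (1 - exp(-u_n(t, x))), with u_n started from f / n.  Bounds on the mass of
    Q_t and Tonelli's theorem then show that the mass int u(t) of a solution is
    nonincreasing in t and stays away from 0. *)

From HB Require Import structures.
Require Import Defs.
From mathcomp Require Import all_boot all_order all_algebra.
From mathcomp Require Import all_classical all_reals all_analysis.
From mathcomp Require Import measurable_realfun.
From mathcomp Require Import ring lra.
Set Implicit Arguments.
Unset Strict Implicit.
Unset Printing Implicit Defensive.
Import Order.TTheory GRing.Theory Num.Theory.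
Import numFieldNormedType.Exports.
Local Open Scope classical_set_scope.
Local Open Scope ring_scope.

(** * Radial functions and comparison principles *)

Section calculus.
Context {R : realType}.

(** The hypotheses give solutions and their link with the law, but neither a heat kernel nor an
    integral form of the equation. Everything quantitative is therefore a pointwise differential
    inequality for an explicit profile. The same comparison theorem yields uniqueness, and from it
    the semigroup property, translation invariance and scaling of the evolution.

    All initial values live in one class: continuous nonnegative functions dominated by (1 +
    |x|^2)^(-m), where m >= d and 2m >= p. This weight is integrable for Lebesgue measure and for
    every measure of M_p, and the evolution multiplies the bound by at most e^(Kt), so the class is
    stable.

    Two inequalities tie the linear flow, the limit of n u_n, to the nonlinear one: u <= n u_n
    always, and n u_n <= 3u when the initial value lies below exp(-|x|^2/2). With mass of Q_t at
    most 1, the first makes the mass of a solution monotone; with that mass bounded below uniformly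
    in t, the second keeps it away from 0. Two-sided bounds on Q_t thus replace any exact knowledge
    of it, and kappa is obtained as a monotone limit rather than by a formula. *)

Lemma is_derive_line d (f : 'rV[R]_d -> R) x v df (t : R) :
  is_derive (t *: v + x) v f df <-> is_derive t 1 (fun h => f (h *: v + x)) df.
Proof.
have E : (fun h : R => h^-1 *: (((fun h => f (h *: v + x)) \o shift t) (h *: 1)
    - (fun h => f (h *: v + x)) t)) =
    (fun h : R => h^-1 *: ((f \o shift (t *: v + x)) (h *: v) - f (t *: v + x))).
  by apply/funext => h /=; rewrite [h *: 1]mulr1 scalerDl addrA.
split=> -[c <-]; split.
- by rewrite /derivable E.
- by rewrite /derive E.
- by move: c; rewrite /derivable E.
- by rewrite /derive E.
Qed.

Lemma is_derive_line0 d (f : 'rV[R]_d -> R) x v df :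
  is_derive x v f df <-> is_derive (0 : R) 1 (fun h => f (h *: v + x)) df.
Proof.
by have := is_derive_line f x v df 0; rewrite scale0r add0r.
Qed.

Lemma is_derive_quot (f : R -> R) (x df : R) : is_derive x 1 f df ->
  h^-1 * (f (x + h) - f x) @[h --> 0^'] --> df.
Proof.
move=> [c <-]; rewrite /derive.
have E : (fun h : R => h^-1 *: ((f \o shift x) (h *: 1) - f x)) =
    (fun h => h^-1 * (f (x + h) - f x)).
  by apply/funext => h /=; rewrite [h *: 1]mulr1 (addrC h).
by move: c; rewrite /derivable E.
Qed.

Lemma exists_lt_both (r e : R) : 0 < r -> 0 < e ->
  exists z, [/\ 0 < z, z < r & z < e].
Proof.
move=> r0 e0; have m0 : 0 < Num.min r e by rewrite lt_min r0.
exists (Num.min r e / 2); split; first by rewrite divr_gt0.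
  by rewrite (@lt_le_trans _ _ (Num.min r e))// ?ge_min ?lexx// ltr_pdivrMr//; lra.
by rewrite (@lt_le_trans _ _ (Num.min r e))// ?ge_min ?lexx ?orbT// ltr_pdivrMr//; lra.
Qed.

(** If [h2 > 0], then [h1] vanishes at 0 and is positive just to the right of it, so the mean value
    theorem makes [h] exceed [h 0] there. *)
Lemma second_derive_at_max (h h1 : R -> R) (h2 e : R) : 0 < e ->
  (forall z : R, `|z| < e -> is_derive z 1 h (h1 z)) ->
  is_derive (0 : R) 1 h1 h2 ->
  (forall z, `|z| < e -> h z <= h 0) -> h2 <= 0.
Proof.
move=> e0 dh dh1 hmax; rewrite leNgt; apply/negP => h20.
have h10 : h1 0 = 0.
  have d0 : is_derive (0 : R) 1 h (h1 0) by apply: dh; rewrite normr0.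
  have d0' : is_derive (0 : R) 1 h 0.
    apply: (@derive1_at_max _ h (- e) e).
    - lra.
    - by move=> t; rewrite in_itv/= -ltr_norml => /dh[].
    - by rewrite in_itv/= oppr_lt0 e0.
    - by move=> t; rewrite in_itv/= -ltr_norml => /hmax.
  by rewrite -(@derive_val _ _ _ _ _ _ _ d0) (@derive_val _ _ _ _ _ _ _ d0').
have := is_derive_quot dh1; move/cvgr_gt => /(_ _ h20) [r /= r0 hr].
have [z [z0 zr ze]] := exists_lt_both r0 e0.
have h1pos c : 0 < c -> c <= z -> 0 < h1 c.
  move=> c0 cz; have := hr c; rewrite /ball_/= sub0r normrN gtr0_norm//.
  move=> /(_ (le_lt_trans cz zr)); rewrite gt_eqF// => /(_ isT).
  by rewrite add0r h10 subr0 pmulr_rgt0 ?invr_gt0.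
have small t : 0 <= t -> t <= z -> `|t| < e.
  by move=> t0 tz; rewrite ger0_norm//; lra.
have [||c] := @MVT _ h h1 0 z z0.
- by move=> t; rewrite in_itv/= => /andP[t0 tz]; apply/dh/small; exact/ltW.
- apply: derivable_within_continuous => t; rewrite in_itv/= => /andP[t0 tz].
  by have [] := dh _ (small _ t0 tz).
rewrite in_itv/= => /andP[c0 cz] /eqP; rewrite subr_eq => /eqP hz.
have := hmax z (small _ (ltW z0) (lexx z)).
rewrite hz gerDr subr0; apply/negP; rewrite -ltNge mulr_gt0// h1pos//.
exact: ltW.
Qed.

(** Only times before [t] are examined, because a maximum over [0, T] may sit at the final time. *)
Lemma derive_ge0_at_left_max (h : R -> R) (t dh e : R) : 0 < e ->
  is_derive t 1 h dh -> (forall z, t - e < z < t -> h z <= h t) -> 0 <= dh.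
Proof.
move=> e0 /is_derive_quot hq hmax; rewrite leNgt; apply/negP => dh0.
move/cvgr_lt : hq => /(_ _ dh0) [r /= r0 hr].
have [z [z0 zr ze]] := exists_lt_both r0 e0.
have := hr (- z); rewrite /ball_/= sub0r opprK gtr0_norm// => /(_ zr).
rewrite oppr_eq0 gt_eqF// => /(_ isT).
rewrite invrN mulNr oppr_lt0 pmulr_rgt0 ?invr_gt0// subr_gt0.
apply/negP; rewrite -leNgt; apply: hmax; apply/andP; split; lra.
Qed.

(** Encoded by witnesses: first partials [D1] near [x], second partials [D2] at [x] alone. This is
    what the maximum principle tests, and it passes through sums, multiples and affine substitutions
    without continuity arguments. *)
Definition has_laplacian d (f : 'rV[R]_d -> R) x (l : R) :=
  exists (D1 : 'I_d -> 'rV[R]_d -> R) (D2 : 'I_d -> R),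
  [/\ forall i, \forall y \near x, is_derive y (delta_mx ord0 i) f (D1 i y),
      forall i, is_derive x (delta_mx ord0 i) (D1 i) (D2 i) &
      l = \sum_i D2 i].

Lemma has_laplacian_max d (f : 'rV[R]_d -> R) x l (D : set 'rV[R]_d) :
  open D -> D x -> (forall y, D y -> f y <= f x) -> has_laplacian f x l -> l <= 0.
Proof.
move=> oD Dx fmax [D1 [D2 [d1 d2 ->]]].
apply: sumr_le0 => i _.
move/(_ i) : d1 => d1; move/(_ i) : d2 => d2.
set v := delta_mx ord0 i in d1 d2.
have cl : {for 0, continuous (fun z : R => z *: v + x)}.
  by apply: cvgD; [exact: scalel_continuous|exact: cvg_cst].
have x0 : 0 *: v + x = x by rewrite scale0r add0r.
have nD : \forall z \near (0 : R), D (z *: v + x).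
  by apply: cl; rewrite /= x0; exact: open_nbhs_nbhs.
have nd : \forall z \near (0 : R), is_derive (z *: v + x) v f (D1 i (z *: v + x)).
  by apply: (cl (fun y => is_derive y v f (D1 i y))); rewrite /= x0; exact: d1.
have [e /= e0 he] := filterI nD nd.
apply: (@second_derive_at_max (fun z => f (z *: v + x))
   (fun z => D1 i (z *: v + x)) (D2 i) e e0).
- move=> z ze; apply/is_derive_line; have := he z; rewrite /ball_/= sub0r normrN.
  by move=> /(_ ze)[].
- exact/is_derive_line0.
- move=> z ze; rewrite x0; apply: fmax; have := he z; rewrite /ball_/= sub0r normrN.
  by move=> /(_ ze)[].
Qed.

Lemma has_laplacianD d (f g : 'rV[R]_d -> R) x l m :
  has_laplacian f x l -> has_laplacian g x m -> has_laplacian (f \+ g) x (l + m).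
Proof.
move=> [D1 [D2 [d1 d2 ->]]] [E1 [E2 [e1 e2 ->]]].
exists (fun i => D1 i \+ E1 i), (fun i => D2 i + E2 i); split=> [i|i|].
- by near=> y; apply: is_deriveD; [near: y; exact: d1|near: y; exact: e1].
- exact: is_deriveD.
- by rewrite big_split.
Unshelve. all: by end_near. Qed.

Lemma has_laplacianZ d (f : 'rV[R]_d -> R) x l (c : R) :
  has_laplacian f x l -> has_laplacian (c \*: f) x (c * l).
Proof.
move=> [D1 [D2 [d1 d2 ->]]].
exists (fun i => c \*: D1 i), (fun i => c * D2 i); split=> [i|i|].
- by near=> y; apply: is_deriveZ; near: y; exact: d1.
- exact: is_deriveZ.
- by rewrite mulr_sumr.
Unshelve. all: by end_near. Qed.

Lemma has_laplacianB d (f g : 'rV[R]_d -> R) x l m :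
  has_laplacian f x l -> has_laplacian g x m -> has_laplacian (f \- g) x (l - m).
Proof.
move=> fl gm; rewrite -mulN1r.
have -> : f \- g = f \+ (-1 \*: g) by apply/funext => y /=; rewrite scaleN1r.
exact/has_laplacianD/has_laplacianZ.
Qed.

Lemma has_laplacian_cst d (c : R) (x : 'rV[R]_d) : has_laplacian (cst c) x 0.
Proof.
exists (fun _ => cst 0), (fun _ => 0); split=> [i|i|]; last by rewrite big1.
  by near=> y; exact: is_derive_cst.
exact: is_derive_cst.
Unshelve. all: by end_near. Qed.

(** Radial profiles are written as functions of |x|^2, a polynomial, so that the origin is not a
    singular point. *)
Definition sqnorm d (x : 'rV[R]_d) : R := \sum_i x ord0 i ^+ 2.

Lemma sqnorm_ge0 d (x : 'rV[R]_d) : 0 <= sqnorm x.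
Proof. by apply: sumr_ge0 => i _; exact: sqr_ge0. Qed.

Lemma continuous_sqnorm d : continuous (@sqnorm d).
Proof.
apply: continuous_big => [|i _ x]; first exact: add_continuous.
exact: (continuous_comp (@coord_continuous _ _ _ ord0 i x)
  (@exprn_continuous R 2 _)).
Qed.

Lemma sqnorm_line d (x : 'rV[R]_d) i z :
  sqnorm (z *: delta_mx ord0 i + x) = sqnorm x + 2 * z * x ord0 i + z ^+ 2.
Proof.
rewrite /sqnorm (bigD1 i)//= [in RHS](bigD1 i)//= !mxE !eqxx/=.
rewrite (eq_bigr (fun j => x ord0 j ^+ 2)); first by ring.
by move=> j /negPf ji; rewrite !mxE ji andbF mulr0 add0r.
Qed.

Lemma is_derive_radial d (h : R -> R) h1 (x : 'rV[R]_d) i :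
  is_derive (sqnorm x) 1 h h1 ->
  is_derive x (delta_mx ord0 i) (h \o @sqnorm d) (2 * x ord0 i * h1).
Proof.
move=> hh.
apply/is_derive_line0.
have -> : (fun z : R => (h \o @sqnorm d) (z *: delta_mx ord0 i + x)) =
   h \o (fun z => sqnorm x + 2 * z * x ord0 i + z ^+ 2).
  by apply/funext => z /=; rewrite sqnorm_line.
set g := (fun z : R => _).
have g0 : g 0 = sqnorm x by rewrite /g mulr0 mul0r addr0 expr0n addr0.
have dg : is_derive (0 : R) 1 g (2 * x ord0 i).
  by apply: is_derive_eq; rewrite /= /GRing.scale/=; ring.
rewrite -g0 in hh.
by apply: (is_derive_eq (@is_derive1_comp _ _ _ _ _ _ hh dg)); rewrite mulrC.
Qed.

Lemma is_derive_coord d (x : 'rV[R]_d) i :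
  is_derive x (delta_mx ord0 i) (fun y => y ord0 i) (1 : R).
Proof.
apply/is_derive_line0.
have -> : (fun z : R => (z *: delta_mx ord0 i + x) ord0 i) = (fun z => z + x ord0 i).
  by apply/funext => z; rewrite !mxE !eqxx mulr1.
by apply: is_derive_eq; rewrite addr0.
Qed.

Lemma has_laplacian_radial d (h h1 : R -> R) (h2 : R) (x : 'rV[R]_d) :
  (\forall s \near sqnorm x, is_derive (s : R) 1 h (h1 s)) ->
  is_derive (sqnorm x) 1 h1 h2 ->
  has_laplacian (h \o @sqnorm d) x
    (2 * d%:R * h1 (sqnorm x) + 4 * sqnorm x * h2).
Proof.
move=> dh dh1.
exists (fun i (y : 'rV[R]_d) => 2 * y ord0 i * h1 (sqnorm y)),
  (fun i => 2 * h1 (sqnorm x) + 4 * x ord0 i ^+ 2 * h2); split=> [i|i|].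
- near=> y; apply: is_derive_radial.
  by near: y; exact: (@continuous_sqnorm d x _ dh).
- have dc := is_derive_coord x i; have dr := is_derive_radial i dh1.
  have := @is_deriveM _ _ _ _ _ _ _ _ (@is_deriveZ _ _ _ _ 2 _ _ _ dc) dr.
  by move=> H; apply: (is_derive_eq H); rewrite /= /GRing.scale/=; ring.
- rewrite big_split/= sumr_const card_ord -mulr_suml -mulr_sumr -/(sqnorm x).
  by rewrite -mulr_natl; ring.
Unshelve. all: by end_near. Qed.

End calculus.

(** * Maximum principle and local comparison *)

Section comparison.
Context {R : realType}.

(** At a positive maximum over [0, T] x K the time derivative is nonnegative and the Laplacian
    nonpositive, against the strict inequality. [K] supplies compactness; since [f] is nonpositive
    on the rest of [D], the maximum is also one over the open set [D], where the Laplacian can be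
    tested. *)
Lemma max_principle d (T : R) (D K : set 'rV[R]_d) (f : R -> 'rV[R]_d -> R) :
  open D -> compact K -> K `<=` D ->
  {within `[0, T] `*` K, continuous (fun q => f q.1 q.2)} ->
  (forall t x, 0 < t <= T -> D x -> 0 < f t x -> exists a l,
    [/\ is_derive t 1 (f ^~ x) a, has_laplacian (f t) x l & a < 2^-1 * l]) ->
  (forall x, D x -> f 0 x <= 0) ->
  (forall t x, 0 <= t <= T -> D x -> ~ K x -> f t x <= 0) ->
  forall t x, 0 <= t <= T -> D x -> f t x <= 0.
Proof.
move=> oD cK KD cf df f0 fK t1 x1 t1T Dx1; rewrite leNgt; apply/negP => f1.
have Kx1 : K x1 by apply: contrapT => /(fK _ _ t1T Dx1); rewrite leNgt f1.
have A1 : (`[0, T] `*` K) (t1, x1) by split => //=; rewrite in_itv.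
have A0 : `[0, T] `*` K !=set0 by exists (t1, x1).
have cA : compact (`[0, T] `*` K) by apply: compact_setX => //; exact: segment_compact.
have [[t0 x0] /set_mem[/= t0T Kx0] fmax] := compact_EVT_max A0 cA cf.
have f00 : 0 < f t0 x0 by rewrite (lt_le_trans f1)//; exact: (fmax (t1, x1) (mem_set A1)).
rewrite in_itv/= in t0T; have [t00 t0T'] := andP t0T.
have t0p : 0 < t0.
  rewrite lt_neqAle t00 andbT; apply/eqP => t0E.
  by move: f00; rewrite -t0E ltNge f0//; exact: KD.
have [|a [l [da dl al]]] := df t0 x0 _ (KD _ Kx0) f00; first by rewrite t0p.
have l0 : l <= 0.
  apply: (has_laplacian_max oD (KD _ Kx0) _ dl) => y Dy.
  have [Ky|nKy] := pselect (K y).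
    by apply: (fmax (t0, y)); rewrite inE; split => //=; rewrite in_itv.
  by rewrite (le_trans (fK _ _ t0T Dy nKy))// ltW.
have a0 : 0 <= a.
  apply: (derive_ge0_at_left_max t0p da) => z /andP[z0 zt].
  apply: (fmax (z, x0)); rewrite inE; split => //=; rewrite in_itv/=.
  by rewrite subrr in z0; rewrite (ltW z0)/= (le_trans (ltW zt)).
by move: al; rewrite ltNge (le_trans _ a0)// pmulr_rle0.
Qed.

Definition subsol d (u : R -> 'rV[R]_d -> R) (t : R) x := exists a l,
  [/\ is_derive t 1 (u ^~ x) a, has_laplacian (u t) x l &
      a <= 2^-1 * l - u t x ^+ 2].

Definition supersol d (u : R -> 'rV[R]_d -> R) (t : R) x := exists a l,
  [/\ is_derive t 1 (u ^~ x) a, has_laplacian (u t) x l &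
      2^-1 * l - u t x ^+ 2 <= a].

(** Adding the stationary supersolution [B] to [V] gives a supersolution, as (V + B)^2 >= V^2 + B^2
    for nonnegative values. Where w > V + B the quadratic terms differ strictly, which is the
    strictness [max_principle] asks for; no perturbation is introduced. *)
Lemma comparison_local d (T : R) (D K : set 'rV[R]_d)
    (w V : R -> 'rV[R]_d -> R) (B : 'rV[R]_d -> R) :
  open D -> compact K -> K `<=` D ->
  {within `[0, T] `*` K, continuous (fun q => w q.1 q.2)} ->
  {within `[0, T] `*` K, continuous (fun q => V q.1 q.2)} ->
  (forall x, D x -> {for x, continuous B}) ->
  (forall t x, 0 < t <= T -> D x -> subsol w t x) ->
  (forall t x, 0 < t <= T -> D x -> supersol V t x /\ 0 <= V t x) ->
  (forall x, D x -> 0 <= B x /\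
    exists2 m, has_laplacian B x m & 2^-1 * m <= B x ^+ 2) ->
  (forall x, D x -> w 0 x <= V 0 x + B x) ->
  (forall t x, 0 <= t <= T -> D x -> ~ K x -> w t x <= V t x + B x) ->
  forall t x, 0 <= t <= T -> D x -> w t x <= V t x + B x.
Proof.
move=> oD cK KD cw cV cB sw sV sB w0 wK t x tT Dx.
rewrite -subr_le0.
apply: (@max_principle d T D K (fun t x => w t x - (V t x + B x)) oD cK KD) => //.
- apply/subspace_continuousP => q qA.
  move/subspace_continuousP : cw => /(_ _ qA) cw.
  move/subspace_continuousP : cV => /(_ _ qA) cV.
  apply: cvgB => //; apply: cvgD => //.
  apply: cvg_within_filter.
  apply: (@continuous_comp _ _ _ snd B); first exact: cvg_snd.
  exact/cB/KD/(proj2 qA).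
- move=> {t x tT Dx} t x tT Dx; rewrite subr_gt0 => Vw.
  have [a [l [da dl al]]] := sw _ _ tT Dx.
  have [[b [m [db dm bm]]] V0] := sV _ _ tT Dx.
  have [B0 [k dk Bk]] := sB _ Dx.
  exists (a - (b + 0)), (l - (m + k)); split.
  + exact: is_deriveB.
  + by apply: has_laplacianB => //; exact: has_laplacianD.
  + have : (V t x + B x) ^+ 2 < w t x ^+ 2 by rewrite ltr_pXn2r// nnegrE; lra.
    have : V t x ^+ 2 + B x ^+ 2 <= (V t x + B x) ^+ 2.
      by have := mulr_ge0 V0 B0; nra.
    lra.
- by move=> y Dy; rewrite subr_le0 w0.
- by move=> s y sT Dy nK; rewrite subr_le0 wK.
Qed.

End comparison.

(** * Comparison on the whole space *)

Section whole_space.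
Context {R : realType}.

(** One family for all rational profiles: (rho, -1) for the barrier, (1, 1) for the decaying weight,
    (-1, 1) for the blow-up on the unit sphere and, as a function of time, (e, 1) for the solution
    1/(e + t) of z' = -z^2. *)
Definition powinv (a b : R) m (s : R) : R := (a + b * s)^-1 ^+ m.

Lemma is_derive_powinv (a b : R) m (s : R) : a + b * s != 0 ->
  is_derive s 1 (powinv a b m) (- (m%:R * b) * powinv a b m.+1 s).
Proof.
move=> s0.
have dl : is_derive s 1 (fun s => a + b * s) b.
  by apply: is_derive_eq; rewrite /GRing.scale/=; ring.
have di := @is_deriveV _ (fun s => a + b * s) s _ 1 s0 dl.
case: m => [|m].
  have -> : powinv a b 0 = cst 1 by apply/funext => z; rewrite /powinv expr0.
  by apply: is_derive_eq; rewrite mul0r oppr0 mul0r.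
have H := @is_deriveX _ _ _ m.+1 _ _ _ di.
have -> : powinv a b m.+1 = (fun s => (a + b * s)^-1) ^+ m.+1.
  by apply/funext => z; rewrite /powinv exprfctE.
apply: (is_derive_eq H); rewrite /powinv /GRing.scale/= -!exprVn !exprS.
by ring.
Qed.

Lemma continuous_powinv_sqnorm d (a b : R) m (x : 'rV[R]_d) :
  a + b * sqnorm x != 0 -> {for x, continuous (powinv a b m \o @sqnorm R d)}.
Proof.
move=> s0; apply: continuous_comp; first exact: continuous_sqnorm.
apply: differentiable_continuous; apply/derivable1_diffP.
by case: (is_derive_powinv m s0).
Qed.

Lemma has_laplacian_powinv d (a b : R) m (x : 'rV[R]_d) :
  a + b * sqnorm x != 0 ->
  has_laplacian (powinv a b m \o @sqnorm R d) x
   (2 * d%:R * (- (m%:R * b) * powinv a b m.+1 (sqnorm x)) +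
    4 * sqnorm x * (m%:R * m.+1%:R * b ^+ 2 * powinv a b m.+2 (sqnorm x))).
Proof.
move=> s0.
apply: (@has_laplacian_radial _ _ _ (fun s => - (m%:R * b) * powinv a b m.+1 s)).
  have /cvgr_neq0 : a + b * s @[s --> sqnorm x] --> a + b * sqnorm x.
    by apply: cvgD; [exact: cvg_cst|apply: cvgM; [exact: cvg_cst|exact: cvg_id]].
  by move=> /(_ s0); apply: filterS => s; exact: is_derive_powinv.
have H := @is_deriveZ _ _ _ _ (- (m%:R * b)) _ _ _ (is_derive_powinv m.+1 s0).
by apply: (is_derive_eq H); rewrite /GRing.scale/=; ring.
Qed.

Lemma compact_shell d (a b : R) : compact [set x : 'rV[R]_d | a <= sqnorm x <= b].
Proof.
apply: bounded_closed_compact; last first.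
  rewrite (_ : mkset _ = @sqnorm R d @^-1` `[a, b]); last first.
    by apply/seteqP; split => x; rewrite /= in_itv.
  by apply: closed_comp => [x _|]; [exact: continuous_sqnorm|exact: interval_closed].
exists (1 + `|b|); split; first by rewrite num_real.
move=> M bM x /= /andP[_ xb].
rewrite [leLHS]/Num.norm/= mx_normrE; apply: bigmax_le => [|[i j] _] /=.
  by rewrite (le_trans _ (ltW bM))// addr_ge0.
have : x i j ^+ 2 <= b.
  rewrite (le_trans _ xb)// /sqnorm (bigD1 j)//= (ord1 i) lerDl.
  by apply: sumr_ge0 => k _; exact: sqr_ge0.
rewrite -real_normK ?num_real// => h.
have : b <= `|b| := ler_norm b.
have : 0 <= `|x i j| by [].
nra.
Qed.

Definition cont0 d (u : R -> 'rV[R]_d -> R) :=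
  {within [set q : R * 'rV[R]_d | 0 <= q.1], continuous (fun q => u q.1 q.2)}.

Lemma cont0_shell d (u : R -> 'rV[R]_d -> R) T a b : cont0 u ->
  {within `[0, T] `*` [set x : 'rV[R]_d | a <= sqnorm x <= b],
    continuous (fun q => u q.1 q.2)}.
Proof.
apply: continuous_subspaceW => -[t x] /= [].
by rewrite in_itv/= => /andP[].
Qed.

Lemma cont0_bounded d (u : R -> 'rV[R]_d -> R) T b : 0 <= T -> cont0 u ->
  exists2 M, 0 <= M & forall t x, 0 <= t <= T -> sqnorm x <= b -> u t x <= M.
Proof.
move=> T0 cu.
have [b0|b0] := ltP b 0.
  exists 0 => // t x _ xb.
  by have := sqnorm_ge0 x; rewrite leNgt (le_lt_trans xb).
set A := `[0, T] `*` [set x : 'rV[R]_d | 0 <= sqnorm x <= b].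
have cA : compact A.
  by apply: compact_setX; [exact: segment_compact|exact: compact_shell].
have A0 : A !=set0.
  exists (0, 0); split => /=; first by rewrite in_itv/= lexx.
  by rewrite /sqnorm big1 ?lexx// => i _; rewrite mxE expr0n.
have [[t0 x0] _ umax] := compact_EVT_max A0 cA (cont0_shell (a := 0) (b := b) cu).
exists (Num.max 0 (u t0 x0)); first by rewrite le_max lexx.
move=> t x tT xb; rewrite le_max; apply/orP; right.
apply: (umax (t, x)); rewrite inE; split => /=; first by rewrite in_itv.
by rewrite sqnorm_ge0.
Qed.

Lemma open_sqnorm_lt d (a b : R) : open [set x : 'rV[R]_d | a < sqnorm x < b].
Proof.
rewrite (_ : mkset _ = @sqnorm R d @^-1` `]a, b[); last first.
  by apply/seteqP; split => x; rewrite /= in_itv.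
by apply: open_comp => [x _|]; [exact: continuous_sqnorm|exact: interval_open].
Qed.

(* The blow-up barrier rho (2 d + 12) / (rho - |x|^2)^2 of the ball |x|^2 < rho
   (a stationary supersolution): it tends to 0 as rho grows, so that comparison
   needs no growth condition. *)
Definition barrier d (rho : R) (x : 'rV[R]_d) : R :=
  ((2 * d%:R + 12) * rho) * powinv rho (-1) 2 (sqnorm x).

Lemma barrier_ge0 d (rho : R) (x : 'rV[R]_d) : 0 <= rho -> 0 <= barrier rho x.
Proof.
move=> r0; rewrite /barrier mulr_ge0 ?sqr_ge0// mulr_ge0// addr_ge0// mulr_ge0//.
Qed.

Lemma continuous_barrier d (rho : R) (x : 'rV[R]_d) : sqnorm x < rho ->
  {for x, continuous (barrier rho)}.
Proof.
move=> xr; have nz : rho + -1 * sqnorm x != 0 by rewrite mulN1r subr_eq0 gt_eqF.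
have cp := @continuous_powinv_sqnorm d rho (-1) 2 x nz.
exact: (cvgM (cvg_cst ((2 * d%:R + 12) * rho)) cp).
Qed.

(** Put s = |x|^2, v = 1/(rho - s) and c = (2d + 12) rho. Half the Laplacian is c (2d (rho - s) + 12
    s) v^4, and the bracket is at most c, so this is at most the square c^2 v^4. *)
Lemma barrier_supersol d (rho : R) (x : 'rV[R]_d) : sqnorm x < rho ->
  exists2 m, has_laplacian (barrier rho) x m & 2^-1 * m <= barrier rho x ^+ 2.
Proof.
move=> xr; have x0 := sqnorm_ge0 x.
have nz : rho + -1 * sqnorm x != 0 by rewrite mulN1r subr_eq0 gt_eqF.
eexists; first exact/has_laplacianZ/has_laplacian_powinv.
rewrite /barrier /powinv; set s := sqnorm x in x0 xr nz *.
set v := (rho + -1 * s)^-1.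
have v0 : 0 < v by rewrite invr_gt0 mulN1r subr_gt0.
have vE : (rho - s) * v = 1 by rewrite /v -[- s]mulN1r divff.
have d0 : (0 : R) <= d%:R by [].
have e3 : v ^+ 3 = (rho - s) * v ^+ 4 by rewrite [in RHS]exprS mulrA vE mul1r.
rewrite e3.
have v4 : 0 <= v ^+ 4 by rewrite exprn_ge0// ltW.
apply: (@le_trans _ _ ((2 * d%:R + 12) * rho *
    (d%:R * 2 * (rho - s) + 12 * s) * v ^+ 4)).
  by rewrite le_eqVlt; apply/orP; left; apply/eqP; field.
apply: (@le_trans _ _ ((2 * d%:R + 12) * rho * ((2 * d%:R + 12) * rho) * v ^+ 4)); last first.
  by rewrite le_eqVlt; apply/orP; left; apply/eqP; ring.
apply: ler_wpM2r => //; apply: ler_wpM2l; first by rewrite mulr_ge0//; lra.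
have := mulr_ge0 d0 x0; nra.
Qed.

Lemma barrier_blowup d (rho M : R) : 0 < rho -> 0 <= M ->
  exists2 k, k < rho & forall x : 'rV[R]_d, k < sqnorm x < rho -> M <= barrier rho x.
Proof.
move=> r0 M0; pose c : R := (2 * d%:R + 12) * rho.
have c0 : 0 < c by rewrite /c mulr_gt0// ltr_wpDl// mulr_ge0.
have Mc0 : 0 < M + c by rewrite ltr_wpDl.
(* For z = rho - |x|^2 below c / (M + c) <= 1, one has M z^2 <= M z <= c. *)
exists (rho - c / (M + c)); first by rewrite ltrBlDr ltrDl divr_gt0.
move=> x /andP[kx xr]; rewrite /barrier /powinv -/c.
set z := rho + -1 * sqnorm x.
have z0 : 0 < z by rewrite /z; lra.
have zc : z < c / (M + c) by rewrite /z; lra.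
have z1 : z < 1 by rewrite (lt_le_trans zc)// ler_pdivrMr// mul1r; lra.
rewrite ltr_pdivlMr// in zc.
rewrite exprVn ler_pdivlMr ?exprn_gt0//.
have : z * z <= z by rewrite ger_pMr// ltW.
have := mulr_ge0 M0 (ltW z0); nra.
Qed.

Lemma barrier_vanish d (x : 'rV[R]_d) (e : R) :
  (forall rho, sqnorm x < rho -> e <= barrier rho x) -> e <= 0.
Proof.
move=> H; rewrite leNgt; apply/negP => e0; set s := sqnorm x in H.
have s0 : 0 <= s := sqnorm_ge0 x.
pose c : R := 2 * d%:R + 12.
have c0 : 0 < c by rewrite /c ltr_wpDl// mulr_ge0.
(* At rho = s + z the barrier is c (s + z) / z^2 <= c (s + 1) / z < e; the summand 1 ensures z >
   1. *)
pose z := 1 + c * (s + 1) / e.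
have z1 : 1 < z by rewrite ltrDl divr_gt0// mulr_gt0//; lra.
have := H (s + z); rewrite ltrDl => /(_ (lt_trans ltr01 z1)).
apply/negP; rewrite -ltNge /barrier /powinv -/c -/s.
have -> : s + z + -1 * s = z by ring.
rewrite exprVn ltr_pdivrMr ?exprn_gt0//; last lra.
have : c * (s + 1) < z * e by rewrite [ltRHS]mulrDl mul1r divfK ?gt_eqF//; lra.
have : s + z <= (s + 1) * z by nra.
nra.
Qed.

Theorem comparison d (w V : R -> 'rV[R]_d -> R) :
  cont0 w -> cont0 V -> (forall t x, 0 <= t -> 0 <= V t x) ->
  (forall t x, 0 < t -> subsol w t x) ->
  (forall t x, 0 < t -> supersol V t x) ->
  (forall x, w 0 x <= V 0 x) ->
  forall t x, 0 <= t -> w t x <= V t x.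
Proof.
move=> cw cV V0 sw sV w0 t x t0.
suff H rho : sqnorm x < rho -> w t x <= V t x + barrier rho x.
  rewrite -subr_le0; apply: (@barrier_vanish d x) => rho /H.
  by rewrite lerBlDl.
move=> xr.
have r0 : 0 < rho by rewrite (le_lt_trans (sqnorm_ge0 x)).
have [M M0 wM] := cont0_bounded rho t0 cw.
have [k kr kB] := @barrier_blowup d rho M r0 M0.
(* [M] bounds [w] on |y|^2 <= rho and the barrier exceeds [M] for k < |y|^2 < rho, so |y|^2 <= k is
   the compact core. The bound -1 holds everywhere and casts the ball as an open shell. *)
apply: (@comparison_local _ _ t [set y | -1 < sqnorm y < rho]
    [set y | 0 <= sqnorm y <= k]) => //=.
- exact: open_sqnorm_lt.
- exact: compact_shell.
- move=> y /= /andP[y0 yk]; rewrite (le_lt_trans yk)// andbT.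
  exact: lt_le_trans y0.
- exact: cont0_shell.
- exact: cont0_shell.
- by move=> y /andP[_]; exact: continuous_barrier.
- by move=> s y /andP[s0 _] _; exact: sw.
- by move=> s y /andP[s0 _] _; split; [exact: sV|exact/V0/ltW].
- move=> y /andP[_ yr]; split; first exact/barrier_ge0/ltW.
  exact: barrier_supersol.
- by move=> y _; rewrite (le_trans (w0 y))// lerDl barrier_ge0// ltW.
- move=> s y sT /andP[_ yr] /negP; rewrite sqnorm_ge0/= -ltNge => ky.
  rewrite (le_trans (wM _ _ sT (ltW yr)))// (le_trans (kB y _)) ?ky//.
  by rewrite lerDr V0//; case/andP : sT.
- by rewrite t0 lexx.
- by rewrite xr (lt_le_trans _ (sqnorm_ge0 x)).
Qed.

End whole_space.

(** * Solutions read pointwise, and their invariances *)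

Section weak_solutions.
Context {R : realType} {d : nat}.
Implicit Types (u v : R -> 'rV[R]_d -> R) (phi psi : 'rV[R]_d -> R).

Lemma is_derive_affine (f : 'rV[R]_d -> R) (c : R) (x y v : 'rV[R]_d) df :
  is_derive (c *: x + y) v f df -> is_derive x v (fun z => f (c *: z + y)) (c * df).
Proof.
move=> /is_derive_line0 df0; apply/is_derive_line0.
have -> : (fun h : R => f (c *: (h *: v + x) + y)) =
   (fun h => f (h *: v + (c *: x + y))) \o (fun h => c * h).
  by apply/funext => h /=; rewrite scalerDr scalerA addrA.
have d1 : is_derive (0 : R) 1 (fun h : R => c * h) c.
  by apply: is_derive_eq; rewrite /GRing.scale/= mulr1.
rewrite mulrC; apply: is_derive1_comp; by rewrite mulr0.
Qed.

Lemma continuous_affine (c : R) (y : 'rV[R]_d) :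
  continuous (fun x : 'rV[R]_d => c *: x + y).
Proof.
by move=> x; exact: (cvgD (@scaler_continuous _ 'rV[R]_d c x) (cvg_cst y)).
Qed.

Lemma has_laplacian_affine (f : 'rV[R]_d -> R) (c : R) (x y : 'rV[R]_d) l :
  has_laplacian f (c *: x + y) l ->
  has_laplacian (fun z => f (c *: z + y)) x (c ^+ 2 * l).
Proof.
move=> [D1 [D2 [d1 d2 ->]]].
exists (fun i z => c * D1 i (c *: z + y)), (fun i => c ^+ 2 * D2 i); split.
- move=> i; near=> z; apply: is_derive_affine; near: z.
  exact: (@continuous_affine c y x _ (d1 i)).
- move=> i; have H := @is_deriveZ _ _ _ _ c _ _ _ (is_derive_affine (d2 i)).
  by apply: (is_derive_eq H); rewrite /GRing.scale/= mulrA.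
- by rewrite mulr_sumr.
Unshelve. all: by end_near. Qed.

(** The equation is kept in pointwise form, so that shifts, translations and rescalings of solutions
    are solutions by the chain rule alone; uniqueness in this class comes from [comparison]. *)
Definition wsol phi u :=
  [/\ forall t x, 0 <= t -> 0 <= u t x,
      cont0 u,
      forall (t : R) x, 0 < t -> exists a l, [/\ is_derive t 1 (u ^~ x) a,
        has_laplacian (u t) x l & a = 2^-1 * l - u t x ^+ 2] &
      forall x, u 0 x = phi x].

Lemma is_solution_wsol phi u : is_solution phi u -> wsol phi u.
Proof.
move=> [u0 cu uC ueq uphi]; split => // t x t0.
exists (derive1 (u ^~ x) t), (laplacian (u t) x); split; last exact: ueq.
  by rewrite derive1E; have [/derivableP] := uC t x t0.
exists (fun i => pd i (u t)), (fun i => pd i (pd i (u t)) x); split => // i.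
  by near=> y; apply/derivableP; have [_ _ /(_ i)[]] := uC t y t0.
by apply/derivableP; have [_ _ /(_ i)[_ _ /(_ i)[]]] := uC t x t0.
Unshelve. all: by end_near. Qed.

Lemma wsol_subsol phi u t x : wsol phi u -> 0 < t -> subsol u t x.
Proof.
by move=> [_ _ + _] t0 => /(_ _ x t0)[a [l [da dl aE]]]; exists a, l; split=> //; rewrite aE.
Qed.

Lemma wsol_supersol phi u t x : wsol phi u -> 0 < t -> supersol u t x.
Proof.
by move=> [_ _ + _] t0 => /(_ _ x t0)[a [l [da dl aE]]]; exists a, l; split=> //; rewrite aE.
Qed.

Lemma wsol_le_supersol phi u V : wsol phi u -> cont0 V ->
  (forall t x, 0 <= t -> 0 <= V t x) -> (forall t x, 0 < t -> supersol V t x) ->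
  (forall x, phi x <= V 0 x) -> forall t x, 0 <= t -> u t x <= V t x.
Proof.
move=> su cV V0 sV phiV; have [u0 cu _ uphi] := su.
apply: comparison => //; last by move=> x; rewrite uphi; exact: phiV.
by move=> t x; exact: (wsol_subsol _ su).
Qed.

Lemma subsol_le_wsol phi u w : wsol phi u -> cont0 w ->
  (forall t x, 0 < t -> subsol w t x) ->
  (forall x, w 0 x <= phi x) -> forall t x, 0 <= t -> w t x <= u t x.
Proof.
move=> su cw sw phiw; have [u0 cu _ uphi] := su.
apply: comparison => //; last by move=> x; rewrite uphi; exact: phiw.
by move=> t x; exact: (wsol_supersol _ su).
Qed.

Lemma wsol_le phi psi u v : wsol phi u -> wsol psi v ->
  (forall x, phi x <= psi x) -> forall t x, 0 <= t -> u t x <= v t x.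
Proof.
move=> su sv phipsi; have [v0 cv _ vpsi] := sv.
apply: (wsol_le_supersol su cv v0) => [t x|x]; first exact: (wsol_supersol _ sv).
by rewrite vpsi; exact: phipsi.
Qed.

Lemma wsol_unique phi u v : wsol phi u -> wsol phi v ->
  forall t x, 0 <= t -> u t x = v t x.
Proof.
move=> su sv t x t0; apply/eqP; rewrite eq_le.
by rewrite (wsol_le su sv)// (wsol_le sv su).
Qed.

Lemma cont0_at u : (forall t x, 0 <= t ->
  {for (t, x), continuous (fun q => u q.1 q.2)}) -> cont0 u.
Proof.
move=> H; apply: continuous_in_subspaceT => -[t x] /set_mem /= t0.
exact: H.
Qed.

Lemma cont0_mul (A : R -> R) (h : 'rV[R]_d -> R) :
  (forall t, 0 <= t -> {for t, continuous A}) -> continuous h ->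
  cont0 (fun t x => A t * h x).
Proof.
move=> cA ch; apply: cont0_at => t x t0; apply: cvgM.
  by apply: (@continuous_comp _ _ _ fst A); [exact: cvg_fst|exact: cA].
by apply: (@continuous_comp _ _ _ snd h); [exact: cvg_snd|exact: ch].
Qed.

Lemma cont0_comp u (F : R * 'rV[R]_d -> R * 'rV[R]_d) : continuous F ->
  (forall q, 0 <= q.1 -> 0 <= (F q).1) -> cont0 u ->
  cont0 (fun t x => u (F (t, x)).1 (F (t, x)).2).
Proof.
move=> cF F0 /subspace_continuousP cu; apply/subspace_continuousP => -[t x] /= t0.
have -> : (fun q : R * 'rV[R]_d => u (F (q.1, q.2)).1 (F (q.1, q.2)).2) =
    (fun q => u q.1 q.2) \o F by apply/funext => -[].
have Fw : F q @[q --> within [set q | 0 <= q.1] (nbhs (t, x))] -->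
    within [set q | 0 <= q.1] (nbhs (F (t, x))).
  move=> A FA; have : nbhs (t, x) (F @^-1` [set z | 0 <= z.1 -> A z]).
    exact: (cF (t, x) _ FA).
  suff : F @^-1` [set z | 0 <= z.1 -> A z] `<=` [set q | 0 <= q.1 -> A (F q)].
    exact: filterS.
  by move=> q /= h q0; exact/h/F0.
exact: (cvg_comp _ _ Fw (cu (F (t, x)) (F0 (t, x) t0))).
Qed.

(* Time shift, translation and the parabolic scaling of the equation at once. *)
Lemma wsol_affine phi u (s c : R) (y : 'rV[R]_d) : 0 <= s -> 0 < c -> wsol phi u ->
  wsol (fun x => c ^+ 2 * u s (c *: x + y))
       (fun t x => c ^+ 2 * u (s + c ^+ 2 * t) (c *: x + y)).
Proof.
move=> s0 c0 [u0 cu ueq _].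
have c20 : 0 < c ^+ 2 by rewrite exprn_gt0.
split.
- move=> t x t0; apply: mulr_ge0; first exact: ltW.
  by apply: u0; rewrite addr_ge0// mulr_ge0// ltW.
- pose F (q : R * 'rV[R]_d) := (s + c ^+ 2 * q.1, c *: q.2 + y).
  have cF : continuous F.
    have c1 : continuous (fun q : R * 'rV[R]_d => s + c ^+ 2 * q.1).
      by move=> q; apply: cvgD; [exact: cvg_cst|apply: cvgM; [exact: cvg_cst|exact: cvg_fst]].
    have c2 : continuous (fun q : R * 'rV[R]_d => c *: q.2 + y).
      move=> q; apply: (@continuous_comp _ _ _ snd (fun x : 'rV[R]_d => c *: x + y)).
        exact: cvg_snd.
      exact: continuous_affine.
    by move=> q; exact: (cvg_pair (c1 q) (c2 q)).
  have cuF : cont0 (fun t x => u (F (t, x)).1 (F (t, x)).2).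
    by apply: cont0_comp => // q q0 /=; rewrite addr_ge0// mulr_ge0// ltW.
  move/subspace_continuousP : cuF => cuF; apply/subspace_continuousP => q q0.
  by apply: cvgM; [exact: cvg_cst|exact: cuF].
- move=> t x t0; have st : 0 < s + c ^+ 2 * t by rewrite ltr_wpDl// mulr_gt0.
  have [a [l [da dl aE]]] := ueq _ (c *: x + y) st.
  exists (c ^+ 2 * (a * c ^+ 2)), (c ^+ 2 * (c ^+ 2 * l)); split.
  + have dt : is_derive t 1 (fun t => s + c ^+ 2 * t) (c ^+ 2).
      by apply: is_derive_eq; rewrite /GRing.scale/=; ring.
    have dc := @is_derive1_comp _ (u ^~ (c *: x + y)) (fun t => s + c ^+ 2 * t) t _ _ da dt.
    exact: (@is_deriveZ _ _ _ _ (c ^+ 2) _ _ _ dc).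
  + exact/has_laplacianZ/has_laplacian_affine.
  + by rewrite aE; ring.
- by move=> x; rewrite mulr0 addr0.
Qed.

End weak_solutions.

(** * Explicit super- and subsolutions *)

Section explicit_comparisons.
Context {R : realType} {d : nat}.
Implicit Types (u v : R -> 'rV[R]_d -> R) (phi psi : 'rV[R]_d -> R).

Lemma supersol_mul (A : R -> R) (h : 'rV[R]_d -> R) (t a l : R) x :
  is_derive t 1 A a -> has_laplacian h x l ->
  2^-1 * (A t * l) - (A t * h x) ^+ 2 <= a * h x ->
  supersol (fun t x => A t * h x) t x.
Proof.
move=> dA dh H; exists (a * h x), (A t * l); split => //; last exact: has_laplacianZ.
have -> : (fun t => A t * h x) = (h x) \*: A by apply/funext => z /=; rewrite mulrC.
by rewrite mulrC; exact: is_deriveZ.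
Qed.

Lemma subsol_mul (A : R -> R) (h : 'rV[R]_d -> R) (t a l : R) x :
  is_derive t 1 A a -> has_laplacian h x l ->
  a * h x <= 2^-1 * (A t * l) - (A t * h x) ^+ 2 ->
  subsol (fun t x => A t * h x) t x.
Proof.
move=> dA dh H; exists (a * h x), (A t * l); split => //; last exact: has_laplacianZ.
have -> : (fun t => A t * h x) = (h x) \*: A by apply/funext => z /=; rewrite mulrC.
by rewrite mulrC; exact: is_deriveZ.
Qed.

Lemma derive_continuous (A : R -> R) (t a : R) :
  is_derive t 1 A a -> {for t, continuous A}.
Proof.
by move=> [dA _]; apply: differentiable_continuous; exact/derivable1_diffP.
Qed.

Lemma wsol_le_cst phi u (M : R) : wsol phi u -> 0 <= M ->
  (forall x, phi x <= M) -> forall t x, 0 <= t -> u t x <= M.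
Proof.
move=> su M0 phiM; apply: (wsol_le_supersol su (V := fun _ _ => M)) => //.
  by apply: cont0_at => t x _; exact: cvg_cst.
move=> t x _; exists 0, 0; split; [exact: is_derive_cst|exact: has_laplacian_cst|].
by rewrite mulr0 sub0r oppr_le0 sqr_ge0.
Qed.

(** The function 1/(e + t) solves the equation and starts from 1/e = max(M, 1), hence above [phi];
    the maximum keeps [e] positive. The resulting bound is independent of [M], so it survives
    initial values growing to infinity. *)
Lemma wsol_le_inv phi u (M : R) : wsol phi u ->
  (forall x, phi x <= M) -> forall t x, 0 < t -> u t x <= t^-1.
Proof.
move=> su phiM t x t0; pose e : R := (Num.max M 1)^-1.
have m0 : 0 < Num.max M 1 by rewrite lt_max ltr01 orbT.
have e0 : 0 < e by rewrite invr_gt0.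
have nz z : 0 <= z -> e + 1 * z != 0 by move=> z0; rewrite gt_eqF//; lra.
have H : u t x <= powinv e 1 1 t * cst 1 x.
  apply: (wsol_le_supersol su (V := fun t x => powinv e 1 1 t * cst 1 x)); last exact: ltW.
  - apply: cont0_mul => [s s0|]; last exact: cst_continuous.
    exact: (derive_continuous (is_derive_powinv 1 (nz _ s0))).
  - by move=> s y s0; rewrite mulr1 /powinv expr1 invr_ge0; lra.
  - move=> s y s0.
    apply: (supersol_mul (is_derive_powinv 1 (nz _ (ltW s0))) (has_laplacian_cst 1 y)).
    by rewrite /powinv /=; lra.
  - move=> y; rewrite /powinv expr1 mulr1 mulr0 addr0 /e invrK (le_trans (phiM y))//.
    by rewrite le_max lexx.
apply: (le_trans H); rewrite mulr1 /powinv expr1 lef_pV2 ?posrE//; lra.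
Qed.

Lemma is_derive_expRM (K t : R) : is_derive t 1 (fun t => expR (K * t)) (K * expR (K * t)).
Proof. by apply: is_derive_eq; rewrite /GRing.scale/=; ring. Qed.

Lemma powinv11_gt0 m (x : 'rV[R]_d) : 0 < powinv 1 1 m (sqnorm x).
Proof. by rewrite exprn_gt0// invr_gt0 mul1r ltr_pwDl// sqnorm_ge0. Qed.

(** Half the Laplacian of (1 + |x|^2)^(-m) is at most 2m(m + 1) times the function, since |x|^2 <=
    (1 + |x|^2)^2; the quadratic term helps. This is why the evolution preserves polynomial
    decay. *)
Lemma wsol_le_powinv phi u (C : R) m : wsol phi u -> 0 <= C ->
  (forall x, phi x <= C * powinv 1 1 m (sqnorm x)) ->
  forall t x, 0 <= t ->
  u t x <= C * expR ((2 * m%:R * m.+1%:R) * t) * powinv 1 1 m (sqnorm x).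
Proof.
move=> su C0 phiC; set K := 2 * _ * _.
have nz (x : 'rV[R]_d) : 1 + 1 * sqnorm x != 0.
  by have x0 := sqnorm_ge0 x; rewrite gt_eqF//; lra.
apply: (wsol_le_supersol su (V := fun t x => (C * expR (K * t)) * powinv 1 1 m (sqnorm x))).
- apply: (@cont0_mul _ _ (fun t => C * expR (K * t)) (powinv 1 1 m \o @sqnorm R d)).
    move=> s s0.
    exact: (derive_continuous (@is_deriveZ _ _ _ _ C _ _ _ (is_derive_expRM K s))).
  by move=> y; exact: continuous_powinv_sqnorm.
- by move=> s y s0; rewrite mulr_ge0 ?mulr_ge0 ?expR_ge0// ltW// powinv11_gt0.
- move=> s y s0.
  apply: (@supersol_mul (fun t => C * expR (K * t)) (powinv 1 1 m \o @sqnorm R d) _ _ _ _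
    (@is_deriveZ _ _ _ _ C _ _ _ (is_derive_expRM K s)) (has_laplacian_powinv m (nz y))).
  have y0 := sqnorm_ge0 y.
  rewrite /GRing.scale/= /powinv; move: (sqnorm y) y0 => z y0; rewrite mul1r.
  have z10 : 0 < 1 + z by lra.
  set v := (1 + z)^-1.
  have v0 : 0 < v by rewrite invr_gt0.
  have zv : z * v <= 1 by rewrite ler_pdivrMr// mul1r; lra.
  have v1 : v <= 1 by rewrite invf_le1//; lra.
  have vm : 0 < v ^+ m by rewrite exprn_gt0.
  set E := C * expR (K * s).
  have E0 : 0 <= E by rewrite mulr_ge0 ?expR_ge0.
  have -> : C * (K * expR (K * s)) = K * E by rewrite /E; ring.
  have m0 : (0 : R) <= m%:R by [].
  have d0 : (0 : R) <= d%:R by [].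
  set mm : R := m.+1%:R. have mm0 : 0 <= mm by rewrite /mm.
  have P : 0 <= E * v ^+ m by rewrite mulr_ge0// ltW.
  have H1 : 0 <= d%:R * (m%:R * v) by rewrite !mulr_ge0// ltW.
  have H2 : 2 * z * (m%:R * mm * v ^+ 2) <= K.
    rewrite /K -/mm.
    have : (z * v) * v <= 1 by rewrite mulr_ile1 ?mulr_ge0// ltW.
    have : 0 <= m%:R * mm by rewrite mulr_ge0.
    nra.
  have H3 := sqr_ge0 (E * v ^+ m).
  apply: (@le_trans _ _ (E * v ^+ m * (2 * z * (m%:R * mm * v ^+ 2))
     - E * v ^+ m * (d%:R * (m%:R * v)) - (E * v ^+ m) ^+ 2)).
    by rewrite le_eqVlt; apply/orP; left; apply/eqP; rewrite !exprS; field.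
  by have := ler_wpM2l P H2; have := mulr_ge0 P H1; lra.
- by move=> y; rewrite mulr0 expR0 mulr1.
Qed.

(** In half the Laplacian of (1 + |x|^2/L)^(-m) the only negative term is at most dm/L times the
    function, and the quadratic term costs at most the factor [e], which bounds the subsolution.
    Large [L] and small [e] make the decay as slow as desired. *)
Lemma subsol_powinv_le_wsol phi u (e L : R) m : wsol phi u -> 0 <= e -> 0 < L ->
  (forall x, e * powinv 1 L^-1 m (sqnorm x) <= phi x) ->
  forall t x, 0 <= t ->
  e * expR (- (d%:R * m%:R / L + e) * t) * powinv 1 L^-1 m (sqnorm x) <= u t x.
Proof.
move=> su e0 L0 phie; set K := - _.
have nz (x : 'rV[R]_d) : 1 + L^-1 * sqnorm x != 0.
  by rewrite gt_eqF// ltr_pwDl// mulr_ge0 ?sqnorm_ge0 ?invr_ge0// ltW.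
apply: (subsol_le_wsol su (w := fun t x => (e * expR (K * t)) * powinv 1 L^-1 m (sqnorm x))).
- apply: (@cont0_mul _ _ (fun t => e * expR (K * t)) (powinv 1 L^-1 m \o @sqnorm R d)).
    move=> s s0.
    exact: (derive_continuous (@is_deriveZ _ _ _ _ e _ _ _ (is_derive_expRM K s))).
  by move=> y; exact: continuous_powinv_sqnorm.
- move=> s y s0.
  apply: (@subsol_mul (fun t => e * expR (K * t)) (powinv 1 L^-1 m \o @sqnorm R d) _ _ _ _
    (@is_deriveZ _ _ _ _ e _ _ _ (is_derive_expRM K s)) (has_laplacian_powinv m (nz y))).
  have y0 := sqnorm_ge0 y.
  rewrite /GRing.scale/= /powinv; move: (sqnorm y) y0 => z y0.
  have L'0 : 0 < L^-1 by rewrite invr_gt0.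
  have Lz : 0 <= L^-1 * z by rewrite mulr_ge0// ltW.
  have z10 : 0 < 1 + L^-1 * z by lra.
  set v := (1 + L^-1 * z)^-1.
  have v0 : 0 < v by rewrite invr_gt0.
  have v1 : v <= 1 by rewrite invf_le1//; lra.
  have vm : 0 < v ^+ m by rewrite exprn_gt0.
  have vm1 : v ^+ m <= 1 by rewrite exprn_ile1// ltW.
  set E := e * expR (K * s).
  have E0 : 0 <= E by rewrite mulr_ge0 ?expR_ge0.
  have m0 : (0 : R) <= m%:R by [].
  have d0 : (0 : R) <= d%:R by [].
  have Ee : E <= e.
    rewrite ler_piMr// expR_le1 /K mulNr oppr_le0 mulr_ge0//; last exact: ltW.
    by rewrite addr_ge0// mulr_ge0 ?mulr_ge0// ltW.
  have -> : e * (K * expR (K * s)) = K * E by rewrite /E; ring.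
  set mm : R := m.+1%:R. have mm0 : 0 <= mm by rewrite /mm.
  have P : 0 <= E * v ^+ m by rewrite mulr_ge0// ltW.
  apply: (@le_trans _ _ (E * v ^+ m * (2 * z * (m%:R * mm * L^-1 ^+ 2 * v ^+ 2))
     - E * v ^+ m * (d%:R * m%:R * L^-1 * v) - (E * v ^+ m) ^+ 2)); last first.
    by rewrite le_eqVlt; apply/orP; left; apply/eqP; rewrite !exprS; field; rewrite gt_eqF.
  have Q : 0 <= 2 * z * (m%:R * mm * L^-1 ^+ 2 * v ^+ 2).
    by do ?[exact: sqr_ge0 | exact: y0 | exact: m0 | exact: mm0 | apply: mulr_ge0].
  have := mulr_ge0 P Q.
  have DL : 0 <= d%:R * m%:R * L^-1 by rewrite !mulr_ge0// ltW.
  have : d%:R * m%:R * L^-1 * v <= d%:R * m%:R * L^-1 by rewrite ler_piMr.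
  move=> /(ler_wpM2l P).
  have : (E * v ^+ m) * (E * v ^+ m) <= (E * v ^+ m) * e.
    by apply: ler_wpM2l => //; rewrite (le_trans _ Ee)// ler_piMr.
  rewrite /K expr2; lra.
- by move=> y; rewrite mulr0 expR0 mulr1.
Qed.

End explicit_comparisons.

(** * Decay outside the unit ball, uniform in the initial value *)

Section decay.
Context {R : realType} {d : nat}.
Implicit Types (u v : R -> 'rV[R]_d -> R) (phi psi : 'rV[R]_d -> R).

(* With e^{A t} absorbing the error for |x|^2 >= 2 and the quadratic term that
   for |x|^2 < 2, A e^{A t} (|x|^2 - 1)^{-m} is a supersolution outside the unit
   ball which is infinite on the unit sphere. *)
Lemma wsol_exterior phi u (m : nat) : wsol phi u -> (2 <= m)%N ->
  (forall x, 1 <= sqnorm x -> phi x <= 0) ->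
  let A := 4 * m%:R * m.+1%:R in
  forall t x, 0 <= t <= 1 -> 1 < sqnorm x ->
  u t x <= A * expR (A * t) * powinv (-1) 1 m (sqnorm x).
Proof.
move=> su m2 phi0 A t x t01 x1.
have [u0 cu _ uphi] := su.
have m1 : (1 <= m)%N by rewrite (leq_trans _ m2).
have mR : (1 : R) <= m%:R by rewrite ler1n.
have smR : (1 : R) <= m.+1%:R by rewrite ler1n.
have A1 : 4 <= A by rewrite /A; nra.
pose V (t : R) (x : 'rV[R]_d) := A * expR (A * t) * powinv (-1) 1 m (sqnorm x).
have V0 s (y : 'rV[R]_d) : 1 < sqnorm y -> 0 <= V s y.
  move=> y1; apply: mulr_ge0; first by rewrite mulr_ge0 ?expR_ge0//; lra.
  by rewrite exprn_ge0// invr_ge0; lra.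
have nz (y : 'rV[R]_d) : 1 < sqnorm y -> -1 + 1 * sqnorm y != 0.
  by move=> y1; rewrite gt_eqF//; lra.
rewrite -/(V t x) -subr_le0; apply: (@barrier_vanish _ d x) => rho xr.
rewrite lerBlDl.
have [M M0 uM] := cont0_bounded rho (@ler01 R) cu.
have r0 : 0 < rho by rewrite (lt_trans _ xr)//; lra.
have [k kr kB] := @barrier_blowup _ d rho M r0 M0.
(* In the layer 1 < |y|^2 < 1 + eta, V >= 1/(|y|^2 - 1) >= M + 1 already exceeds [u], so the compact
   set may avoid the sphere, where [V] is singular. *)
pose eta := (M + 1)^-1.
have eta0 : 0 < eta by rewrite invr_gt0; lra.
apply: (@comparison_local _ _ 1 [set y | 1 < sqnorm y < rho]
    [set y | 1 + eta <= sqnorm y <= k] u V (barrier rho)) => //=.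
- exact: open_sqnorm_lt.
- exact: compact_shell.
- by move=> y /= /andP[y0 yk]; apply/andP; split; lra.
- exact: cont0_shell.
- apply: continuous_in_subspaceT => -[s y] /set_mem[/= _ /andP[y1 _]].
  have y1' : 1 < sqnorm y by lra.
  apply: (@cvgM _ _ _ _ (fun q : R * 'rV[R]_d => A * expR (A * q.1))
                       (fun q : R * 'rV[R]_d => powinv (-1) 1 m (sqnorm q.2))).
    apply: (@continuous_comp _ _ _ fst (fun s => A * expR (A * s))); first exact: cvg_fst.
    exact: (derive_continuous (@is_deriveZ _ _ _ _ A _ _ _ (is_derive_expRM A s))).
  apply: (@continuous_comp _ _ _ snd (powinv (-1) 1 m \o @sqnorm R d)); first exact: cvg_snd.
  exact/continuous_powinv_sqnorm/nz.
- by move=> y /andP[_]; exact: continuous_barrier.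
- by move=> s y /andP[s0 _] _; exact: wsol_subsol su s0.
- move=> s y /andP[s0 _] /andP[y1 _]; split; last exact: V0.
  apply: (@supersol_mul _ _ (fun t => A * expR (A * t)) (powinv (-1) 1 m \o @sqnorm R d) _ _ _ _
    (@is_deriveZ _ _ _ _ A _ _ _ (is_derive_expRM A s)) (has_laplacian_powinv m (nz y y1))).
  rewrite /GRing.scale/= /powinv; move: (sqnorm y) y1 => z y1.
  have z10 : 0 < -1 + 1 * z by lra.
  set v := (-1 + 1 * z)^-1.
  have v0 : 0 < v by rewrite invr_gt0.
  have zv : (z - 1) * v = 1.
    by rewrite /v (_ : -1 + 1 * z = z - 1) ?divff//; [rewrite gt_eqF//; lra|ring].
  set E := A * expR (A * s).
  have EA : A <= E.
    by rewrite /E ler_peMr//; [lra|rewrite -expR0 ler_expR mulr_ge0//; lra].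
  have E0 : 0 <= E by lra.
  have vm : 0 < v ^+ m by rewrite exprn_gt0.
  have -> : A * (A * expR (A * s)) = A * E by [].
  set mm : R := m.+1%:R in smR *.
  have AE : A = 4 * m%:R * mm by [].
  have P : 0 <= E * v ^+ m by rewrite mulr_ge0// ltW.
  apply: (@le_trans _ _ (E * v ^+ m * (2 * z * (m%:R * mm * v ^+ 2))
     - E * v ^+ m * (d%:R * (m%:R * v)) - (E * v ^+ m) ^+ 2)).
    by rewrite le_eqVlt; apply/orP; left; apply/eqP; rewrite !exprS; field.
  have H1 : 0 <= d%:R * (m%:R * v) by rewrite mulr_ge0// mulr_ge0// ltW.
  suff H2 : 2 * z * (m%:R * mm * v ^+ 2) <= A + E * v ^+ m.
    by have := ler_wpM2l P H2; have := mulr_ge0 P H1; rewrite expr2; lra.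
  have mm0 : 0 <= m%:R * mm by rewrite mulr_ge0; lra.
  have [z2|z2] := leP 2 z.
    have v1 : v <= 1 by rewrite invf_le1//; lra.
    have : z * v ^+ 2 <= 2.
      have -> : z * v ^+ 2 = ((z - 1) * v) * v + v ^+ 2 by ring.
      by rewrite zv; nra.
    have := mulr_ge0 E0 (ltW vm); rewrite AE; nra.
  (* Near the sphere v >= 1, so m >= 2 gives v^2 <= v^m, and with z < 2 the Laplacian term is at
     most A v^2 <= E v^m. *)
  have v1 : 1 <= v by rewrite invf_ge1//; lra.
  have : v ^+ 2 <= v ^+ m by rewrite ler_weXn2l.
  move=> /(ler_wpM2l E0).
  have := ler_wpM2r (sqr_ge0 v) EA.
  have : z * v ^+ 2 <= 2 * v ^+ 2 by rewrite ler_wpM2r ?sqr_ge0// ltW.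
  move=> /(ler_wpM2l mm0); rewrite AE; nra.
- move=> y /andP[_ yr]; split; first exact/barrier_ge0/ltW.
  exact: barrier_supersol.
- move=> y /andP[y1 yr]; rewrite uphi (le_trans (phi0 _ (ltW y1)))// addr_ge0//.
    exact: V0.
  exact/barrier_ge0/ltW.
- move=> s y sT /andP[y1 yr] /negP; rewrite negb_and -!ltNge => /orP[ye|ky].
    rewrite (le_trans (uM _ _ sT (ltW yr)))// -[leLHS]addr0; apply: lerD; last exact/barrier_ge0/ltW.
    rewrite /V /powinv; set v := (_)^-1.
    have vM : M + 1 <= v.
      rewrite /v -[leLHS]invrK lef_pV2 ?posrE -/eta//; lra.
    have e1 : 1 <= expR (A * s).
      by rewrite -expR0 ler_expR mulr_ge0//; [lra|case/andP : sT].
    have v1 : v <= v ^+ m by rewrite -[leLHS]expr1 ler_weXn2l//; lra.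
    have Ae1 : 1 <= A * expR (A * s) by rewrite mulr_ege1//; lra.
    by apply: (@le_trans _ _ (v ^+ m)); [lra|rewrite ler_peMl//; lra].
  rewrite (le_trans (uM _ _ sT (ltW yr)))// (le_trans (kB y _)) ?ky//.
  by rewrite lerDr V0.
- by rewrite x1 xr.
Qed.

End decay.

(** * Gaussian decay and comparison with the linearized equation *)

Section decay.
Context {R : realType} {d : nat}.
Implicit Types (u v : R -> 'rV[R]_d -> R) (phi psi : 'rV[R]_d -> R).

(** For c >= 1 the multiple c v is a supersolution, because c v^2 <= (c v)^2. The evolution is thus
    sublinear, and dividing the initial value before multiplying the solution can only increase
    it. *)
Lemma wsol_scale_ge phi u v (c : R) : 1 <= c -> wsol phi u ->
  wsol (fun x => c^-1 * phi x) v -> forall t x, 0 <= t -> u t x <= c * v t x.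
Proof.
move=> c1 su [v0 cv veq vphi].
apply: (wsol_le_supersol su (V := fun t x => c * v t x)).
- move/subspace_continuousP : cv => cv; apply/subspace_continuousP => q q0.
  by apply: cvgM; [exact: cvg_cst|exact: cv].
- by move=> t x t0; rewrite mulr_ge0 ?v0//; lra.
- move=> t x t0; have [a [l [da dl aE]]] := veq t x t0.
  exists (c * a), (c * l); split.
  + exact: is_deriveZ.
  + exact: has_laplacianZ.
  + by rewrite aE; have := sqr_ge0 (v t x); nra.
- by move=> x; rewrite vphi mulrA divff ?mul1r// gt_eqF//; lra.
Qed.

(** Its integer powers stand for the half-integer powers of 1 + t: the cube is (1 + t)^(-3/2). *)
Definition rsqrt1D (t : R) : R := (Num.sqrt (1 + t))^-1.

Lemma rsqrt1D_gt0 t : 0 <= t -> 0 < rsqrt1D t.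
Proof. by move=> t0; rewrite invr_gt0 sqrtr_gt0; lra. Qed.

Lemma rsqrt1D_le1 t : 0 <= t -> rsqrt1D t <= 1.
Proof.
move=> t0; rewrite invf_le1 ?sqrtr_gt0; last by lra.
by rewrite -[leLHS]sqrtr1 ler_sqrt; lra.
Qed.

Lemma is_derive_rsqrt1D (t : R) : 0 <= t ->
  is_derive t 1 rsqrt1D (- 2^-1 * rsqrt1D t ^+ 3).
Proof.
move=> t0.
have t10 : 0 < 1 + t by lra.
have d1 : is_derive t 1 (fun t : R => 1 + t) 1.
  by apply: is_derive_eq; rewrite /=; ring.
have d2 := @is_derive1_comp _ Num.sqrt (fun t => 1 + t) t _ _ (is_derive1_sqrt t10) d1.
have s0 : Num.sqrt (1 + t) != 0 by rewrite gt_eqF// sqrtr_gt0.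
have d3 := @is_deriveV _ (Num.sqrt \o (fun t => 1 + t)) t _ 1 s0 d2.
by apply: (is_derive_eq d3); rewrite /rsqrt1D /GRing.scale/=; field.
Qed.

(** The supersolution is (1 + t)^(-3/2) exp(-|x|^2 / (2(1 + t))), which solves the heat equation in
    dimension 3. In dimension d >= 3 its Laplacian is only smaller, so this one exponent, integrable
    in time, serves all d. *)
Lemma wsol_le_gauss phi u (e : R) : (3 <= d)%N -> wsol phi u -> 0 <= e ->
  (forall x, phi x <= e * expR (- (2^-1 * sqnorm x))) ->
  forall t x, 0 <= t -> u t x <= e * rsqrt1D t ^+ 3.
Proof.
move=> d3 su e0 phie t x t0.
pose V (t : R) (x : 'rV[R]_d) :=
  e * rsqrt1D t ^+ 3 * expR (- (2^-1 * rsqrt1D t ^+ 2) * sqnorm x).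
have V0 s (y : 'rV[R]_d) : 0 <= s -> 0 <= V s y.
  move=> s0; rewrite /V mulr_ge0 ?expR_ge0// mulr_ge0// exprn_ge0// ltW//.
  exact: rsqrt1D_gt0.
suff : u t x <= V t x.
  move=> /le_trans; apply; rewrite /V ler_piMr ?mulr_ge0 ?exprn_ge0 ?(ltW (rsqrt1D_gt0 t0))//.
  rewrite -expR0 ler_expR mulNr oppr_le0 mulr_ge0 ?sqnorm_ge0//.
  by rewrite mulr_ge0 ?sqr_ge0.
apply: (wsol_le_supersol su) => //.
- apply: cont0_at => s y s0.
  have cr : {for (s, y), continuous (fun q : R * 'rV[R]_d => rsqrt1D q.1)}.
    apply: (@continuous_comp _ _ _ fst rsqrt1D); first exact: cvg_fst.
    exact: (derive_continuous (is_derive_rsqrt1D s0)).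
  have cs : {for (s, y), continuous (fun q : R * 'rV[R]_d => sqnorm q.2)}.
    apply: (@continuous_comp _ _ _ snd (@sqnorm R d)); first exact: cvg_snd.
    exact: continuous_sqnorm.
  have ce n := @continuous_comp _ _ _ (fun q : R * 'rV[R]_d => rsqrt1D q.1)
    (fun r => r ^+ n) (s, y) cr (@exprn_continuous R n _).
  have cE : {for (s, y), continuous
      (fun q : R * 'rV[R]_d => - (2^-1 * rsqrt1D q.1 ^+ 2) * sqnorm q.2)}.
    exact: (cvgM (cvgN (cvgM (cvg_cst (2^-1 : R)) (ce 2))) cs).
  have cx := @continuous_comp _ _ _ _ (@expR R) (s, y) cE (@continuous_expR R _).
  exact: (cvgM (cvgM (cvg_cst e) (ce 3)) cx).
- move=> s y s0; have s00 := ltW s0.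
  set q := rsqrt1D s; set z := sqnorm y; set E := expR (- (2^-1 * q ^+ 2) * z).
  have q0 : 0 < q := rsqrt1D_gt0 s00.
  have dq := is_derive_rsqrt1D s00; rewrite -/q in dq.
  exists (e * E * q ^+ 5 * (2^-1 * (q ^+ 2 * z - 3))),
    (e * q ^+ 3 * (2 * d%:R * (- (2^-1 * q ^+ 2) * E) +
     4 * z * ((2^-1 * q ^+ 2) ^+ 2 * E))); split.
  + have d1 := @is_deriveZ _ _ _ _ e _ _ _ (@is_deriveX _ _ _ 3 _ _ _ dq).
    have d2 := @is_deriveZ _ _ _ _ (- 2^-1 * z) _ _ _ (@is_deriveX _ _ _ 2 _ _ _ dq).
    have d4 := @is_derive1_comp _ expR _ s _ _ (is_derive_expR _) d2.
    have d5 := @is_deriveM _ _ _ _ _ _ _ _ d1 d4.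
    have VE : V ^~ y = (e \*: rsqrt1D ^+ 3) * (expR \o ((- 2^-1 * z) \*: rsqrt1D ^+ 2)).
      apply/funext => r; rewrite /V /= !fctE /GRing.scale/= -/z; congr (_ * expR _).
      by rewrite /GRing.scale/=; ring.
    rewrite VE; apply: (is_derive_eq d5); rewrite !fctE /GRing.scale/= -/q.
    rewrite /GRing.scale/= (_ : - 2^-1 * z * q ^+ 2 = - (2^-1 * q ^+ 2) * z); last by ring.
    by rewrite -/E; field.
  + have dl : has_laplacian ((fun r => expR (- (2^-1 * q ^+ 2) * r)) \o @sqnorm R d) y
       (2 * d%:R * (- (2^-1 * q ^+ 2) * E) + 4 * z * ((2^-1 * q ^+ 2) ^+ 2 * E)).
      apply: (@has_laplacian_radial _ _ _
        (fun r => - (2^-1 * q ^+ 2) * expR (- (2^-1 * q ^+ 2) * r))).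
        by near=> r; exact: is_derive_expRM.
      have H := @is_deriveZ _ _ _ _ (- (2^-1 * q ^+ 2)) _ _ _ (is_derive_expRM (- (2^-1 * q ^+ 2)) z).
      by apply: (is_derive_eq H); rewrite /GRing.scale/= /E; ring.
    exact: (has_laplacianZ (e * q ^+ 3) dl).
  + have E0 : 0 <= E by exact: expR_ge0.
    have d3R : (3 : R) <= d%:R by rewrite (ler_nat R 3).
    have P : 0 <= e * E * q ^+ 5.
      by apply: mulr_ge0; [exact: mulr_ge0|rewrite exprn_ge0// ltW].
    have := ler_wpM2l P d3R; have := sqr_ge0 (V s y).
    have -> : 2^-1 * (e * q ^+ 3 * (2 * d%:R * (- (2^-1 * q ^+ 2) * E) +
       4 * z * ((2^-1 * q ^+ 2) ^+ 2 * E))) =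
       e * E * q ^+ 5 * (2^-1 * (q ^+ 2 * z - d%:R)) by field.
    lra.
- by move=> y; rewrite /V /rsqrt1D addr0 sqrtr1 invr1 !expr1n !mulr1 mulNr.
Unshelve. all: by end_near. Qed.

(* v / e times 1 / (3 - 2 (1+t)^{-1/2}) is a subsolution, by the Gaussian bound
   v <= e (1+t)^{-3/2}; the integrability of (1+t)^{-3/2} is where d >= 3
   enters. *)
Lemma wsol_ge_linear phi u v (e : R) : (3 <= d)%N -> 0 < e ->
  wsol phi u -> wsol (fun x => e * phi x) v ->
  (forall x, phi x <= expR (- (2^-1 * sqnorm x))) ->
  forall t x, 0 <= t -> (3 * e)^-1 * v t x <= u t x.
Proof.
move=> d3 e0 su sv phie t x t0.
have vg : forall t x, 0 <= t -> v t x <= e * rsqrt1D t ^+ 3.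
  by apply: (wsol_le_gauss d3 sv (ltW e0)) => y; rewrite ler_wpM2l// ltW.
have [v0 cv veq vphi] := sv.
(* [b] solves b' = -b^2 (1 + t)^(-3/2) with b(0) = 1; its inverse grows by the time integral of (1 +
   t)^(-3/2), which is at most 2, whence b >= 1/3. *)
pose b (t : R) : R := (3 - 2 * rsqrt1D t)^-1.
have b10 s : 0 <= s -> 0 < 3 - 2 * rsqrt1D s by move=> /rsqrt1D_le1; lra.
have db (s : R) : 0 <= s -> is_derive s 1 b (- b s ^+ 2 * rsqrt1D s ^+ 3).
  move=> s0.
  have d1 : is_derive s 1 (fun s => 3 - 2 * rsqrt1D s) (rsqrt1D s ^+ 3).
    have dq := @is_deriveZ _ _ _ _ 2 _ _ _ (is_derive_rsqrt1D s0).
    have H := @is_deriveB _ _ _ _ _ _ _ _ _ (@is_derive_cst _ _ _ (3 : R) s 1) dq.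
    by apply: (is_derive_eq H); rewrite /GRing.scale/=; field.
  have H := @is_deriveV _ (fun s => 3 - 2 * rsqrt1D s) s _ 1 (lt0r_neq0 (b10 _ s0)) d1.
  by apply: (is_derive_eq H); rewrite /b /GRing.scale/= -exprVn.
have b0 s : 0 <= s -> 0 < b s by move=> /b10; rewrite /b invr_gt0.
apply: (@le_trans _ _ (b t * (e^-1 * v t x))).
  rewrite invfM -mulrA ler_wpM2r//.
    by rewrite mulr_ge0 ?v0// invr_ge0 ltW.
  rewrite /b lef_pV2 ?posrE ?b10//.
  by have := rsqrt1D_gt0 t0; lra.
apply: (subsol_le_wsol su (w := fun t x => b t * (e^-1 * v t x))) => //.
- move/subspace_continuousP : cv => cv; apply/subspace_continuousP => -[s y] s0.
  apply: cvgM; last by apply: cvgM; [exact: cvg_cst|exact: cv].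
  apply: cvg_within_filter; apply: (@continuous_comp _ _ _ fst b); first exact: cvg_fst.
  exact: (derive_continuous (db _ s0)).
- move=> s y s0; have s00 := ltW s0.
  have [a [l [da dl aE]]] := veq s y s0.
  exists (b s * (e^-1 * a) + (e^-1 * v s y) * (- b s ^+ 2 * rsqrt1D s ^+ 3)),
    (b s * (e^-1 * l)); split.
  + have H := @is_deriveM _ _ _ _ _ _ _ _ (db _ s00) (@is_deriveZ _ _ _ _ e^-1 _ _ _ da).
    by apply: (is_derive_eq H); rewrite /GRing.scale/=.
  + by apply: has_laplacianZ; exact: has_laplacianZ.
  + rewrite aE; have ve := vg s y s00; have w0 := v0 s y s00.
    have bs := b0 _ s00.
    have e'0 : 0 < e^-1 by rewrite invr_gt0.
    have P : 0 <= b s * e^-1 * v s y ^+ 2 by rewrite !mulr_ge0 ?sqr_ge0// ltW.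
    have Q : 0 <= b s ^+ 2 * e^-1 * v s y * e^-1 by rewrite !mulr_ge0 ?sqr_ge0// ltW.
    have := ler_wpM2l Q ve.
    have -> : b s ^+ 2 * e^-1 * v s y * e^-1 * (e * rsqrt1D s ^+ 3) =
      (e^-1 * v s y) * (b s ^+ 2 * rsqrt1D s ^+ 3) by field; rewrite gt_eqF.
    have -> : b s ^+ 2 * e^-1 * v s y * e^-1 * v s y = (b s * (e^-1 * v s y)) ^+ 2 by ring.
    lra.
- move=> y; rewrite vphi /b /rsqrt1D addr0 sqrtr1 invr1 mulKf ?gt_eqF//.
  by rewrite (_ : 3 - 2 * 1 = 1) ?invr1 ?mul1r//; ring.
Qed.

End decay.

(** * Random measures and the Lebesgue measure *)

Section borel_rV.
Context {R : realType}.

(** These boxes form a countable base of the topology, through which measurability into row vectors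
    reduces to the coordinates. *)
Definition rat_box n (q : 'rV[rat]_n * nat) : set 'rV[R]_n :=
  [set v | forall i, ball (ratr (q.1 ord0 i) : R) q.2.+1%:R^-1 (v ord0 i)].

Lemma open_bigcup_rat_box n (U : set 'rV[R]_n) : open U ->
  U = \bigcup_(q in [set q | rat_box q `<=` U]) rat_box q.
Proof.
move=> oU; apply/seteqP; split=> [v Uv|v [q /= qU /qU]//].
have : nbhs v U by exact: open_nbhs_nbhs.
move=> /nbhs_ballP[e /= e0 eU].
have [k ke] : exists k : nat, k.+1%:R^-1 < e / 2 :> R.
  have e20 : 0 < e / 2 by rewrite divr_gt0.
  have [k _ /(_ k (leqnn k)) /= hk] := near_infty_natSinv_lt (PosNum e20).
  by exists k.
have k0 : 0 < k.+1%:R^-1 :> R by rewrite invr_gt0.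
have ratex (x : R) : exists q : rat, `|ratr q - x| < k.+1%:R^-1.
  have [|q] := @rat_in_itvoo R (x - k.+1%:R^-1) (x + k.+1%:R^-1).
    by rewrite ltrBlDr -addrA ltrDl addr_gt0.
  by rewrite in_itv/= => /andP[h1 h2]; exists q; rewrite ltr_distl h1 h2.
exists (\row_i sval (cid (ratex (v ord0 i))), k); last first.
  by move=> i /=; rewrite mxE /ball/=; case: cid.
move=> u hu; apply: eU; split=> // i j; rewrite (ord1 i).
have := hu j; rewrite /= mxE; case: cid => q /= qv; rewrite /ball/= => qu.
rewrite (_ : v ord0 j - u ord0 j = (ratr q - u ord0 j) - (ratr q - v ord0 j)); last by ring.
by rewrite (le_lt_trans (ler_normB _ _))// (splitr e) ltrD// (lt_trans _ ke).
Qed.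

Lemma measurable_fun_rV d (T : measurableType d) n (f : T -> 'rV[R]_n) :
  (forall i, measurable_fun setT (fun w => f w ord0 i)) -> measurable_fun setT f.
Proof.
move=> mf; apply: (measurability (@open 'rV[R]_n)) => //.
move=> _ [U oU <-]; rewrite setTI (open_bigcup_rat_box oU) preimage_bigcup.
rewrite bigcup_mkcond; apply: countable_bigcupT_measurable => // q.
case: ifPn => // _.
rewrite (_ : _ @^-1` _ = \bigcap_(i in [set: 'I_n])
    ((fun w => f w ord0 i) @^-1` ball (ratr (q.1 ord0 i) : R) q.2.+1%:R^-1)); last first.
  by apply/seteqP; split=> w /= h i; [move=> _; exact: h|exact: h].
apply: fin_bigcap_measurable => // i _.
by rewrite -[X in measurable X]setTI; apply: mf => //; exact: measurable_ball.
Qed.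

Lemma continuous_measurable_rV n (f : 'rV[R]_n -> R) :
  continuous f -> measurable_fun setT f.
Proof.
move=> cf; apply: (measurability _ (RGenOpens.measurableE R)).
move=> _ [_ [a [b ->] <-]]; rewrite setTI; apply: measurable_open_mx.
by apply: open_comp => // *; exact: interval_open.
Qed.

End borel_rV.

Lemma integrable_indic_fin d (T : measurableType d) (R : realType)
    (mu : {measure set T -> \bar R}) (A : set T) :
  measurable A -> (mu A < +oo)%E -> mu.-integrable setT (EFin \o \1_A).
Proof.
move=> mA Aoo; apply/integrableP; split; first exact/measurable_EFinP.
rewrite (eq_integral (fun x => (\1_A x)%:E)); last first.
  by move=> t _; rewrite gee0_abs// lee_fin.
by rewrite integral_indic// setIT.
Qed.

(** * Measurability of evaluations on M_p *)

Section evaluation.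
Context {R : realType} {d : nat} {p : R}.
Local Notation T := (@tempered R d p).

Lemma measurable_pairing (g : 'rV[R]_d -> R) : Cc g ->
  measurable_fun setT (fun mu : T => (\int[mu]_x g x)%R).
Proof.
move=> gCc.
have tg : test_fun p g.
  by exists g, 0; split => //; apply/funext => x; rewrite mul0r addr0.
pose h : T -> R := fun mu => pairing mu (exist _ g (mem_set tg)).
have ch : continuous h.
  move=> mu.
  apply: (@continuous_comp _ _ _ (@pairing R d p)
    (fun F : {ptws test_fun p -> R} => F (exist _ g (mem_set tg)))).
    exact: initial_continuous.
  exact: (@proj_continuous _ (fun=> R)).
apply: (measurability _ (RGenOpens.measurableE R)).
move=> _ [_ [a [b ->] <-]]; rewrite setTI; apply: sub_sigma_algebra.
by apply: (open_comp (f := h)) => // *; exact: interval_open.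
Qed.

Lemma compact_closed_ball (N : R) : compact [set x : 'rV[R]_d | `|x| <= N].
Proof.
apply: bounded_closed_compact.
  by exists N; split; [exact: num_real|move=> M NM x /= /le_trans; apply; exact: ltW].
rewrite (_ : mkset _ = (fun x => `|x|) @^-1` [set y | y <= N])//.
by apply: closed_comp => [x _|]; [exact: norm_continuous|exact: closed_le].
Qed.

(** The topology of M_p controls integrals of continuous functions only, so the indicator of [U] is
    reached as a pointwise limit of Urysohn functions. Boundedness of [U] gives them compact support
    and a common integrable majorant, the indicator of a closed ball. *)
Lemma measurable_ev_open (U : set 'rV[R]_d) (N : R) : open U ->
  (forall x, U x -> `|x| <= N) -> measurable_fun setT (fun mu : T => mu U).
Proof.
move=> oU UN; set C := [set x : 'rV[R]_d | `|x| <= N].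
have mU : measurable U by exact: measurable_open_mx.
have cC : compact C by exact: compact_closed_ball.
have clC : closed C.
  by apply: compact_closed => //; exact: norm_hausdorff.
have mC : measurable C.
  by rewrite -[C]setCK; apply: measurableC; apply: measurable_open_mx; exact: closed_openC.
(* [F k] stays at distance 1/(k + 1) from the complement of [U], which is the uniform separation
   Urysohn's lemma requires; these sets exhaust [U]. *)
pose F k := [set x : 'rV[R]_d | ball x k.+1%:R^-1 `<=` U].
have sepF k : uniform_separator (~` U) (F k).
  apply: uniform_separatorW.
  exists [set xy | ball xy.1 k.+1%:R^-1 xy.2].
    rewrite -entourage_ballE; exists (k.+1%:R^-1 : R) => /=; last by []. by rewrite invr_gt0.
  rewrite -subset0 => -[x y] [[/= Ux Fy] xy]; apply: Ux; apply: Fy.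
  exact: ball_sym.
pose g k : 'rV[R]_d -> R := Urysohn (~` U) (F k).
have cg k : continuous (g k) by exact: Urysohn_continuous.
have g01 k x : 0 <= g k x <= 1.
  by have /= := @Urysohn_range _ R (~` U) (F k) (g k x); rewrite in_itv/=; apply; exists x.
have g0 k x : ~ U x -> g k x = 0.
  by move=> Ux; apply: (Urysohn_sub0 (sepF k)); exists x.
have g1 k x : F k x -> g k x = 1.
  by move=> Fx; apply: (Urysohn_sub1 (sepF k)); exists x.
have gU k x : g k x <= \1_U x.
  rewrite indicE; have [xU|/g0 ->] := pselect (U x).
    by rewrite mem_set//; case/andP : (g01 k x).
  by case: (_ \in _).
have gC k x : g k x <= \1_C x.
  rewrite (le_trans (gU k x))// !indicE.
  by have [/set_mem /UN Ux|_] := boolP (x \in U); [rewrite mem_set|case: (_ \in _)].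
have gCc k : Cc (g k).
  split => //; apply: (subclosed_compact _ cC); first exact: closed_closure.
  rewrite [X in _ `<=` X]((closure_id C).1 clC); apply: closureS => x /= gx.
  by apply: UN; apply: contrapT => /(g0 k) /eqP; rewrite (negPf gx).
have mg k : measurable_fun setT (g k) by exact: continuous_measurable_rV.
have ig k (mu : T) : mu.-integrable setT (EFin \o g k).
  apply: (@le_integrable _ _ _ mu setT measurableT _ (EFin \o \1_C)).
  - exact/measurable_EFinP.
  - by move=> x _ /=; rewrite lee_fin !ger0_norm//; case/andP : (g01 k x).
  - by apply: integrable_indic_fin => //; exact: tempered_locally_finite.
have mint k : measurable_fun setT (fun mu : T => (\int[mu]_x g k x)%R%:E).
  by apply/measurable_EFinP; exact: measurable_pairing.
apply: (emeasurable_fun_cvg _ (fun mu : T => mu U) mint) => mu _.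
rewrite (_ : mu U = \int[mu]_x (\1_U x)%:E)%E; last by rewrite integral_indic// setIT.
rewrite (_ : (fun k => _) = (fun k => \int[mu]_x (g k x)%:E)%E); last first.
  apply/funext => k; rewrite /Rintegral fineK//; exact: (integrable_fin_num measurableT (ig k mu)).
have := @dominated_convergence _ _ _ mu setT measurableT (fun k => EFin \o g k) (EFin \o \1_U) (EFin \o \1_C).
case => //.
- by move=> k; exact/measurable_EFinP.
- by apply/measurable_EFinP.
- apply: aeW => x _; apply: cvg_near_cst.
  have [Ux|nUx] := pselect (U x); last first.
    by near=> k; rewrite /= g0// indicE memNset.
  have /nbhs_ballP[e /= e0 eU] : nbhs x U by exact: open_nbhs_nbhs.
  near=> k; rewrite /= g1 ?indicE ?mem_set// => y xy; apply: eU.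
  apply: le_ball xy; apply/ltW; near: k.
  exact: (near_infty_natSinv_lt (PosNum e0)).
- by apply: integrable_indic_fin => //; exact: tempered_locally_finite.
- by apply: aeW => x k _ /=; rewrite lee_fin ger0_norm//; case/andP : (g01 k x).
Unshelve. all: by end_near. Qed.

End evaluation.

Section evaluation_borel.
Context {R : realType} {d : nat} {p : R}.
Local Notation T := (@tempered R d p).
Local Open Scope ereal_scope.

Lemma open_norm_lt (r : R) : open [set x : 'rV[R]_d | (`|x| < r)%R].
Proof.
rewrite (_ : mkset _ = (fun x => `|x|%R) @^-1` [set y | (y < r)%R])//.
by apply: open_comp => [x _|]; [exact: norm_continuous|exact: open_lt].
Qed.

Lemma tempered_norm_lt_fin (mu : T) (r : R) (A : set 'rV[R]_d) :
  measurable A -> mu (A `&` [set x | (`|x| < r)%R]) < +oo.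
Proof.
move=> mA.
apply: (@le_lt_trans _ _ (mu [set x | (`|x| <= r)%R])); last first.
  exact/tempered_locally_finite/compact_closed_ball.
apply: le_measure; rewrite ?inE.
- by apply: measurableI => //; apply: measurable_open_mx; exact: open_norm_lt.
- rewrite -[X in measurable X]setCK; apply: measurableC; apply: measurable_open_mx.
  apply: closed_openC; apply: compact_closed; first exact: norm_hausdorff.
  exact: compact_closed_ball.
- by move=> x [_ /ltW].
Qed.

(** Restricting to a bounded set makes every [mu] finite there, so that complements in the Dynkin
    argument become genuine differences. *)
Lemma measurable_ev_bounded (r : R) (A : set 'rV[R]_d) : measurable A ->
  measurable_fun setT (fun mu : T => mu (A `&` [set x | (`|x| < r)%R])).
Proof.
set B := [set x : 'rV[R]_d | (`|x| < r)%R].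
have oB : open B by exact: open_norm_lt.
have mB : measurable B by exact: measurable_open_mx.
have mevB : measurable_fun setT (fun mu : T => mu B).
  by apply: (@measurable_ev_open _ _ _ _ r) => // x /ltW.
move: A; apply: (@dynkin_induction _ 'rV[R]_d open) => //.
- by move=> U V; exact: openI.
- by rewrite setTI.
- move=> U oU; apply: (@measurable_ev_open _ _ _ _ r); first exact: openI.
  by move=> x [_ /ltW].
- move=> S mS mevS.
  rewrite (_ : (fun _ => _) = (fun mu : T => mu B - mu (S `&` B))); last first.
    apply/funext => mu.
    have Boo : mu B < +oo.
      by have := @tempered_norm_lt_fin mu r setT measurableT; rewrite setTI.
    by rewrite setIC -setDE measureD// (setIC B).
  exact: emeasurable_funB.
- move=> F mF tF mevF.
  rewrite (_ : (fun _ => _) = (fun mu : T => \sum_(0 <= k <oo) mu (F k `&` B))); last first.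
    apply/funext => mu; rewrite setI_bigcupl.
    apply/esym/cvg_lim => //; apply: measure_semi_sigma_additive.
    + by move=> k; exact: measurableI.
    + by apply: trivIset_setIr.
    + by apply: bigcup_measurable => k _; exact: measurableI.
  by apply: ge0_emeasurable_sum.
Qed.

Lemma measurable_ev (A : set 'rV[R]_d) : measurable A ->
  measurable_fun setT (fun mu : T => mu A).
Proof.
move=> mA; have mev k := measurable_ev_bounded k%:R mA.
apply: (emeasurable_fun_cvg _ (fun mu : T => mu A) mev) => mu _.
have AE : A = \bigcup_k (A `&` [set x | (`|x| < k%:R)%R]).
  apply/seteqP; split=> [x Ax|x [k _ []]//].
  exists (Num.truncn `|x|).+1 => //; split => //=.
  by have /andP[] := Num.Theory.truncn_itv (normr_ge0 x).
rewrite [X in _ --> mu X]AE; apply: nondecreasing_cvg_mu.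
- move=> k; apply: measurableI => //; apply: measurable_open_mx; exact: open_norm_lt.
- rewrite -AE//.
- move=> m n mn; apply/subsetPset => x [Ax /= xm]; split => //=.
  by rewrite (lt_le_trans xm)// ler_nat.
Qed.

End evaluation_borel.

(* A random measure [ev] on [S], given through the measurability of its
   evaluations. *)
Section random_measure.
Context d (M : measurableType d) ds (S : measurableType ds) (R : realType).
Variable ev : M -> {measure set S -> \bar R}.
Hypothesis mev : forall A, measurable A -> measurable_fun setT (fun m => ev m A).
Local Open Scope ereal_scope.
Import HBNNSimple.

Lemma measurable_integral_ev (f : S -> \bar R) :
  measurable_fun setT f -> (forall x, 0 <= f x) ->
  measurable_fun setT (fun m => \int[ev m]_x f x).
Proof.
move=> mf f0.
pose g := nnsfun_approx measurableT mf.
pose I n m := \int[ev m]_x (g n x)%:E.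
have mI n : measurable_fun setT (I n).
  rewrite /I; under eq_fun do rewrite integralT_nnsfun sintegralE.
  apply: emeasurable_fsum => //= r.
  by apply: measurable_funeM => //=; exact: mev.
apply: (emeasurable_fun_cvg _ (fun m => \int[ev m]_x f x) mI) => m _.
rewrite (_ : \int[ev m]_x f x = \int[ev m]_x limn (fun n => (g n x)%:E)).
  apply: cvg_monotone_convergence => //.
  - by move=> n; exact/measurable_EFinP.
  - by move=> n x _; rewrite lee_fin.
  - by move=> t _ n k nk; rewrite lee_fin; exact/lefP/nd_nnsfun_approx.
apply: eq_integral => t _.
by apply/esym/cvg_lim => //; exact/cvg_nnsfun_approx.
Qed.

Variable Q : {measure set M -> \bar R}.

Definition mean_measure (A : set S) := \int[Q]_m ev m A.

Let mean0 : mean_measure set0 = 0.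
Proof. by rewrite /mean_measure integral0_eq. Qed.

Let mean_ge0 A : 0 <= mean_measure A.
Proof. by rewrite /mean_measure integral_ge0. Qed.

Let mean_sigma_additive : semi_sigma_additive mean_measure.
Proof.
move=> F mF tF _; rewrite [X in _ --> X](_ : _ =
    \int[Q]_m (\sum_(0 <= k <oo) ev m (F k))); last first.
  apply: eq_integral => m _.
  by apply/esym/cvg_lim => //; exact: measure_sigma_additive.
rewrite [X in X @ _](_ : _ =
    (fun n => \int[Q]_m (\sum_(0 <= i < n) ev m (F i)))); last first.
  by apply/funext => n; rewrite -ge0_integral_sum// => k; exact: mev.
apply: cvg_monotone_convergence => //.
- by move=> n; apply: emeasurable_sum => k; exact: mev.
- by move=> n x _; rewrite sume_ge0.
- by move=> x _ m n mn; exact: ereal_nondecreasing_series.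
Qed.

HB.instance Definition _ := isMeasure.Build _ _ _ mean_measure
  mean0 mean_ge0 mean_sigma_additive.

(** Campbell's formula: it holds for simple functions by linearity and passes to increasing limits
    on both sides. *)
Lemma integral_mean_measure (f : S -> \bar R) :
  measurable_fun setT f -> (forall x, 0 <= f x) ->
  \int[mean_measure]_x f x = \int[Q]_m \int[ev m]_x f x.
Proof.
move=> mf f0.
pose g := nnsfun_approx measurableT mf.
have mg n : measurable_fun setT (fun x => (g n x)%:E) by exact/measurable_EFinP.
have g0 n x : 0 <= (g n x)%:E by rewrite lee_fin.
have ndg x : {homo (fun n => (g n x)%:E) : n m / (n <= m)%N >-> n <= m}.
  by move=> n m nm; rewrite lee_fin; exact/lefP/nd_nnsfun_approx.
have fE x : f x = limn (fun n => (g n x)%:E).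
  by apply/esym/cvg_lim => //; exact: cvg_nnsfun_approx.
have sint n : \int[mean_measure]_x (g n x)%:E = \int[Q]_m \int[ev m]_x (g n x)%:E.
  rewrite integralT_nnsfun sintegralE.
  under [RHS]eq_integral do rewrite integralT_nnsfun sintegralE.
  have m1 r : measurable_fun setT (fun m => r%:E * ev m (g n @^-1` [set r])).
    by apply: measurable_funeM; exact: mev.
  have p1 r m : setT m -> 0 <= r%:E * ev m (g n @^-1` [set r]).
    by move=> _; exact: nnsfun_mulemu_ge0.
  rewrite ge0_integral_fsum//.
  apply: eq_fsbigr => r _; have [r0|r0] := leP 0%R r.
    by rewrite ge0_integralZl//; exact: mev.
  rewrite preimage_nnfun0// measure0 mule0 integral0_eq// => m _.
  by rewrite measure0 mule0.
transitivity (limn (fun n => \int[mean_measure]_x (g n x)%:E)).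
  by rewrite -monotone_convergence//; apply: eq_integral => x _; rewrite fE.
transitivity (limn (fun n => \int[Q]_m \int[ev m]_x (g n x)%:E)).
  by apply: congr_lim; apply/funext => n; exact: sint.
rewrite -[LHS]monotone_convergence//; last 3 first.
- by move=> n; exact: measurable_integral_ev.
- by move=> n m _; exact: integral_ge0.
- by move=> m _ n k nk; apply: ge0_le_integral => // x _; exact: ndg.
apply: eq_integral => m _.
by rewrite -monotone_convergence//; apply: eq_integral => x _; rewrite fE.
Qed.

Lemma exists_mean_measure : exists Q' : {measure set S -> \bar R},
  forall f : S -> \bar R, measurable_fun setT f -> (forall x, 0 <= f x) ->
  \int[Q']_x f x = \int[Q]_m \int[ev m]_x f x.
Proof. by exists mean_measure; exact: integral_mean_measure. Qed.

End random_measure.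

(** * Lebesgue measure: affine changes of variables, integrable weights *)

Section lebesgue.
Context {R : realType}.
Local Open Scope ereal_scope.

(** The multiple by c of the image measure agrees with Lebesgue measure on half-open intervals,
    hence everywhere by uniqueness. *)
Lemma lebesgue_affine1 (c b : R) (f : R -> \bar R) : (0 < c)%R ->
  measurable_fun setT f -> (forall x, 0 <= f x) ->
  \int[lebesgue_measure]_x f (c * x + b)%R =
  c^-1%:E * \int[lebesgue_measure]_x f x.
Proof.
move=> c0 mf f0; pose phi (x : R) : measurableTypeR R := (c * x + b)%R.
have mphi : measurable_fun setT phi.
  by apply: measurable_funD => //; exact: measurable_funM.
have cn : c != 0%R by rewrite gt_eqF.
pose nu := mscale (NngNum (ltW c0)) (pushforward (@lebesgue_measure R) phi).
have nuE (A : set (measurableTypeR R)) : measurable A -> lebesgue_measure A = nu mphi A.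
  apply: lebesgue_measure_unique => _ [[l r] _ <-]/=.
  rewrite /nu /mscale/= /pushforward.
  rewrite (_ : phi @^-1` _ = `](l - b) / c, (r - b) / c]%classic)%R; last first.
    apply/seteqP; split => x /=; rewrite !in_itv/= /phi.
      by rewrite ltr_pdivrMr// ler_pdivlMr// mulrC ltrBlDr lerBrDr.
    by rewrite ltr_pdivrMr// ler_pdivlMr// mulrC ltrBlDr lerBrDr.
  rewrite !lebesgue_measure_itv/= !lte_fin ltr_pM2r ?invr_gt0// ltrD2r.
  case: ifPn => _; last by rewrite mule0.
  by rewrite !EFinN -!EFinD -EFinM; congr EFin; field.
have -> : \int[lebesgue_measure]_x f x = \int[nu mphi]_x f x.
  by apply: eq_measure_integral => A mA _; exact: nuE.
rewrite ge0_integral_mscale//= ge0_integral_pushforward//.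
by rewrite muleA -EFinM mulVf// mul1e.
Qed.

Lemma integral_lebesgue_rVS n (f : 'rV[R]_n.+1 -> \bar R) :
  measurable_fun setT f -> (forall x, 0 <= f x) ->
  \int[lebesgue_rV n.+1]_x f x =
  \int[lebesgue_measure]_a \int[lebesgue_rV n]_v f (rcons0 (a, v)).
Proof.
move=> mf f0.
rewrite /= /lebesgue_step ge0_integral_pushforward//; last exact: measurable_rcons0.
rewrite fubini_tonelli1//.
  by apply: measurableT_comp => //; exact: measurable_rcons0.
by move=> x; exact: f0.
Qed.

Lemma measurable_inner_rV n (f : 'rV[R]_n.+1 -> \bar R) :
  measurable_fun setT f -> (forall x, 0 <= f x) ->
  measurable_fun setT (fun a => \int[lebesgue_rV n]_v f (rcons0 (a, v))).
Proof.
move=> mf f0.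
apply: (@measurable_fun_fubini_tonelli_F _ _ _ _ _ (lebesgue_rV n) (f \o @rcons0 R n)) => //.
  by apply: measurableT_comp => //; exact: measurable_rcons0.
by move=> x; exact: f0.
Qed.

Lemma measurable_affine n (c : R) (b : 'rV[R]_n) :
  measurable_fun setT (fun x : 'rV[R]_n => c *: x + b)%R.
Proof.
apply: measurable_fun_rV => i.
rewrite (_ : (fun _ => _) = (fun w : 'rV[R]_n => c * w ord0 i + b ord0 i)%R); last first.
  by apply/funext => w; rewrite !mxE.
by apply: measurable_funD => //; apply: measurable_funM => //; exact: measurable_coord.
Qed.

Lemma affine_rcons0 n (c : R) (b : 'rV[R]_n.+1) a v :
  (c *: rcons0 (a, v) + b =
  rcons0 (c * a + b ord0 ord0, c *: v + (rsubmx (b : 'rV_(1 + n)))))%R.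
Proof.
apply/rowP => i; rewrite [LHS]mxE [X in (X + _)%R]mxE.
case: (unliftP ord0 i) => [j ->|->]; last by rewrite !rcons0_head.
by rewrite !rcons0_tail !mxE; congr (_ + b _ _)%R; exact/val_inj.
Qed.

(** Induction on the dimension, peeling off the first coordinate. It serves with c = 1 as
    translation invariance and with c = 1/r for the scaling in the radius. *)
Lemma lebesgue_affine n (c : R) (b : 'rV[R]_n) (f : 'rV[R]_n -> \bar R) :
  (0 < c)%R -> measurable_fun setT f -> (forall x, 0 <= f x) ->
  \int[lebesgue_rV n]_x f (c *: x + b)%R =
  (c ^- n)%:E * \int[lebesgue_rV n]_x f x.
Proof.
move=> c0; elim: n b f => [|n IH] b f mf f0.
  rewrite /= expr0 invr1 mul1e; apply: eq_integral => x _; congr f.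
  by apply/rowP => -[].
have mfc : measurable_fun setT (fun x : 'rV[R]_n.+1 => f (c *: x + b)%R).
  by apply: (measurableT_comp mf); exact: measurable_affine.
pose G a := \int[lebesgue_rV n]_v f (rcons0 (a, v)).
have mG : measurable_fun setT G by exact: measurable_inner_rV.
have G0 a : 0 <= G a by exact: integral_ge0.
have mfa a : measurable_fun setT (fun v => f (rcons0 (a, v))).
  by apply: (measurableT_comp mf); apply: (measurableT_comp (@measurable_rcons0 R n)).
rewrite !integral_lebesgue_rVS// -/(G _).
transitivity (\int[lebesgue_measure]_a ((c ^- n)%:E * G (c * a + b ord0 ord0)%R)).
  apply: eq_integral => a _; rewrite /G -(IH (rsubmx (b : 'rV_(1 + n))))//.
  by apply: eq_integral => v _; rewrite affine_rcons0.
have mGc : measurable_fun setT (fun a => G (c * a + b ord0 ord0)%R).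
  apply: (measurableT_comp mG).
  by apply: measurable_funD => //; exact: measurable_funM.
have cn0 : 0 <= (c ^- n)%:E by rewrite lee_fin invr_ge0 exprn_ge0// ltW.
have Gc0 a : setT a -> 0 <= G (c * a + b ord0 ord0)%R by [].
rewrite (ge0_integralZl lebesgue_measure measurableT mGc Gc0 cn0).
rewrite (@lebesgue_affine1 c _ G)// muleA -EFinM.
by congr (_ * _); congr EFin; rewrite exprS invfM mulrC.
Qed.

Lemma integral_oneDsqrV_lty :
  \int[lebesgue_measure]_x (1 + x ^+ 2)^-1%:E < +oo :> \bar R.
Proof.
have mo : measurable_fun setT (fun x : R => (1 + x ^+ 2)^-1%:E).
  by apply/measurable_EFinP; apply: continuous_measurable_fun; exact: continuous_oneDsqrV.
have o0 (x : R) : 0 <= (1 + x ^+ 2)^-1%:E.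
  by rewrite lee_fin invr_ge0 addr_ge0// sqr_ge0.
have I1 : \int[lebesgue_measure]_(x in `[0%R, +oo[) (1 + x ^+ 2)^-1%:E = (pi / 2)%:E :> \bar R.
  exact: integral0y_oneDsqr.
have I2 : \int[lebesgue_measure]_(x in `]-oo, 0%R]) (1 + x ^+ 2)^-1%:E = (pi / 2)%:E :> \bar R.
  rewrite -I1 [RHS]ge0_integration_by_substitution0//.
  by apply: eq_integral => x _; rewrite sqrrN.
have RE : [set: R] = `]-oo, 0%R[ `|` `[0%R, +oo[.
  apply/seteqP; split=> // x _ /=; rewrite !in_itv/= andbT.
  by case: (ltP x 0%R) => [|]; [left|right].
rewrite RE ge0_integral_setU//=; last 2 first.
- by rewrite -RE.
- apply/disj_setPS => x [] /=; rewrite !in_itv/= andbT => x0.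
  by rewrite leNgt x0.
rewrite I1 lte_add_pinfty ?ltry//.
rewrite (@le_lt_trans _ _ (pi / 2)%:E) ?ltry// -I2.
apply: ge0_subset_integral => //=; first exact: measurable_funS mo.
by move=> x; rewrite /= !in_itv/= => /ltW.
Qed.

Lemma integral_prod_rV (f : R -> R) n : measurable_fun setT f ->
  (forall x, 0 <= f x)%R -> \int[lebesgue_measure]_x (f x)%:E < +oo ->
  \int[lebesgue_rV n]_v (\prod_i f (v ord0 i))%R%:E < +oo.
Proof.
move=> mf f0 foo.
have mprod k : measurable_fun setT (fun v : 'rV[R]_k => (\prod_i f (v ord0 i))%R).
  apply: measurable_prod => i _.
  by apply: measurableT_comp => //; exact: measurable_coord.
elim: n => [|n IH].
  rewrite /= integral_dirac//; first by rewrite diracT mul1e ltry.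
  by apply/measurable_EFinP; exact: (mprod 0%N).
rewrite integral_lebesgue_rVS//; last 2 first.
- exact/measurable_EFinP.
- by move=> x; rewrite lee_fin prodr_ge0.
under eq_integral => a _.
  under eq_integral => v _.
    rewrite big_ord_recl rcons0_head; under eq_bigr do rewrite rcons0_tail.
    rewrite EFinM; over.
  rewrite ge0_integralZl//; last 3 first.
  - exact/measurable_EFinP.
  - by move=> v _; rewrite lee_fin prodr_ge0.
  - by rewrite lee_fin.
  over.
rewrite ge0_integralZr//; last 3 first.
- exact/measurable_EFinP.
- by move=> x _; rewrite lee_fin.
- by apply: integral_ge0 => v _; rewrite lee_fin prodr_ge0.
have If0 : 0 <= \int[lebesgue_measure]_x (f x)%:E.
  by apply: integral_ge0 => x _; rewrite lee_fin.
by apply: lte_mul_pinfty => //; rewrite ge0_fin_numE.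
Qed.

(** (1 + |x|^2)^n dominates the product of the 1 + x_i^2, which reduces integrability to one
    arctangent integral per coordinate. *)
Lemma powinv11_integrable n m : (n <= m)%N ->
  \int[lebesgue_rV n]_x (powinv 1 1 m (sqnorm x))%:E < +oo :> \bar R.
Proof.
move=> nm.
have mo : measurable_fun setT (fun x : R => (1 + x ^+ 2)^-1)%R.
  by apply: continuous_measurable_fun; exact: continuous_oneDsqrV.
have o0 (x : R) : (0 <= (1 + x ^+ 2)^-1)%R.
  by rewrite invr_ge0 addr_ge0// sqr_ge0.
apply: le_lt_trans (@integral_prod_rV _ n mo o0 integral_oneDsqrV_lty).
apply: ge0_le_integral => //.
- by move=> x _; rewrite lee_fin exprn_ge0// invr_ge0 mul1r addr_ge0// sqnorm_ge0.
- apply/measurable_EFinP; apply: continuous_measurable_rV => x.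
  apply: continuous_powinv_sqnorm; rewrite mul1r gt_eqF// ltr_pwDl//; exact: sqnorm_ge0.
- apply/measurable_EFinP; apply: measurable_prod => i _.
  by apply: (measurableT_comp mo); exact: measurable_coord.
- move=> x _; rewrite lee_fin /powinv mul1r prodfV exprVn.
  have x0 := sqnorm_ge0 x.
  rewrite lef_pV2 ?posrE; last 2 first.
  + by rewrite exprn_gt0// ltr_pwDl.
  + by apply: prodr_gt0 => i _; rewrite ltr_pwDl// sqr_ge0.
  apply: (@le_trans _ _ ((1 + sqnorm x) ^+ n)%R); last by rewrite ler_weXn2l// lerDl.
  rewrite -[X in (_ ^+ X)%R]card_ord -prodr_const.
  apply: ler_prod => i _; rewrite addr_ge0 ?sqr_ge0//= lerD2l /sqnorm (bigD1 i)//= lerDl.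
  by apply: sumr_ge0 => j _; exact: sqr_ge0.
Qed.

(** Continuous and positive exactly on the open ball, for r > 0, so that its multiples by k increase
    to +oo there and vanish elsewhere. *)
Definition cutoff n (r : R) (x : 'rV[R]_n) : R :=
  Num.max 0%R (r ^+ 2 - sqnorm x)%R.

Lemma cutoff_ge0 n (r : R) (x : 'rV[R]_n) : (0 <= cutoff r x)%R.
Proof. by rewrite /cutoff le_max lexx. Qed.

Lemma continuous_cutoff n (r : R) : continuous (@cutoff n r).
Proof.
move=> x; apply: (@continuous_max _ _ (cst 0%R)
  (fun x : 'rV[R]_n => r ^+ 2 - sqnorm x)%R); first exact: cst_continuous.
exact: (cvgB (cvg_cst (r ^+ 2)%R) (@continuous_sqnorm R n x)).
Qed.

Lemma integral_cutoff_gt0 n (r : R) : (0 < r)%R ->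
  0 < \int[lebesgue_rV n]_x (cutoff r x)%:E.
Proof.
move=> r0.
(* Since n e^2 <= r^2 / 2, the cube of half-side [e] lies where the cutoff is at least r^2 / 2. *)
pose e : R := (r / (2 * n.+1%:R))%R.
have e0 : (0 < e)%R by rewrite divr_gt0// mulr_gt0.
pose B : set 'rV[R]_n := [set v | forall i, `](- e)%R, e[%classic (v ord0 i)].
have mB : measurable B.
  by apply: (@measurable_box R n (fun=> `](- e)%R, e[%classic)) => i; exact: measurable_itv.
have B0 : 0 < lebesgue_rV n B.
  rewrite /B (@lebesgue_rV_box R n (fun=> `](- e)%R, e[%classic)); last first.
    by move=> i; exact: measurable_itv.
  apply: (big_ind (fun x => 0 < x)) => //.
    by move=> x y; exact: mule_gt0.
  by move=> i _; rewrite lebesgue_measure_itv/= lte_fin gtrN// -EFinB lte_fin; lra.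
have Bcutoff x : B x -> (r ^+ 2 / 2 <= cutoff r x)%R.
  move=> Bx; rewrite /cutoff le_max; apply/orP; right.
  suff : (sqnorm x <= r ^+ 2 / 2)%R by lra.
  apply: (@le_trans _ _ (\sum_(i < n) e ^+ 2)%R).
    apply: ler_sum => i _; have := Bx i; rewrite /= in_itv/= => /andP[h1 h2].
    by nra.
  rewrite sumr_const card_ord -[leLHS]mulr_natl /e.
  rewrite expr_div_n exprMn.
  have n1 : (1 <= n.+1%:R :> R)%R by rewrite ler1n.
  have n2 : (n%:R <= n.+1%:R :> R)%R by rewrite ler_nat.
  have n0 : (0 <= n%:R :> R)%R by [].
  rewrite mulrA ler_pdivrMr; last by rewrite mulr_gt0// exprn_gt0// ltr0n.
  have := sqr_ge0 r; nra.
apply: (@lt_le_trans _ _ (\int[lebesgue_rV n]_x ((r ^+ 2 / 2)%:E * (\1_B x)%:E))).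
  rewrite ge0_integralZl//; last 2 first.
  - exact/measurable_EFinP.
  - by rewrite lee_fin divr_ge0// sqr_ge0.
  by rewrite integral_indic// setIT mule_gt0// lte_fin divr_gt0// exprn_gt0.
apply: ge0_le_integral => //.
- by move=> x _; rewrite -EFinM lee_fin mulr_ge0// divr_ge0// sqr_ge0.
- by apply: measurable_funeM; exact/measurable_EFinP.
- by apply/measurable_EFinP; apply: continuous_measurable_rV; exact: continuous_cutoff.
- move=> x _; rewrite -EFinM lee_fin indicE.
  have [/set_mem/Bcutoff|_] := boolP (x \in B); first by rewrite mulr1.
  by rewrite mulr0 cutoff_ge0.
Qed.

End lebesgue.

Lemma cvg_EFinr (T : Type) (F : set_system T) {FF : Filter F} (R : realType)
    (u : T -> R) (l : R) :
  u x @[x --> F] --> l -> (u x)%:E @[x --> F] --> l%:E.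
Proof. by move=> ul; apply/fine_cvgP; split; [exact: nearW|exact: ul]. Qed.

(** * The Laplace functional of the Poisson random measure *)

Section poisson_series.
Context {R : realType}.
Local Open Scope ereal_scope.

Lemma poisson_prob_series (a : R) :
  \sum_(k <oo) poisson_prob a 0 [set k] = 1.
Proof.
rewrite -(probability_setT (poisson_prob a 0)).
have -> : [set: nat] = \bigcup_k [set k].
  by apply/esym/seteqP; split=> // k _; exists k.
rewrite measure_bigcup//.
- by apply: eq_eseriesl => k; rewrite in_setT.
- apply/trivIsetP => i j _ _ ij; rewrite -subset0 => k [/= -> /eqP].
  by rewrite (negPf ij).
Qed.

Lemma poisson_prob_set1 (a : R) k : (0 <= a)%R ->
  poisson_prob a 0 [set k] = ((a ^+ k) * k`!%:R^-1 * expR (- a))%:E.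
Proof.
move=> a0; rewrite /poisson_prob; case: ifPn => [a1|].
  rewrite esum_set1 /poisson_pmf ?a1// lee_fin.
  by rewrite !mulr_ge0 ?exprn_ge0// expR_ge0.
rewrite -leNgt => a1; have -> : a = 0%R by apply/eqP; rewrite eq_le a1.
rewrite diracE oppr0 expR0 mulr1; case: k => [|k].
  by rewrite mem_set//= expr0 fact0 invr1 mulr1.
by rewrite memNset//= expr0n mul0r.
Qed.

(** Exponential tilting: e^(-ck) times the Poisson weight of rate a is a constant times the Poisson
    weight of rate a e^(-c), and the latter weights sum to 1. *)
Lemma poisson_laplace_series (a c : R) : (0 <= a)%R ->
  \sum_(k <oo) (expR (- (c * k%:R)))%:E * poisson_prob a 0 [set k] =
  (expR (- (a * (1 - expR (- c)))))%:E.
Proof.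
move=> a0.
have ac0 : (0 <= a * expR (- c))%R by rewrite mulr_ge0 ?expR_ge0.
transitivity (\sum_(k <oo) (expR (- (a * (1 - expR (- c)))))%:E *
    poisson_prob (a * expR (- c))%R 0 [set k]).
  apply: eq_eseriesr => k _; rewrite !poisson_prob_set1// -!EFinM; congr EFin.
  rewrite exprMn -expRM_natr mulNr [RHS]mulrCA.
  rewrite (_ : expR (- (a * (1 - expR (- c)))) =
     expR (- a) * expR (a * expR (- c)))%R; last by rewrite -expRD; congr expR; ring.
  rewrite expRN (expRN (a * expR (- c))).
  by field; rewrite !gt_eqF ?expR_gt0// ltr0n fact_gt0.
rewrite nneseriesZl; last by move=> k _; exact: measure_ge0.
by rewrite poisson_prob_series mule1.
Qed.

End poisson_series.

Lemma emeasurable_prod d (T : measurableType d) (R : realType) (I : Type)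
    (s : seq I) (P : pred I) (f : I -> T -> \bar R) :
  (forall i, measurable_fun setT (f i)) ->
  measurable_fun setT (fun x => \prod_(i <- s | P i) f i x)%E.
Proof.
move=> mf; elim: s => [|i s IH].
  by under eq_fun do rewrite big_nil; exact: measurable_cst.
under eq_fun do rewrite big_cons.
by case: (P i) => //; exact: emeasurable_funM.
Qed.

Lemma measurable_expeR (R : realType) : measurable_fun setT (@expeR R).
Proof.
apply: (measurability _ (ErealGenOInfty.measurableE R)) => //.
move=> _ [_ [r ->] <-]; rewrite setTI.
have [r0|r0] := ltP r 0.
  rewrite (_ : _ @^-1` _ = setT)//; apply/seteqP; split => // x _.
  by rewrite /= in_itv/= andbT (lt_le_trans _ (expeR_ge0 x))// lte_fin.
have [y yr] := @expeR_total R r%:E r0.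
rewrite (_ : _ @^-1` _ = `]y, +oo[%classic); first exact: emeasurable_itv.
by apply/seteqP; split => x /=; rewrite !in_itv/= !andbT -yr lte_expeR.
Qed.

(** * From Poisson counts to the Laplace functional *)

Section poisson_random_measure.
Context {R : realType} {d : nat} {p : R}.
Local Notation T := (@tempered R d p).
Variables (lambda : {measure set 'rV[R]_d -> \bar R}) (Pi : probability T R).
Hypothesis PRM : is_PRM lambda Pi.
Local Open Scope ereal_scope.

(** The Poisson weights sum to 1, so the events on which the count of [A] is a given natural number
    exhaust the space up to a null set. *)
Lemma prm_split (A : set 'rV[R]_d) (G : T -> \bar R) :
  measurable A -> lambda A < +oo ->
  measurable_fun setT G -> (forall mu, 0 <= G mu) ->
  \int[Pi]_mu G mu =
  \sum_(k <oo) \int[Pi]_(mu in [set mu : T | mu A = k%:R%:E]) G mu.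
Proof.
move=> mA Aoo mG G0.
pose E (k : nat) := [set mu : T | mu A = k%:R%:E].
have mE k : measurable (E k).
  rewrite -[X in measurable X]setTI.
  exact: (@measurable_ev R d p A mA measurableT [set k%:R%:E] (emeasurable_set1 _)).
have tE : trivIset setT E.
  apply/trivIsetP => i j _ _ ij; rewrite -subset0 => mu [/= muE].
  rewrite /E/= muE => -[/eqP].
  by rewrite eqr_nat (negPf ij).
have mUE : measurable (\bigcup_k E k) by exact: bigcup_measurable.
have PE : Pi (\bigcup_k E k) = 1.
  rewrite measure_bigcup// -[RHS](poisson_prob_series (fine (lambda A))).
  transitivity (\sum_(k <oo) Pi (E k)).
    by apply: eq_eseriesl => k; rewrite in_setT.
  by apply: eq_eseriesr => k _; rewrite (PRM.1 A k mA Aoo).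
have PEc : Pi (~` \bigcup_k E k) = 0.
  by rewrite probability_setC// PE subee.
rewrite (ge0_negligible_integral (measurableC mUE) measurableT mG)//.
rewrite setTD setCK ge0_integral_bigcup//.
exact: measurable_funS mG.
Qed.

Section simple.
Variables (n : nat) (A : 'I_n -> set 'rV[R]_d) (c : 'I_n -> R).
Hypotheses (mA : forall i, measurable (A i)) (tA : trivIset setT A).
Hypotheses (Aoo : forall i, lambda (A i) < +oo) (c0 : forall i, (0 <= c i)%R).

(** [W] is a hybrid factor, an exponential or the indicator of an event on the count; [V] is its
    expectation. They interpolate between the independence of events given by [is_PRM] and the
    product formula for exponentials. *)
Let W (b : bool) (B : set (\bar R)) i (mu : T) : \bar R :=
  if b then expeR (- ((c i)%:E * mu (A i))) else (\1_B (mu (A i)))%:E.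

Let V (b : bool) (B : set (\bar R)) i : \bar R :=
  if b then (expR (- (fine (lambda (A i)) * (1 - expR (- c i)))))%:E
  else Pi [set mu : T | B (mu (A i))].

Let mW b B i : measurable B -> measurable_fun setT (W b B i).
Proof.
move=> mB; rewrite /W; case: b.
  apply: (measurableT_comp (@measurable_expeR R)); apply: measurableT_comp => //.
  by apply: measurable_funeM; exact: measurable_ev.
apply/measurable_EFinP; apply: measurableT_comp => //; exact: measurable_ev.
Qed.

Let mpre i (B : set (\bar R)) : measurable B ->
  measurable [set mu : T | B (mu (A i))].
Proof.
move=> mB; rewrite -[X in measurable X]setTI.
exact: (@measurable_ev R d p (A i) (mA i) measurableT _ mB).
Qed.

Let W0 b B i mu : 0 <= W b B i mu.
Proof. by rewrite /W; case: b; [exact: expeR_ge0|rewrite lee_fin]. Qed.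

(** Induction on the number of exponential factors. The new one is split over the values k of its
    count; on each piece it is constant, and the piece is again an indicator factor, to which the
    induction hypothesis applies. *)
Let prm_indep j : (j <= n)%N -> forall B : 'I_n -> set (\bar R),
  (forall i, measurable (B i)) ->
  \int[Pi]_mu (\prod_(i < n) W (i < j)%N (B i) i mu) =
  \prod_(i < n) V (i < j)%N (B i) i.
Proof.
elim: j => [_|j IH jn] B mB.
  rewrite -(PRM.2 n A B)//.
  have mI : measurable [set mu : T | forall i, B i (mu (A i))].
    rewrite (_ : mkset _ = \bigcap_(i in [set: 'I_n])
        ((fun mu : T => mu (A i)) @^-1` B i)); last first.
      by apply/seteqP; split=> w /= h i; [move=> _; exact: h|exact: h].
    apply: fin_bigcap_measurable => // i _.
    exact: mpre.
  transitivity (\int[Pi]_mu (\1_[set mu : T | forall i, B i (mu (A i))] mu)%:E); last first.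
    by rewrite integral_indic// setIT.
  apply: eq_integral => mu _; rewrite indicE; apply/esym.
  have [/set_mem/= h|/negP h] := boolP (mu \in _).
    by rewrite big1// => i _; rewrite /W/= indicE mem_set.
  have [i Bi] : exists i, ~ B i (mu (A i)).
    by apply/existsNP => h'; apply: h; rewrite inE.
  by rewrite (bigD1 i)//= /W/= indicE memNset// mul0e.
pose i0 := Ordinal jn.
have nei0 (i : 'I_n) : i != i0 -> (i < j.+1)%N = (i < j)%N.
  by move=> ii0; rewrite ltnS leq_eqVlt (_ : (i == j :> nat) = (i == i0))// (negPf ii0).
pose G mu := \prod_(i < n | i != i0) W (i < j)%N (B i) i mu.
pose C := \prod_(i < n | i != i0) V (i < j)%N (B i) i.
have mWB (i : 'I_n) : measurable_fun setT (W (i < j)%N (B i) i) by exact: mW.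
have mG : measurable_fun setT G by exact: emeasurable_prod.
have G0 mu : 0 <= G mu by apply: prode_ge0 => i _; exact: W0.
have IHB (D : set (\bar R)) : measurable D ->
    \int[Pi]_mu (W false D i0 mu * G mu) = V false D i0 * C.
  move=> mD; pose B' (i : 'I_n) := if i == i0 then D else B i.
  transitivity (\int[Pi]_mu \prod_(i < n) W (i < j)%N (B' i) i mu).
    apply: eq_integral => mu _; rewrite [RHS](bigD1 i0)//= /B' eqxx ltnn; congr (_ * _).
    by apply: eq_bigr => i /negPf ->.
  rewrite IH; [|exact: ltnW|by move=> i; rewrite /B'; case: ifPn].
  rewrite (bigD1 i0)//= /B' eqxx ltnn; congr (_ * _).
  by apply: eq_bigr => i /negPf ->.
rewrite (bigD1 i0)//= ltnSn.
rewrite (eq_bigr (fun i : 'I_n => V (i < j)%N (B i) i)); last by move=> i /nei0 ->.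
rewrite -/C.
transitivity (\int[Pi]_mu (W true (B i0) i0 mu * G mu)).
  apply: eq_integral => mu _; rewrite (bigD1 i0)//= ltnSn; congr (_ * _).
  by apply: eq_bigr => i /nei0 ->.
rewrite (prm_split (mA i0) (Aoo i0)); last 2 first.
- by apply: emeasurable_funM => //; exact: mW.
- by move=> mu; rewrite mule_ge0// W0.
rewrite /V -poisson_laplace_series ?fine_ge0 ?measure_ge0//.
have C0 : 0 <= C.
  apply: prode_ge0 => i _; rewrite /V; case: ifP => _; last exact: measure_ge0.
  by rewrite lee_fin expR_ge0.
have Cfin : C \is a fin_num.
  apply: (big_ind (fun x => x \is a fin_num)) => //; first exact: fin_numM.
  move=> i _; rewrite /V; case: ifP => // _.
  by apply: fin_num_measure; exact: (mpre i (mB i)).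
rewrite -(fineK Cfin) muleC -nneseriesZl; last first.
  by move=> k _; rewrite mule_ge0 ?lee_fin ?expR_ge0// measure_ge0.
apply: eq_eseriesr => k _.
have mk : measurable [set k%:R%:E : \bar R] by exact: emeasurable_set1.
have := IHB [set k%:R%:E] mk.
rewrite /V (PRM.1 (A i0) k (mA i0) (Aoo i0)) fineK// => IHk.
transitivity ((expR (- (c i0 * k%:R)))%:E *
    \int[Pi]_mu (W false [set k%:R%:E] i0 mu * G mu)); last first.
  by rewrite IHk [in RHS]muleC -muleA.
have mWG : measurable_fun setT (fun mu => W false [set k%:R%:E] i0 mu * G mu).
  by apply: emeasurable_funM => //; exact: mW.
have WG0 mu : setT mu -> 0 <= W false [set k%:R%:E] i0 mu * G mu.
  by move=> _; rewrite mule_ge0// W0.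
have e0 : 0 <= (expR (- (c i0 * k%:R)))%:E :> \bar R by rewrite lee_fin expR_ge0.
rewrite -(ge0_integralZl Pi measurableT mWG WG0 e0) [LHS]integral_mkcond; apply: eq_integral => mu _.
rewrite patchE /W; have [/set_mem/= h|/negP h] := boolP (mu \in _).
  by rewrite h indicE mem_set// mul1e.
by rewrite indicE memNset ?mul0e ?mule0// => h'; apply: h; rewrite inE.
Qed.

Lemma prm_laplace_simple :
  \int[Pi]_mu expeR (- \sum_(i < n) (c i)%:E * mu (A i)) =
  expeR (- \sum_(i < n) lambda (A i) * (1 - expR (- c i))%:E).
Proof.
have := @prm_indep n (leqnn n) (fun=> setT) (fun=> measurableT).
have -> : \prod_(i < n) V (i < n)%N setT i =
    expeR (- \sum_(i < n) lambda (A i) * (1 - expR (- c i))%:E).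
  rewrite (_ : \sum_(i < n) _ = (\sum_(i < n) (fine (lambda (A i)) * (1 - expR (- c i))))%R%:E).
    rewrite -EFinN /= -sumrN expR_sum -prodEFin.
    by apply: eq_bigr => i _; rewrite /V ltn_ord.
  rewrite -sumEFin; apply: eq_bigr => i _.
  by rewrite EFinM fineK// ge0_fin_numE.
move=> <-; apply: eq_integral => mu _.
rewrite [RHS](eq_bigr (fun i : 'I_n => W true setT i mu)); last by move=> i _; rewrite ltn_ord.
suff : 0 <= \sum_(i < n) (c i)%:E * mu (A i) /\
  expeR (- \sum_(i < n) (c i)%:E * mu (A i)) = \prod_(i < n) W true setT i mu by case.
apply: (big_ind2 (fun x y : \bar R => 0 <= x /\ expeR (- x) = y)).
- by rewrite oppe0 expeR0.
- move=> x1 y1 x2 y2 [x10 <-] [x20 <-]; split; first exact: adde_ge0.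
  by rewrite oppeD ?expeRD// ge0_adde_def// inE.
- by move=> i _; rewrite mule_ge0 ?lee_fin.
Qed.

End simple.

Import HBNNSimple.

Lemma prm_laplace_nnsfun (g : {nnsfun 'rV[R]_d >-> R}) :
  \int[lambda]_x (g x)%:E < +oo ->
  \int[Pi]_mu expeR (- \int[mu]_x (g x)%:E) =
  expeR (- \int[lambda]_x (1 - expR (- g x))%:E).
Proof.
move=> goo.
have /finite_seqP[rg rgE] : finite_set (range g) by exact: fimfunP.
have in_rg r : (r \in rg) = (r \in range g).
  by apply/idP/idP; rewrite inE rgE.
(* The value 0 is left out, because its level set may have infinite intensity; without repetitions,
   the remaining level sets are disjoint. *)
pose s : seq R := [seq r <- undup rg | r != 0%R].
have us : uniq s by rewrite filter_uniq// undup_uniq.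
pose A (i : 'I_(size s)) := g @^-1` [set s`_i]%R.
have mA i : measurable (A i) by exact: measurable_sfunP.
have s0 (i : 'I_(size s)) : (0 < s`_i)%R.
  have : s`_i \in s by exact: mem_nth.
  rewrite mem_filter mem_undup in_rg => /andP[si0 /set_mem[x _ gx]].
  by rewrite lt_neqAle eq_sym si0/= -gx.
have tA : trivIset setT A.
  apply/trivIsetP => i j _ _ ij; rewrite -subset0 => x [/= gx].
  rewrite /A/= gx => /eqP.
  by rewrite nth_uniq// (inj_eq val_inj) (negPf ij).
(* Stated for any F with F 0 = 0, to cover both r and 1 - e^(-r). *)
have gE (F : R -> R) x : F 0%R = 0%R -> F (g x) = (\sum_(i < size s) F s`_i * \1_(A i) x)%R.
  move=> F0; have [gx0|gx0] := eqVneq (g x) 0%R.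
    rewrite gx0 F0 big1// => i _; rewrite indicE memNset ?mulr0// => h.
    by have := s0 i; rewrite -h gx0 ltxx.
  have gs : g x \in s by rewrite mem_filter gx0/= mem_undup in_rg; apply/mem_set; exists x.
  have sz : (index (g x) s < size s)%N by rewrite index_mem.
  have Ax : A (Ordinal sz) x by rewrite /A/= nth_index.
  rewrite (bigD1 (Ordinal sz))//= indicE (mem_set Ax) mulr1 nth_index//.
  rewrite big1 ?addr0// => i ii0; rewrite indicE memNset ?mulr0// => h.
  by move: ii0; rewrite -val_eqE/= h index_uniq// eqxx.
have intE (m : {measure set 'rV[R]_d -> \bar R}) (F : R -> R) : F 0%R = 0%R ->
    (forall i : 'I_(size s), 0 <= F s`_i)%R ->
    \int[m]_x (F (g x))%:E = \sum_(i < size s) (F s`_i)%:E * m (A i).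
  move=> F0 Fge0.
  under eq_integral do rewrite (gE F)// -sumEFin.
  rewrite ge0_integral_sum//; last 2 first.
  - by move=> i; apply/measurable_EFinP; exact: measurable_funM.
  - by move=> i x _; rewrite lee_fin mulr_ge0.
  apply: eq_bigr => i _; under eq_integral do rewrite EFinM.
  rewrite ge0_integralZl//; last 2 first.
  - exact/measurable_EFinP.
  - by rewrite lee_fin.
  by rewrite integral_indic// setIT.
have Aoo i : lambda (A i) < +oo.
  rewrite ltey; apply/eqP => Aoo; move: goo.
  rewrite (intE lambda id)//; last by move=> j; exact: ltW.
  rewrite (bigD1 i)//= Aoo gt0_muley ?lte_fin// addye//.
  rewrite gt_eqF// (@lt_le_trans _ _ 0)// sume_ge0// => j _.
  by rewrite mule_ge0// lee_fin ltW.
transitivity (\int[Pi]_mu expeR (- \sum_(i < size s) (s`_i)%R%:E * mu (A i))).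
  by apply: eq_integral => mu _; rewrite (intE mu id)// => i; exact: ltW.
rewrite (prm_laplace_simple mA tA Aoo (fun i => ltW (s0 i))); congr expeR; congr (- _).
rewrite (intE lambda (fun r => 1 - expR (- r))%R).
- by apply: eq_bigr => i _; rewrite muleC.
- by rewrite oppr0 expR0 subrr.
- by move=> i; rewrite subr_ge0 expR_le1 oppr_le0 ltW.
Qed.

(** Simple functions increase to [f]. The left side converges by dominated convergence, the
    integrands being at most 1, and the right side by monotone convergence; finiteness of all
    integrals lets the exponential be treated as a continuous real function. *)
Lemma prm_laplace (f : 'rV[R]_d -> R) : measurable_fun setT f ->
  (forall x, 0 <= f x)%R -> \int[lambda]_x (f x)%:E < +oo ->
  (forall mu : T, \int[mu]_x (f x)%:E < +oo) ->
  \int[Pi]_mu expeR (- \int[mu]_x (f x)%:E) =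
  expeR (- \int[lambda]_x (1 - expR (- f x))%:E).
Proof.
move=> mf f0 foo fmu.
have mfE : measurable_fun setT (EFin \o f) by exact/measurable_EFinP.
pose g := nnsfun_approx measurableT mfE.
have cg x : (g n x)%:E @[n --> \oo] --> (f x)%:E.
  by apply: cvg_nnsfun_approx => // y _; rewrite lee_fin.
have ndg x n m : (n <= m)%N -> (g n x <= g m x)%R.
  by move=> nm; exact/lefP/nd_nnsfun_approx.
have gf n x : (g n x <= f x)%R.
  by rewrite -lee_fin /g nnsfun_approxE; apply: le_approx => // y _; rewrite lee_fin.
have mg n : measurable_fun setT (fun x => (g n x)%:E) by exact/measurable_EFinP.
have cint (m : {measure set 'rV[R]_d -> \bar R}) :
    \int[m]_x (g n x)%:E @[n --> \oo] --> \int[m]_x (f x)%:E.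
  rewrite (_ : \int[m]_x (f x)%:E = \int[m]_x limn (fun n => (g n x)%:E)).
    apply: cvg_monotone_convergence => //.
    - by move=> n x _; rewrite lee_fin.
    - by move=> x _ n k nk; rewrite lee_fin ndg.
  by apply: eq_integral => x _; apply/esym/cvg_lim.
have lgoo n (m : {measure set 'rV[R]_d -> \bar R}) :
    \int[m]_x (f x)%:E < +oo -> \int[m]_x (g n x)%:E < +oo.
  apply: le_lt_trans; apply: ge0_le_integral => //.
  - by move=> x _; rewrite lee_fin.
  - by move=> x _; rewrite lee_fin.
have intge0 (m : {measure set 'rV[R]_d -> \bar R}) (h : 'rV[R]_d -> R) :
  (forall x, 0 <= h x)%R -> 0 <= \int[m]_x (h x)%:E.
  by move=> h0; apply: integral_ge0 => x _; rewrite lee_fin.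
have cexp (a : nat -> \bar R) (l : \bar R) : (forall n, 0 <= a n < +oo) -> 0 <= l < +oo ->
    a n @[n --> \oo] --> l -> expeR (- a n) @[n --> \oo] --> expeR (- l).
  move=> afin lfin al.
  have aE n : a n = (fine (a n))%:E by rewrite fineK// ge0_fin_numE; case/andP : (afin n).
  have lE : l = (fine l)%:E by rewrite fineK// ge0_fin_numE; case/andP : lfin.
  have -> : (fun n => expeR (- a n)) = (fun n => (expR (- fine (a n)))%:E).
    by apply/funext => n; rewrite {1}aE.
  have -> : expeR (- l) = (expR (- fine l))%:E by rewrite {1}lE.
  apply: (@cvg_EFinr _ \oo _ R (fun n => expR (- fine (a n)))).
  have fal : (- fine (a n))%R @[n --> \oo] --> (- fine l)%R.
    by apply: cvgN; move: al; rewrite {1}lE => /fine_cvgP[_].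
  exact: (cvg_comp _ _ fal (@continuous_expR R _)).
have L : \int[Pi]_mu expeR (- \int[mu]_x (g n x)%:E) @[n --> \oo] -->
    \int[Pi]_mu expeR (- \int[mu]_x (f x)%:E).
  apply: (@dominated_cvg _ _ _ Pi setT measurableT
     (fun n (mu : T) => expeR (- \int[mu]_x (g n x)%:E)) _ (EFin \o cst 1%R)).
  - move=> n; apply: (measurableT_comp (@measurable_expeR R)); apply: measurableT_comp => //.
    apply: (@measurable_integral_ev _ _ _ _ _ (fun mu : T => mu)) => //.
      by move=> A mA; exact: measurable_ev.
    by move=> x; rewrite lee_fin.
  - move=> mu _; apply: cexp; last exact: cint.
    + by move=> n; rewrite intge0//= lgoo.
    + by rewrite intge0//= fmu.
  - by [].
  - exact: (finite_measure_integrable_cst Pi 1%R measurableT).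
  - move=> n mu _; rewrite gee0_abs ?expeR_ge0//= -expeR0 lee_expeR.
    by rewrite oppe_le0 intge0.
have E : (fun n => \int[Pi]_mu expeR (- \int[mu]_x (g n x)%:E)) =
    (fun n => expeR (- \int[lambda]_x (1 - expR (- g n x))%:E)).
  by apply/funext => n; exact: (prm_laplace_nnsfun (lgoo n _ foo)).
rewrite E in L; apply: (cvg_unique _ L) => //.
have h01 (h : 'rV[R]_d -> R) x : (0 <= h x)%R -> (0 <= 1 - expR (- h x) <= h x)%R.
  move=> hx0; rewrite subr_ge0 -expR0 ler_expR oppr_le0 hx0/=.
  by rewrite expR0; have := expR_ge1Dx (- h x)%R; lra.
have mh (h : 'rV[R]_d -> R) : measurable_fun setT h ->
    measurable_fun setT (fun x => (1 - expR (- h x))%:E).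
  move=> mh; apply/measurable_EFinP; apply: measurable_funB => //.
  by apply: measurableT_comp => //; exact: measurableT_comp.
have hoo (h : 'rV[R]_d -> R) : measurable_fun setT h -> (forall x, 0 <= h x)%R ->
    \int[lambda]_x (h x)%:E < +oo -> \int[lambda]_x (1 - expR (- h x))%:E < +oo.
  move=> mh0 h0; apply: le_lt_trans; apply: ge0_le_integral => //.
  - by move=> x _; rewrite lee_fin; case/andP : (h01 h x (h0 x)).
  - exact: mh.
  - exact/measurable_EFinP.
  - by move=> x _; rewrite lee_fin; case/andP : (h01 h x (h0 x)).
apply: cexp.
- move=> n; rewrite intge0/= ?hoo ?lgoo// => x.
  by case/andP : (h01 (g n) x (fun_ge0 x)).
- rewrite intge0/= ?hoo// => x.
  by case/andP : (h01 f x (f0 x)).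
rewrite (_ : \int[lambda]_x (1 - expR (- f x))%:E =
    \int[lambda]_x limn (fun n => (1 - expR (- g n x))%:E)).
  apply: cvg_monotone_convergence => //.
  - by move=> n; exact: mh.
  - by move=> n x _; rewrite lee_fin; case/andP : (h01 (g n) x (fun_ge0 x)).
  - by move=> x _ n k nk; rewrite lee_fin lerD2l lerN2 ler_expR lerN2 ndg.
apply: eq_integral => x _; apply/esym/cvg_lim => //.
apply: (@cvg_EFinr _ \oo _ R (fun n => 1 - expR (- g n x))%R).
apply: cvgB; first exact: cvg_cst.
have cgx : (- g n x)%R @[n --> \oo] --> (- f x)%R.
  by apply: cvgN; have /fine_cvgP[_] := cg x.
exact: (cvg_comp _ _ cgx (@continuous_expR R _)).
Qed.

End poisson_random_measure.

(** * The evolution and its first moment *)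

Section admissible.
Context {R : realType} {d : nat}.
Implicit Types (phi : 'rV[R]_d -> R).

(** Once p <= 2m and d <= m, these functions are admissible in the log-Laplace formula and
    integrable for every tempered measure and for Lebesgue measure. *)
Definition adm (m : nat) phi := [/\ continuous phi, forall x, 0 <= phi x &
  exists2 C, 0 <= C & forall x, phi x <= C * powinv 1 1 m (sqnorm x)].

Lemma powinv11_le1 m (x : 'rV[R]_d) : powinv 1 1 m (sqnorm x) <= 1.
Proof.
have x0 := sqnorm_ge0 x.
by rewrite exprn_ile1 ?invr_ge0 ?invf_le1 ?mul1r ?addr_ge0 ?lerDl// ltr_pwDl.
Qed.

Lemma adm_bounded m phi : adm m phi -> exists2 C, 0 <= C & forall x, phi x <= C.
Proof.
move=> [_ _ [C C0 phiC]]; exists C => // x.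
by rewrite (le_trans (phiC x))// ler_piMr// powinv11_le1.
Qed.

Lemma adm_measurable m phi : adm m phi -> measurable_fun setT phi.
Proof. by move=> [cphi _ _]; exact: continuous_measurable_rV. Qed.

Lemma admZ m phi (c : R) : 0 <= c -> adm m phi -> adm m (fun x => c * phi x).
Proof.
move=> c0 [cphi phi0 [C C0 phiC]]; split.
- by move=> x; exact: (cvgM (cvg_cst c) (cphi x)).
- by move=> x; rewrite mulr_ge0.
- by exists (c * C); [rewrite mulr_ge0|move=> x; rewrite -mulrA ler_wpM2l].
Qed.

Lemma sqnormZ (c : R) (x : 'rV[R]_d) : sqnorm (c *: x) = c ^+ 2 * sqnorm x.
Proof. by rewrite /sqnorm mulr_sumr; apply: eq_bigr => i _; rewrite mxE exprMn. Qed.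

Lemma sqnormD_le (x y : 'rV[R]_d) : sqnorm x <= 2 * sqnorm (x + y) + 2 * sqnorm y.
Proof.
rewrite /sqnorm !mulr_sumr -big_split/=; apply: ler_sum => i _; rewrite mxE.
by have := sqr_ge0 (x ord0 i + 2 * y ord0 i); nra.
Qed.

Lemma adm_affine m phi (c : R) (y : 'rV[R]_d) : 0 < c -> adm m phi ->
  adm m (fun x => phi (c *: x + y)).
Proof.
move=> c0 [cphi phi0 [C C0 phiC]]; split => //.
  move=> x; apply: (@continuous_comp _ _ _ (fun x : 'rV[R]_d => c *: x + y) phi).
    exact: continuous_affine.
  exact: cphi.
(* |x|^2 <= K (|cx + y|^2 + |y|^2), hence 1 + |x|^2 <= D (1 + |cx + y|^2). *)
pose K := 2 / c ^+ 2.
have y0 := sqnorm_ge0 y.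
have c20 : 0 < c ^+ 2 by rewrite exprn_gt0.
have K0 : 0 < K by rewrite divr_gt0.
pose D := 1 + K + K * sqnorm y.
have Ky0 : 0 <= K * sqnorm y by rewrite mulr_ge0// ltW.
have D0 : 0 < D by rewrite /D; lra.
exists (C * D ^+ m); first by rewrite mulr_ge0// exprn_ge0// ltW.
move=> x; rewrite (le_trans (phiC _))// -mulrA ler_wpM2l//.
rewrite /powinv -exprMn; set s := sqnorm (_ + _).
have s0 : 0 <= s := sqnorm_ge0 _; have x0 := sqnorm_ge0 x.
have x10 : 0 < 1 + sqnorm x by lra.
have s10 : 0 < 1 + s by lra.
rewrite !mul1r; apply: lerXn2r; rewrite ?nnegrE.
- by rewrite invr_ge0 ltW.
- by apply: mulr_ge0; rewrite ?invr_ge0 ltW.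
rewrite -[leLHS]div1r ler_pdivrMr// mulrAC ler_pdivlMr// mul1r.
have xs : sqnorm x <= K * (s + sqnorm y).
  have := sqnormD_le (c *: x) y; rewrite -/s sqnormZ => h.
  by rewrite /K mulrAC ler_pdivlMr// mulrC; lra.
rewrite mulrDr in xs.
have : 0 <= K * s by rewrite mulr_ge0// ltW.
have : 0 <= K * sqnorm y * s by rewrite mulr_ge0.
rewrite /D; lra.
Qed.

Lemma adm_cutoff m (r : R) : adm m (@cutoff R d r).
Proof.
split; [exact: continuous_cutoff|exact: cutoff_ge0|].
exists (r ^+ 2 * (1 + r ^+ 2) ^+ m).
  by rewrite mulr_ge0 ?sqr_ge0// exprn_ge0// addr_ge0// sqr_ge0.
move=> x; have x0 := sqnorm_ge0 x; have r20 := sqr_ge0 r.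
have P := powinv11_gt0 m x.
rewrite /cutoff ge_max; apply/andP; split.
  by rewrite mulr_ge0 ?(ltW P)// mulr_ge0// exprn_ge0// addr_ge0.
have [h|h] := leP (r ^+ 2) (sqnorm x).
  apply: (@le_trans _ _ 0); first by rewrite subr_le0.
  by rewrite mulr_ge0 ?(ltW P)// mulr_ge0// exprn_ge0// addr_ge0.
apply: (@le_trans _ _ (r ^+ 2)); first lra.
rewrite -mulrA ler_peMr// /powinv mul1r -exprMn.
by rewrite exprn_ege1// ler_pdivlMr ?mul1r; lra.
Qed.

Lemma adm_powinv m (L : R) : 0 < L -> 1 <= L ->
  adm m (powinv 1 L^-1 m \o @sqnorm R d).
Proof.
move=> L0 L1; have iL0 : 0 < L^-1 by rewrite invr_gt0.
have pos (x : 'rV[R]_d) : 0 < 1 + L^-1 * sqnorm x.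
  by rewrite ltr_pwDl// mulr_ge0 ?sqnorm_ge0// ltW.
split.
- by move=> x; apply: continuous_powinv_sqnorm; rewrite gt_eqF.
- by move=> x; rewrite /= exprn_ge0// invr_ge0 ltW.
exists (L ^+ m); first by rewrite exprn_ge0// ltW.
move=> x; have x0 := sqnorm_ge0 x; rewrite /powinv/= -exprMn; apply: lerXn2r; rewrite ?nnegrE.
- by rewrite invr_ge0 ltW.
- by rewrite mulr_ge0 ?(ltW L0)// invr_ge0 mul1r addr_ge0.
rewrite -[leLHS]div1r ler_pdivrMr// mulrAC ler_pdivlMr ?mul1r; last lra.
by rewrite mulrDr mulr1 mulrA divff ?gt_eqF// mul1r lerD2r.
Qed.

Lemma adm_wsol m phi u t : adm m phi -> wsol phi u -> 0 <= t -> adm m (u t).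
Proof.
move=> [cphi phi0 [C C0 phiC]] su t0; have [u0 cu _ _] := su; split.
- move=> x; move/subspace_continuousP : cu => /(_ (t, x) t0) cu.
  have h : (t, y) @[y --> x] --> within [set q : R * 'rV[R]_d | 0 <= q.1] (nbhs (t, x)).
    move=> A; rewrite /within/= => -[[B1 B2]/= [tB1 xB2] BA].
    apply: filterS xB2 => y yB2.
    by apply: (BA (t, y)) => //; split => //=; exact: nbhs_singleton.
  exact: (cvg_comp _ _ h cu).
- by move=> x; exact: u0.
- exists (C * expR ((2 * m%:R * m.+1%:R) * t)); first by rewrite mulr_ge0 ?expR_ge0.
  by move=> x; exact: (wsol_le_powinv su).
Qed.

Lemma adm_has_ubound (p : R) m phi : p <= 2 * m%:R -> adm m phi ->
  has_ubound (range (fun x => phi x / phi_p p x)).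
Proof.
move=> pm [_ phi0 [C C0 phiC]]; exists C => _ [x _ <-].
have x0 := sqnorm_ge0 x.
rewrite /phi_p /enorm sqr_sqrtr -/(sqnorm x)//.
have x10 : 0 < 1 + sqnorm x by lra.
rewrite mulNr powRN invrK.
apply: (@le_trans _ _ (C * powinv 1 1 m (sqnorm x) * (1 + sqnorm x) `^ (p / 2))).
  by rewrite ler_wpM2r// powR_ge0.
apply: (@le_trans _ _ (C * powinv 1 1 m (sqnorm x) * (1 + sqnorm x) ^+ m)).
  rewrite ler_wpM2l//; first by rewrite mulr_ge0// ltW// powinv11_gt0.
  rewrite -powR_mulrn ?(ltW x10)//; apply: ler_powR; [lra|].
  by rewrite ler_pdivrMr//; lra.
by rewrite /powinv mul1r -mulrA -exprMn mulVf ?gt_eqF// expr1n mulr1.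
Qed.

Lemma adm_integral_lty (p : R) m phi (mu : @tempered R d p) :
  p <= 2 * m%:R -> adm m phi -> (\int[mu]_x (phi x)%:E < +oo)%E.
Proof.
move=> pm aphi; have [cphi phi0 _] := aphi.
have [C phiC] := adm_has_ubound pm aphi.
have pp0 (x : 'rV[R]_d) : 0 < phi_p p x.
  by rewrite /phi_p powR_gt0// ltr_pwDl// sqr_ge0.
have C0 : 0 <= C.
  rewrite (le_trans _ (phiC _ (imageT _ 0)))// divr_ge0// ltW//.
apply: (@le_lt_trans _ _ (\int[mu]_x (C%:E * (phi_p p x)%:E))%E).
  apply: ge0_le_integral => //.
  - by move=> x _; rewrite lee_fin.
  - by apply/measurable_EFinP; exact: (adm_measurable aphi).
  - apply: measurable_funeM; apply/measurable_EFinP; exact: measurable_phi_p.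
  - move=> x _; rewrite -EFinM lee_fin -ler_pdivrMr//.
    exact: (phiC _ (imageT _ x)).
rewrite ge0_integralZl//.
- by rewrite lte_mul_pinfty ?lee_fin// tempered_integral.
- by apply/measurable_EFinP; exact: measurable_phi_p.
- by move=> x _; rewrite lee_fin ltW.
Qed.

Lemma adm_lebesgue_lty m phi : (d <= m)%N -> adm m phi ->
  (\int[lebesgue_rV d]_x (phi x)%:E < +oo)%E.
Proof.
move=> dm aphi; have [cphi phi0 [C C0 phiC]] := aphi.
have mpow : measurable_fun setT (fun x : 'rV[R]_d => (powinv 1 1 m (sqnorm x))%:E).
  apply/measurable_EFinP; apply: (adm_measurable (m := m)).
  by have := @adm_powinv m 1 ltr01 (lexx 1); rewrite invr1.
apply: (@le_lt_trans _ _ (\int[lebesgue_rV d]_x (C%:E * (powinv 1 1 m (sqnorm x))%:E))%E).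
  apply: ge0_le_integral => //.
  - by move=> x _; rewrite lee_fin.
  - by apply/measurable_EFinP; exact: (adm_measurable aphi).
  - exact: measurable_funeM.
  - by move=> x _; rewrite -EFinM lee_fin.
rewrite ge0_integralZl//.
- by rewrite lte_mul_pinfty ?lee_fin// powinv11_integrable.
- by move=> x _; rewrite lee_fin ltW// powinv11_gt0.
Qed.

End admissible.

(** * The evolution operator and its invariances *)

Section evolution.
Context {R : realType} {d : nat} {p : R} {d' : measure_display}
  {Omega : measurableType d'}.
Variables (X : R -> Omega -> @tempered R d p)
  (P : R.-pker (@tempered R d p) ~> Omega) (m : nat).
Hypothesis sbm : is_super_brownian_motion X P.
Hypothesis pm : p <= 2 * m%:R.
Implicit Types (phi : 'rV[R]_d -> R) (t s : R) (x : 'rV[R]_d).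

(* Junk unless [phi] has a solution, e.g. by [evolP] for admissible [phi]. *)
Definition evol phi : R -> 'rV[R]_d -> R :=
  xget (fun _ _ => 0) [set u | wsol phi u].

Lemma evolP phi : adm m phi -> wsol phi (evol phi) /\
  forall (mu : @tempered R d p) t, 0 <= t ->
  (\int[P mu]_w expeR (- \int[X t w]_x (phi x)%:E) =
   expeR (- \int[mu]_x (evol phi t x)%:E))%E.
Proof.
move=> aphi; have [cphi phi0 _] := aphi; have [_ lap] := sbm.
have [u [[su _] lu]] := lap phi phi0 cphi (adm_has_ubound pm aphi).
have wu : wsol phi u := is_solution_wsol su.
have we : wsol phi (evol phi) by rewrite /evol; case: xgetP => [v _ //|/(_ u)].
split => // mu t t0; rewrite lu//; congr (expeR (- _)); apply: eq_integral => x _.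
by congr (_ %:E); exact: (wsol_unique wu we).
Qed.

Lemma evol_wsol phi : adm m phi -> wsol phi (evol phi).
Proof. by move=> /evolP[]. Qed.

Lemma evol_laplace phi (mu : @tempered R d p) t : adm m phi -> 0 <= t ->
  (\int[P mu]_w expeR (- \int[X t w]_x (phi x)%:E) =
   expeR (- \int[mu]_x (evol phi t x)%:E))%E.
Proof. by move=> /evolP[_ +] t0; apply. Qed.

Lemma evol_unique phi u t x : adm m phi -> wsol phi u -> 0 <= t ->
  evol phi t x = u t x.
Proof. by move=> /evol_wsol we wu; exact: wsol_unique we wu _ _. Qed.

Lemma adm_evol phi t : adm m phi -> 0 <= t -> adm m (evol phi t).
Proof. by move=> aphi; apply: adm_wsol (evol_wsol aphi). Qed.

Lemma evol_ge0 phi t x : adm m phi -> 0 <= t -> 0 <= evol phi t x.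
Proof. by move=> aphi t0; have [_ ? _] := adm_evol aphi t0. Qed.

Lemma evol_affine phi (c s t : R) (x y : 'rV[R]_d) : adm m phi ->
  0 < c -> 0 <= s -> 0 <= t ->
  evol (fun x => c ^+ 2 * evol phi s (c *: x + y)) t x =
  c ^+ 2 * evol phi (s + c ^+ 2 * t) (c *: x + y).
Proof.
move=> aphi c0 s0 t0.
rewrite (evol_unique _ _ (wsol_affine y s0 c0 (evol_wsol aphi)))//.
by apply: admZ; [rewrite sqr_ge0|apply: (@adm_affine _ _ _ (evol phi s)) => //; exact: adm_evol].
Qed.

Lemma evol_affine0 phi (c t : R) (x y : 'rV[R]_d) : adm m phi ->
  0 < c -> 0 <= t ->
  evol (fun x => c ^+ 2 * phi (c *: x + y)) t x =
  c ^+ 2 * evol phi (c ^+ 2 * t) (c *: x + y).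
Proof.
move=> aphi c0 t0; rewrite -[in RHS](add0r (c ^+ 2 * t)) -evol_affine//.
congr evol; apply/funext => z; congr (_ * _).
by have [_ _ _ ->] := evol_wsol aphi.
Qed.

(** The semigroup property, read off from uniqueness: a solution restarted at time s solves the
    equation. *)
Lemma evol_shift phi s t x : adm m phi -> 0 <= s -> 0 <= t ->
  evol (evol phi s) t x = evol phi (s + t) x.
Proof.
move=> aphi s0 t0; have := evol_affine x 0 aphi ltr01 s0 t0.
rewrite expr1n !mul1r scale1r addr0 => <-; congr evol.
by apply/funext => z; rewrite mul1r scale1r addr0.
Qed.

(** Moves the starting point to the origin, so that one law, started from the Dirac mass at 0,
    describes the solution at every [x]. *)
Lemma evol_translate phi t x : adm m phi -> 0 <= t ->
  evol (fun z => phi (z + x)) t 0 = evol phi t x.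
Proof.
move=> aphi t0; have := evol_affine0 0 x aphi ltr01 t0.
rewrite expr1n !mul1r scale1r add0r => <-; congr evol.
by apply/funext => z; rewrite mul1r scale1r.
Qed.

Lemma evol_le phi psi t x : adm m phi -> adm m psi ->
  (forall x, phi x <= psi x) -> 0 <= t -> evol phi t x <= evol psi t x.
Proof.
move=> aphi apsi le t0; exact: (wsol_le (evol_wsol aphi) (evol_wsol apsi)).
Qed.

End evolution.

(** * Monotone limits and linearization of the exponential *)

Section monotone_limits.
Context {R : realType}.

Lemma cvg_nondecreasing_integral d (T : measurableType d)
    (mu : {measure set T -> \bar R}) (g : nat -> T -> \bar R) (f : T -> \bar R) :
  (forall n, measurable_fun setT (g n)) -> (forall n x, 0 <= g n x)%E ->
  (forall x, nondecreasing_seq (fun n => g n x)) ->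
  (forall x, g n x @[n --> \oo] --> f x) ->
  (\int[mu]_x g n x @[n --> \oo] --> \int[mu]_x f x)%E.
Proof.
move=> mg g0 ndg gf.
have -> : (\int[mu]_x f x = \int[mu]_x limn (g^~ x))%E.
  by apply: eq_integral => x _; apply/esym/cvg_lim.
apply: cvg_monotone_convergence => //.
Qed.

Lemma nondecreasing_le_cvge (a : nat -> \bar R) (l : \bar R) n :
  nondecreasing_seq a -> a k @[k --> \oo] --> l -> (a n <= l)%E.
Proof.
move=> nda al; apply: (cvge_to_ge al); near=> k; apply: nda; near: k.
exact: nbhs_infty_ge.
Unshelve. all: by end_near. Qed.

(** The case [l = +oo] is included: it is the one met when the measure charges the ball. *)
Lemma cvg_expeRN (a : nat -> \bar R) (l : \bar R) : (forall n, 0 <= a n)%E ->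
  nondecreasing_seq a -> a n @[n --> \oo] --> l ->
  expeR (- a n)%E @[n --> \oo] --> expeR (- l)%E.
Proof.
move=> a0 nda al.
have al_le n : (a n <= l)%E by exact: nondecreasing_le_cvge.
case: l al al_le => [l||] al al_le; last by have := le_trans (a0 0%N) (al_le 0%N).
  have fa n : a n \is a fin_num by rewrite ge0_fin_numE// (le_lt_trans (al_le n))// ltry.
  have -> : (fun n => expeR (- a n)%E) = (fun n => (expR (- fine (a n)))%:E).
    by apply/funext => n; rewrite -{1}(fineK (fa n)).
  apply: (@cvg_EFinr _ _ _ _ (fun n => expR (- fine (a n))) (expR (- l))).
  have c : {for l, continuous (fun x : R => expR (- x))}.
    by apply: continuous_comp; [exact: opp_continuous|exact: continuous_expR].
  exact: (cvg_comp _ _ (fine_cvg al) c).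
have fa n : expeR (- a n)%E \is a fin_num.
  rewrite ge0_fin_numE ?expeR_ge0// (@le_lt_trans _ _ 1%E) ?ltry// -expeR0 lee_expeR.
  by rewrite oppe_le0.
have -> : (fun n => expeR (- a n)%E) = (fun n => (fine (expeR (- a n)%E))%:E).
  by apply/funext => n; rewrite fineK.
apply: cvg_EFinr.
apply/cvgr0Pnorm_le => e e0; move/cvgeyPge : al => /(_ (- ln e)) al.
near=> n; rewrite /= ger0_norm ?fine_ge0 ?expeR_ge0// -lee_fin fineK//.
rewrite -[e in leRHS]lnK ?posrE//.
have -> : (expR (ln e))%:E = expeR (ln e)%:E by [].
rewrite lee_expeR leeNl -EFinN; near: n; exact: al.
Unshelve. all: by end_near. Qed.

(** This is n (1 - e^(-y/n)) with n = 2^k, which tends to y. Along powers of two monotonicity is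
    algebraic: with z = e^(-y/(2n)) the increment is n (1 - z)^2. *)
Definition explin (k : nat) (y : R) : R := 2 ^+ k * (1 - expR (- (2 ^- k * y))).

Lemma explin_ge0 k y : 0 <= y -> 0 <= explin k y.
Proof.
move=> y0; apply: mulr_ge0; first by rewrite exprn_ge0.
by rewrite subr_ge0 -expR0 ler_expR oppr_le0 mulr_ge0// invr_ge0 exprn_ge0.
Qed.

Lemma explin_nondecreasing y : 0 <= y -> nondecreasing_seq (explin ^~ y).
Proof.
move=> y0; apply/nondecreasing_seqP => k; rewrite /explin.
have k0 : (0 : R) < 2 ^+ k by rewrite exprn_gt0.
set z := expR (- (2 ^- k.+1 * y)).
have -> : expR (- (2 ^- k * y)) = z ^+ 2.
  rewrite /z -expRM_natr; congr expR; rewrite exprS invfM mulNr; congr (- _).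
  by field; rewrite gt_eqF.
have z0 : 0 < z := expR_gt0 _.
have z1 : z <= 1.
  by rewrite /z -expR0 ler_expR oppr_le0 mulr_ge0// invr_ge0 exprn_ge0.
rewrite -subr_ge0.
have -> : 2 ^+ k.+1 * (1 - z) - 2 ^+ k * (1 - z ^+ 2) = 2 ^+ k * (1 - z) ^+ 2.
  by rewrite [2 ^+ k.+1]exprS; ring.
by rewrite mulr_ge0 ?sqr_ge0// ltW.
Qed.

Lemma explin_le k y : explin k y <= y.
Proof.
have k0 : (0 : R) < 2 ^+ k by rewrite exprn_gt0.
rewrite /explin -[leRHS](mulVKf (lt0r_neq0 k0)) ler_pM2l//.
by have := expR_ge1Dx (- (2 ^- k * y)); lra.
Qed.

Lemma explin_ge k y : 0 <= y -> y * (1 - 2 ^- k * y) <= explin k y.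
Proof.
move=> y0; have k0 : (0 : R) < 2 ^+ k by rewrite exprn_gt0.
set a := 2 ^- k * y.
have a0 : 0 <= a by rewrite mulr_ge0// invr_ge0 ltW.
have -> : y * (1 - a) = 2 ^+ k * (a * (1 - a)).
  by rewrite /a mulrA mulrA divff ?gt_eqF// mul1r.
rewrite ler_pM2l// expRN lerBrDr -lerBrDl.
(* e^(-a) <= 1/(1 + a) <= 1 - a + a^2. *)
apply: (@le_trans _ _ (1 + a)^-1).
  by rewrite lef_pV2 ?posrE ?expR_gt0 ?expR_ge1Dx//; lra.
rewrite -[leLHS]div1r ler_pdivrMr; last lra.
have : 0 <= a ^+ 3 by rewrite exprn_ge0.
by nra.
Qed.

Lemma cvg_pow2V : (2 ^- k : R) @[k --> \oo] --> 0.
Proof.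
rewrite (_ : (fun k => _) = (fun k => 2^-1 ^+ k)); last first.
  by apply/funext => k; rewrite exprVn.
by apply: cvg_expr; rewrite ger0_norm ?invf_lt1// ltr1n.
Qed.

Lemma cvg_explin y : 0 <= y -> explin k y @[k --> \oo] --> y.
Proof.
move=> y0; apply: (@squeeze_cvgr _ _ _ _ (fun k => y * (1 - 2 ^- k * y)) (cst y)).
- by near=> k; rewrite explin_ge// explin_le.
- rewrite -[X in _ --> X]mulr1 -[X in _ * X]subr0 -[X in _ - X](mul0r y).
  apply: cvgM; first exact: cvg_cst.
  apply: cvgB; first exact: cvg_cst.
  by apply: cvgM; [exact: cvg_pow2V|exact: cvg_cst].
- exact: cvg_cst.
Unshelve. all: by end_near. Qed.

End monotone_limits.

(** * First moment of the process *)

Section first_moment.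
Context {R : realType} {d : nat} {p : R} {d' : measure_display}
  {Omega : measurableType d'}.
Variables (X : R -> Omega -> @tempered R d p)
  (P : R.-pker (@tempered R d p) ~> Omega) (m : nat).
Hypothesis sbm : is_super_brownian_motion X P.
Hypothesis pm : p <= 2 * m%:R.
Implicit Types (phi : 'rV[R]_d -> R) (t s : R) (x : 'rV[R]_d).

Lemma measurable_ev_process t (A : set 'rV[R]_d) : 0 <= t -> measurable A ->
  measurable_fun setT (fun w => X t w A).
Proof.
move=> t0 mA; have [[mX _ _] _] := sbm.
exact: (measurableT_comp (measurable_ev mA) (mX t t0)).
Qed.

(** The n u_n of the linearization, with n = 2^k and u_n the evolution of phi / n. *)
Definition rescaled_evol phi (k : nat) t x :=
  2 ^+ k * evol (fun z => 2 ^- k * phi z) t x.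

(** [Q] is the mean measure of X_t from the Dirac mass at 0, chosen before [phi] and [x]. The
    Laplace formula for phi / n identifies the mean of [explin k] of the pairing with [explin k] of
    [rescaled_evol]; monotone convergence then gives both claims. *)
Lemma first_moment t : 0 <= t -> exists Q : {measure set 'rV[R]_d -> \bar R},
  forall phi x, adm m phi ->
  (forall k, (explin k (rescaled_evol phi k t x))%:E <= \int[Q]_z (phi (z + x))%:E)%E /\
  (explin k (rescaled_evol phi k t x))%:E @[k --> \oo] --> (\int[Q]_z (phi (z + x))%:E)%E.
Proof.
move=> t0.
have [Q QE] := @exists_mean_measure _ _ _ _ _ (fun w => tempered_measure (X t w))
  (fun A mA => measurable_ev_process t0 mA) (P (tempered_dirac p 0)).
exists Q => phi x aphi.
pose psi z := phi (z + x).
have apsi : adm m psi.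
  have := adm_affine x ltr01 aphi; congr adm; apply/funext => z.
  by rewrite scale1r.
have [_ psi0 _] := apsi.
pose y w := fine (\int[X t w]_z (psi z)%:E)%E.
have yE w : (\int[X t w]_z (psi z)%:E)%E = (y w)%:E.
  rewrite /y fineK// ge0_fin_numE ?(adm_integral_lty _ pm apsi)//.
  by apply: integral_ge0 => z _; rewrite lee_fin.
have y0 w : 0 <= y w.
  by rewrite -lee_fin -yE; apply: integral_ge0 => z _; rewrite lee_fin.
have mpsi : measurable_fun setT (fun z => (psi z)%:E).
  by apply/measurable_EFinP; exact: adm_measurable apsi.
have my : measurable_fun setT y.
  apply/measurable_EFinP.
  have := @measurable_integral_ev _ _ _ _ _ (fun w => tempered_measure (X t w))
    (fun A mA => measurable_ev_process t0 mA) _ mpsi.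
  rewrite (_ : (fun _ => _) = EFin \o y); last by apply/funext => w; rewrite yE.
  by apply => z; rewrite lee_fin.
have -> : (\int[Q]_z (phi (z + x))%:E = \int[P (tempered_dirac p 0)]_w (y w)%:E)%E.
  rewrite (QE (fun z => (psi z)%:E))//.
  by apply: eq_integral => w _; rewrite yE.
pose e k w := expR (- (2 ^- k * y w)).
have p2 k : (0 : R) < 2 ^+ k by rewrite exprn_gt0.
have p2V k : (0 : R) <= 2 ^- k by rewrite invr_ge0 ltW.
have e1 k w : e k w <= 1.
  by rewrite /e -expR0 ler_expR oppr_le0 mulr_ge0.
have me k : measurable_fun setT (e k).
  by apply: measurableT_comp => //; apply: measurableT_comp => //; exact: measurable_funM.
have Ee k : (\int[P (tempered_dirac p 0)]_w (e k w)%:E =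
    (expR (- evol (fun z => 2 ^- k * phi z)%R t x))%:E)%E.
  transitivity (\int[P (tempered_dirac p 0)]_w
      expeR (- \int[X t w]_z (2 ^- k * psi z)%:E))%E.
    apply: eq_integral => w _; under eq_integral do rewrite EFinM.
    by rewrite ge0_integralZl// ?yE// => z _; rewrite lee_fin.
  have a2 := admZ (p2V k) aphi.
  rewrite (evol_laplace sbm pm _ (admZ (p2V k) apsi) t0)/=.
  rewrite (_ : evol _ t = fun z => evol (fun z => 2 ^- k * psi z) t z)//.
  rewrite integral_dirac//; last first.
    by apply/measurable_EFinP; exact: adm_measurable (adm_evol sbm pm (admZ (p2V k) apsi) t0).
  rewrite diracT mul1e /= -(evol_translate sbm pm _ a2 t0)//.
have Eg k : (\int[P (tempered_dirac p 0)]_w (explin k (y w))%:E =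
    (explin k (rescaled_evol phi k t x))%:E)%E.
  have m1e : measurable_fun setT (fun w => (1 - e k w)%:E).
    by apply/measurable_EFinP; apply: measurable_funB.
  have E1 : (\int[P (tempered_dirac p 0)]_w (1 - e k w)%:E +
      (expR (- evol (fun z => 2 ^- k * phi z)%R t x))%:E = 1)%E.
    rewrite -Ee -ge0_integralD//; last 3 first.
    - by move=> w _; rewrite lee_fin subr_ge0.
    - by move=> w _; rewrite lee_fin expR_ge0.
    - exact/measurable_EFinP.
    transitivity (\int[P (tempered_dirac p 0)]_w cst 1 w)%E.
      by apply: eq_integral => w _; rewrite -EFinD subrK.
    by rewrite integral_cst// mul1e prob_kernel.
  rewrite /explin; under eq_integral do rewrite EFinM.
  rewrite (ge0_integralZl _ measurableT m1e) ?lee_fin ?(ltW (p2 k))//; last first.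
    by move=> w _; rewrite lee_fin subr_ge0; exact: e1.
  rewrite EFinM /rescaled_evol (mulKf (lt0r_neq0 (p2 k))) EFinB; congr (_ * _)%E.
  rewrite -E1 addeK//.
have ndg w : nondecreasing_seq (fun k => (explin k (y w))%:E).
  by move=> a b ab; rewrite lee_fin; exact: explin_nondecreasing.
have mg k : measurable_fun setT (fun w => (explin k (y w))%:E).
  by apply/measurable_EFinP; apply: measurable_funM => //; apply: measurable_funB => //; exact: me.
have L : (explin k (rescaled_evol phi k t x))%:E @[k --> \oo] -->
    (\int[P (tempered_dirac p 0)]_w (y w)%:E)%E.
  under eq_fun do rewrite -Eg.
  apply: cvg_nondecreasing_integral => //.
  - by move=> k w; rewrite lee_fin explin_ge0.
  - by move=> w; apply: cvg_EFinr; exact: cvg_explin.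
split => // k; apply: (nondecreasing_le_cvge k _ L) => a b ab.
rewrite -!Eg; apply: ge0_le_integral => //.
- by move=> w _; rewrite lee_fin explin_ge0.
- by move=> w _; exact: ndg.
Qed.

End first_moment.

Section convolution.
Context {R : realType} {d : nat}.
Local Open Scope ereal_scope.

(** Tonelli's theorem and translation invariance of Lebesgue measure. *)
Lemma integral_convolution (Q : {measure set 'rV[R]_d -> \bar R}) (f : 'rV[R]_d -> R) :
  Q setT < +oo -> measurable_fun setT f -> (forall x, 0 <= f x)%R ->
  measurable_fun setT (fun x => \int[Q]_z (f (z + x)%R)%:E) /\
  \int[lebesgue_rV d]_x \int[Q]_z (f (z + x)%R)%:E =
  Q setT * \int[lebesgue_rV d]_x (f x)%:E.
Proof.
move=> Qoo mf f0.
have finQ : fin_num_fun Q.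
  move=> A mA; rewrite ge0_fin_numE//; apply: le_lt_trans Qoo.
  by apply: le_measure; rewrite ?inE.
have sfQ : sigma_finite setT Q by apply: fin_num_fun_sigma_finite; rewrite ?measure0.
(* The finite measure [Q] is repackaged with the sigma-finite structure that Tonelli's theorem
   expects. *)
have H1 := @isSFinite.Build _ _ _ Q (sfinite_measure_sigma_finite sfQ).
have H2 := @isSigmaFinite.Build _ _ _ Q sfQ.
pose Qf := HB.pack_for {sigma_finite_measure set 'rV[R]_d -> \bar R} (Measure.sort Q) H1 H2.
have mE : measurable_fun setT (EFin \o f) by exact/measurable_EFinP.
have madd : measurable_fun setT (fun q : 'rV[R]_d * 'rV[R]_d => q.2 + q.1)%R.
  apply: measurable_fun_rV => i.
  rewrite (_ : (fun _ => _) = (fun q : 'rV[R]_d * 'rV[R]_d =>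
    q.2 ord0 i + q.1 ord0 i)%R); last by apply/funext => q; rewrite mxE.
  apply: measurable_funD.
    by apply: (measurableT_comp (@measurable_coord R 1 d ord0 i)); exact: measurable_snd.
  by apply: (measurableT_comp (@measurable_coord R 1 d ord0 i)); exact: measurable_fst.
pose F (q : 'rV[R]_d * 'rV[R]_d) := (f (q.2 + q.1)%R)%:E.
have mF : measurable_fun setT F by exact: (measurableT_comp mE madd).
have F0 q : 0 <= F q by rewrite lee_fin.
split; first exact: (measurable_fun_fubini_tonelli_F (m2 := Qf) F mF F0).
have := @fubini_tonelli _ _ _ _ _ (lebesgue_rV d) Qf F mF F0.
rewrite /= => ->.
have := integral_cst Q measurableT (\int[lebesgue_rV d]_x (f x)%:E).
rewrite muleC => <-; apply: eq_integral => z _.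
have := @lebesgue_affine R d 1%R z (EFin \o f) ltr01 mE.
rewrite expr1n invr1 mul1e => <-; last by move=> x; rewrite lee_fin.
by apply: eq_integral => x _; rewrite /= scale1r addrC.
Qed.

End convolution.

(** * Total mass of solutions *)

Section mass.
Context {R : realType} {d : nat} {p : R} {d' : measure_display}
  {Omega : measurableType d'}.
Variables (X : R -> Omega -> @tempered R d p)
  (P : R.-pker (@tempered R d p) ~> Omega) (m : nat).
Hypothesis sbm : is_super_brownian_motion X P.
Hypothesis pm : p <= 2 * m%:R.
Hypothesis d3 : (3 <= d)%N.
Hypothesis dm : (d <= m)%N.
Implicit Types (phi : 'rV[R]_d -> R) (t s : R) (x : 'rV[R]_d).

Let pow2_gt0 k : (0 : R) < 2 ^+ k. Proof. by rewrite exprn_gt0. Qed.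

Let wsol_rescaled phi k : adm m phi ->
  wsol (fun x => 2 ^- k * phi x) (evol (fun z => 2 ^- k * phi z)).
Proof.
move=> aphi; apply: (evol_wsol sbm pm).
by apply: admZ => //; rewrite invr_ge0 ltW.
Qed.

Lemma rescaled_evol_ge0 phi k t x : adm m phi -> 0 <= t ->
  0 <= rescaled_evol phi k t x.
Proof.
move=> aphi t0; rewrite /rescaled_evol mulr_ge0 ?(ltW (pow2_gt0 k))//.
by have [h _ _ _] := wsol_rescaled k aphi; exact: h.
Qed.

Lemma rescaled_evol_le phi k t x C : adm m phi -> 0 <= t ->
  (forall x, phi x <= C) -> rescaled_evol phi k t x <= C.
Proof.
move=> aphi t0 phiC; have [_ phi0 _] := aphi.
have C0 : 0 <= C by rewrite (le_trans (phi0 0)).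
rewrite /rescaled_evol -[leRHS](mulVKf (lt0r_neq0 (pow2_gt0 k))) ler_pM2l//.
apply: (wsol_le_cst (wsol_rescaled k aphi)) => //.
  by rewrite mulr_ge0// invr_ge0 ltW.
by move=> z; rewrite ler_wpM2l// invr_ge0 ltW.
Qed.

Lemma evol_le_rescaled phi k t x : adm m phi -> 0 <= t ->
  evol phi t x <= rescaled_evol phi k t x.
Proof.
move=> aphi t0; apply: (wsol_scale_ge _ (evol_wsol sbm pm aphi) (wsol_rescaled k aphi)) => //.
by rewrite exprn_ege1// ler1n.
Qed.

(** The converse of [evol_le_rescaled] up to the factor 3, uniformly in k and t: [wsol_ge_linear]
    with e = 2^-k applies because max(0, 1 - y) <= e^(-y/2) for y >= 0. *)
Lemma rescaled_evol_cutoff_le k t x : 0 <= t ->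
  rescaled_evol (cutoff 1) k t x <= 3 * evol (cutoff 1) t x.
Proof.
move=> t0; have ac := @adm_cutoff R d m 1.
have k0 : 0 < 2 ^- k :> R by rewrite invr_gt0.
have := wsol_ge_linear d3 k0 (evol_wsol sbm pm ac) (wsol_rescaled k ac) _ x t0.
rewrite invfM invrK -mulrA ler_pdivrMl//; apply => y.
rewrite /cutoff ge_max expR_ge0/= expr1n.
have y0 := sqnorm_ge0 y.
by have := expR_ge1Dx (- (2^-1 * sqnorm y)); lra.
Qed.

(** The mass of [Q] is probed with (1 + |x|^2/L)^(-m), which is at most 1 and increases to 1 with L.
    The upper bound comes from the constant supersolution, the lower one from the slowly decaying
    subsolution at the origin; what matters is that neither depends on t. *)
Lemma first_moment_bounds t : 0 <= t -> exists Q : {measure set 'rV[R]_d -> \bar R},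
  [/\ ((expR (- 2) / 2)%:E <= Q setT <= 1)%E,
      forall phi x, adm m phi -> ((evol phi t x)%:E <= \int[Q]_z (phi (z + x))%:E)%E &
      forall x, (\int[Q]_z (cutoff 1 (z + x))%:E <= (3 * evol (cutoff 1) t x)%:E)%E].
Proof.
move=> t0; have [Q HQ] := first_moment sbm pm t0; exists Q.
pose psi (L : R) := powinv 1 L^-1 m \o @sqnorm R d.
have psi1 L x : 1 <= L -> psi L x <= 1.
  move=> L1; have x0 := sqnorm_ge0 x.
  have l0 : 0 <= L^-1 * sqnorm x by rewrite mulr_ge0// invr_ge0; lra.
  by rewrite exprn_ile1 ?invr_ge0 ?invf_le1 ?addr_ge0 ?lerDl// ltr_pwDl.
have apsi L : 1 <= L -> adm m (psi L) by move=> L1; apply: adm_powinv => //; lra.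
have psi0 L x : 1 <= L -> 0 <= psi L x by move=> /apsi[_ + _]; exact.
split.
- apply/andP; split; last first.
    have L : (\int[Q]_z (psi n.+1%:R z)%:E @[n --> \oo] --> \int[Q]_z cst 1 z)%E.
      apply: cvg_nondecreasing_integral.
      - move=> n; apply/measurable_EFinP; apply: (@adm_measurable _ _ m).
        by apply: apsi; rewrite ler1n.
      - by move=> n z; rewrite lee_fin psi0// ler1n.
      - move=> z a b ab; rewrite lee_fin /psi/= /powinv.
        have z0 := sqnorm_ge0 z.
        have h n : 0 < 1 + n.+1%:R^-1 * sqnorm z by rewrite ltr_pwDl// mulr_ge0.
        apply: lerXn2r; rewrite ?nnegrE ?invr_ge0 ?(ltW (h _))//.
        rewrite lef_pV2 ?posrE// lerD2l ler_wpM2r// lef_pV2 ?posrE// ler_nat.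
        exact: ab.
      - move=> z; apply: cvg_EFinr => /=.
        rewrite (_ : (fun n => _) = (fun n => powinv 1 (sqnorm z) m n.+1%:R^-1)); last first.
          by apply/funext => n; rewrite /powinv mulrC.
        have h0 : 1 + sqnorm z * 0 != 0 :> R by rewrite mulr0 addr0 oner_neq0.
        have c := derive_continuous (is_derive_powinv m h0).
        have E : powinv 1 (sqnorm z) m 0 = 1 by rewrite /powinv mulr0 addr0 invr1 expr1n.
        rewrite -[X in _ --> X]E; exact: (cvg_comp _ _ (@cvg_harmonic R) c).
    rewrite integral_cst//= mul1e in L.
    apply: (cvge_to_le L); near=> n.
    have n1 : 1 <= n.+1%:R :> R by rewrite ler1n.
    have [_ H] := HQ _ 0 (apsi _ n1).
    rewrite (_ : (fun _ => _) = fun z => (psi n.+1%:R (z + 0))%:E); last first.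
      by apply/funext => z; rewrite addr0.
    apply: (cvge_to_le H); near=> k; rewrite lee_fin.
    apply: (le_trans (explin_le _ _)); apply: rescaled_evol_le => //.
      exact: apsi.
    by move=> z; exact: psi1.
  (* The decay rate is dm/L + 2^-k. This [L], and a k with 2^-k t <= 1, bound its product with t by
     2, the origin of e^(-2). *)
  pose L : R := d%:R * m%:R * t + 1.
  have dmt : 0 <= d%:R * m%:R * t by rewrite mulr_ge0// mulr_ge0.
  have L1 : 1 <= L by rewrite /L; lra.
  have L0 : 0 < L by rewrite /L; lra.
  have [k [k2 kt]] : exists k : nat, 2 ^- k <= 2^-1 :> R /\ 2 ^- k * t <= 1.
    have c : (2 ^- k : R) * t @[k --> \oo] --> 0 * t.
      by apply: cvgM; [exact: cvg_pow2V|exact: cvg_cst].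
    rewrite mul0r in c.
    have [k _ /(_ _ (leqnn _))[h1 h2]] : \forall k \near \oo,
        2 ^- k <= 2^-1 :> R /\ 2 ^- k * t <= 1.
      near=> k; split; near: k.
        by apply: (cvgr_le _ cvg_pow2V).
      by apply: (cvgr_le _ c).
    by exists k.
  have [H _] := HQ _ 0 (apsi _ L1).
  apply: (@le_trans _ _ (\int[Q]_z (psi L (z + 0))%:E)%E); last first.
    have := integral_cst Q measurableT 1%E; rewrite mul1e => <-.
    apply: ge0_le_integral => //.
    + by move=> z _; rewrite lee_fin psi0.
    + rewrite (_ : (fun _ => _) = fun z => (psi L z)%:E); last first.
        by apply/funext => z; rewrite addr0.
      by apply/measurable_EFinP; exact: adm_measurable (apsi _ L1).
    + by move=> z _; rewrite lee_fin psi1.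
  apply: le_trans (H k); rewrite lee_fin.
  have z1 := @rescaled_evol_le _ k t 0 1 (apsi _ L1) t0 (fun z => psi1 L z L1).
  have z0 : expR (- 2) <= rescaled_evol (psi L) k t 0.
    rewrite /rescaled_evol -ler_pdivrMl//.
    have := subsol_powinv_le_wsol (wsol_rescaled k (apsi _ L1)) _ L0 (fun=> lexx _) 0 t0.
    have -> : powinv 1 L^-1 m (sqnorm (0 : 'rV[R]_d)) = 1.
      rewrite /powinv [sqnorm _]big1 ?mulr0 ?addr0 ?invr1 ?expr1n// => i _.
      by rewrite mxE expr0n.
    rewrite mulr1 => h; apply: le_trans (h _).
      rewrite ler_pM2l ?invr_gt0// ler_expR mulNr lerN2 mulrDl.
      suff : d%:R * m%:R / L * t <= 1 by lra.
      by rewrite mulrAC ler_pdivrMr// mul1r /L; lra.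
    by rewrite invr_ge0 ltW.
  (* As 2^-k y <= 1/2, passing from y to [explin k y] costs at most a factor 2. *)
  apply: le_trans (explin_ge _ _); last by apply: le_trans z0; exact: expR_ge0.
  have k0 : 0 < 2 ^- k :> R by rewrite invr_gt0.
  have : 2 ^- k * rescaled_evol (psi L) k t 0 <= 2^-1.
    by apply: (@le_trans _ _ (2 ^- k)) => //; rewrite ler_piMr// ltW.
  set y := rescaled_evol _ _ _ _ in z0 z1 *.
  have := expR_gt0 (- 2 : R); set e := expR _ in z0 *; set q := _ * y.
  by move=> e0 q2; nra.
- move=> phi x aphi; have [_ H] := HQ phi x aphi.
  have [C C0 phiC] := adm_bounded aphi.
  (* By [explin_ge] and y = [rescaled_evol] <= C, [explin k y] is at least y (1 - 2^-k C), and y is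
     at least [evol]; the correction vanishes in the limit. *)
  have L : (evol phi t x * (1 - 2 ^- k * C))%:E @[k --> \oo] --> (evol phi t x)%:E.
    apply: cvg_EFinr; rewrite -[X in _ --> X]mulr1 -[X in _ * X]subr0 -[X in _ - X](mul0r C).
    apply: cvgM; first exact: cvg_cst.
    apply: cvgB; first exact: cvg_cst.
    by apply: cvgM; [exact: cvg_pow2V|exact: cvg_cst].
  apply: (cvge_to_le L); near=> k; have [Hk _] := HQ phi x aphi.
  apply: le_trans (Hk k); rewrite lee_fin.
  have z0 := rescaled_evol_ge0 k x aphi t0.
  have zC := rescaled_evol_le k x aphi t0 phiC.
  have ez := evol_le_rescaled k x aphi t0.
  have e0 := evol_ge0 sbm pm x aphi t0.
  apply: le_trans (explin_ge k z0).
  have k0 : 0 < 2 ^- k :> R by rewrite invr_gt0.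
  have k1 : 2 ^- k * C <= 1.
    near: k; have c : (2 ^- k : R) * C @[k --> \oo] --> 0 * C.
      by apply: cvgM; [exact: cvg_pow2V|exact: cvg_cst].
    by rewrite mul0r in c; apply: (cvgr_le _ c).
  apply: (@le_trans _ _ (rescaled_evol phi k t x * (1 - 2 ^- k * C))).
    by rewrite ler_wpM2r// subr_ge0.
  by rewrite ler_wpM2l// lerB// ler_pM2l.
- move=> x; have [_ H] := HQ _ x (@adm_cutoff R d m 1).
  apply: (cvge_to_le H); near=> k; rewrite lee_fin.
  exact/(le_trans (explin_le _ _))/rescaled_evol_cutoff_le.
Unshelve. all: by end_near. Qed.

(** The solution restarted at time s is at most the mean of its value at s under [Q], whose mass is
    at most 1; integrate in x. *)
Lemma mass_evol_le phi s t : adm m phi -> 0 <= s -> 0 <= t ->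
  (\int[lebesgue_rV d]_x (evol phi (s + t) x)%:E <=
   \int[lebesgue_rV d]_x (evol phi s x)%:E)%E.
Proof.
move=> aphi s0 t0; have [Q [/andP[_ Q1] Qle _]] := first_moment_bounds t0.
have as_ := adm_evol sbm pm aphi s0; have [_ es0 _] := as_.
have Qoo : (Q setT < +oo)%E by apply: le_lt_trans Q1 _; rewrite ltry.
have := integral_convolution Qoo (adm_measurable as_) es0 => -[mC E].
apply: (@le_trans _ _ (Q setT * \int[lebesgue_rV d]_x (evol phi s x)%:E)%E); last first.
  rewrite -[leRHS]mul1e lee_wpmul2r// integral_ge0// => x _.
  by rewrite lee_fin.
rewrite -E; apply: ge0_le_integral => //.
- by move=> x _; rewrite lee_fin (evol_ge0 sbm pm)// addr_ge0.
- apply/measurable_EFinP; apply: (@adm_measurable _ _ m); apply: (adm_evol sbm pm) => //.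
  exact: addr_ge0.
- by move=> x _; rewrite -(evol_shift sbm pm)//; exact: Qle.
Qed.

(** Integrating the last clause of [first_moment_bounds]: 1/6 is the factor 1/2 in the mass of [Q]
    times the 1/3 of the linear comparison. *)
Lemma mass_evol_cutoff_ge t : 0 <= t ->
  ((expR (- 2) / 6)%:E * \int[lebesgue_rV d]_x (cutoff 1 x)%:E <=
   \int[lebesgue_rV d]_x (evol (cutoff 1) t x)%:E)%E.
Proof.
move=> t0; have [Q [/andP[Qge Q1] _ Qle]] := first_moment_bounds t0.
have ac := @adm_cutoff R d m 1; have [_ c0 _] := ac.
have Qoo : (Q setT < +oo)%E by apply: le_lt_trans Q1 _; rewrite ltry.
have [mC E] := integral_convolution Qoo (adm_measurable ac) c0.
have I0 : (0 <= \int[@lebesgue_rV R d]_x (cutoff 1 x)%:E)%E.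
  by apply: integral_ge0 => x _; rewrite lee_fin.
have me : measurable_fun setT (fun x => (evol (cutoff 1) t x)%:E).
  by apply/measurable_EFinP; exact: (adm_measurable (adm_evol sbm pm ac t0)).
have : ((expR (- 2) / 2)%:E * \int[lebesgue_rV d]_x (cutoff 1 x)%:E <=
    3%:E * \int[lebesgue_rV d]_x (evol (cutoff 1) t x)%:E)%E.
  apply: (@le_trans _ _ (Q setT * \int[lebesgue_rV d]_x (cutoff 1 x)%:E)%E).
    exact: lee_wpmul2r.
  rewrite -E -ge0_integralZl//; last first.
    by move=> x _; rewrite lee_fin (evol_ge0 sbm pm).
  apply: ge0_le_integral => //.
  - by move=> x _; apply: integral_ge0 => z _; rewrite lee_fin.
  - exact: measurable_funeM.
rewrite -(@lee_pmul2l _ 3^-1%:E)// ?lte_fin ?invr_gt0//.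
rewrite !muleA -!EFinM mulVf// mul1e.
by congr (_%:E * _ <= _)%E; field.
Qed.

End mass.

(** * The maximal solution and the void probability *)

Section maximal_solution.
Context {R : realType} {d : nat} {p : R} {d' : measure_display}
  {Omega : measurableType d'}.
Variables (X : R -> Omega -> @tempered R d p)
  (P : R.-pker (@tempered R d p) ~> Omega) (m : nat).
Hypothesis sbm : is_super_brownian_motion X P.
Hypothesis pm : p <= 2 * m%:R.
Hypothesis d3 : (3 <= d)%N.
Hypothesis dm : (d <= m)%N.
Implicit Types (phi : 'rV[R]_d -> R) (t s : R) (x : 'rV[R]_d).

Definition evol_cutoff (k : nat) t x := evol (fun z => k%:R * cutoff 1 z) t x.

(** The function U_1 of the overview; the bound 1/t makes the limit exist for t > 0. *)
Definition evol_infty t x := limn (fun k => evol_cutoff k t x).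

Let adm_kcutoff k : adm m (fun z : 'rV[R]_d => k%:R * cutoff 1 z).
Proof. by apply: admZ => //; exact: adm_cutoff. Qed.

Lemma adm_evol_cutoff k t : 0 <= t -> adm m (@evol_cutoff k t).
Proof. by move=> t0; exact: (adm_evol sbm pm (adm_kcutoff k) t0). Qed.

Lemma evol_cutoff_ge0 k t x : 0 <= t -> 0 <= evol_cutoff k t x.
Proof. by move=> t0; exact: (evol_ge0 sbm pm x (adm_kcutoff k) t0). Qed.

Lemma evol_cutoff_nondecreasing t x : 0 <= t ->
  nondecreasing_seq (fun k => evol_cutoff k t x).
Proof.
move=> t0 a b ab; apply: (evol_le sbm pm) => // z.
by rewrite ler_wpM2r ?cutoff_ge0// ler_nat.
Qed.

Lemma evol_cutoff_le_inv k t x : 0 < t -> evol_cutoff k t x <= t^-1.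
Proof.
move=> t0; have [C C0 phiC] := adm_bounded (adm_kcutoff k).
exact: (wsol_le_inv (evol_wsol sbm pm (adm_kcutoff k)) phiC x t0).
Qed.

Lemma cvg_evol_infty t x : 0 < t ->
  evol_cutoff k t x @[k --> \oo] --> evol_infty t x.
Proof.
move=> t0; apply: nondecreasing_is_cvgn.
  exact/evol_cutoff_nondecreasing/ltW.
by exists t^-1 => _ [k _ <-]; exact: evol_cutoff_le_inv.
Qed.

Lemma evol_cutoff_le_infty k t x : 0 < t -> evol_cutoff k t x <= evol_infty t x.
Proof.
move=> t0; apply: nondecreasing_cvgn_le.
  exact/evol_cutoff_nondecreasing/ltW.
by apply: cvgP; exact: cvg_evol_infty.
Qed.

Lemma evol_infty_ge0 t x : 0 < t -> 0 <= evol_infty t x.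
Proof.
move=> t0; apply: le_trans (evol_cutoff_le_infty 0%N x t0).
exact/evol_cutoff_ge0/ltW.
Qed.

Lemma evol_infty_le t x C : 0 < t -> (forall k, evol_cutoff k t x <= C) ->
  evol_infty t x <= C.
Proof.
move=> t0 H; apply: limr_le; first by apply: cvgP; exact: cvg_evol_infty.
by near=> k; exact: H.
Unshelve. all: by end_near. Qed.

Lemma evol_infty_le_inv t x : 0 < t -> evol_infty t x <= t^-1.
Proof. by move=> t0; apply: evol_infty_le => // k; exact: evol_cutoff_le_inv. Qed.

Lemma measurable_evol_infty t : 0 < t ->
  measurable_fun setT (fun x => evol_infty t x).
Proof.
move=> t0; apply: (measurable_fun_cvg (h := fun k => evol_cutoff k t)).
  by move=> k; apply: adm_measurable; exact: (adm_evol_cutoff k (ltW t0)).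
by move=> x _; exact: cvg_evol_infty.
Qed.

(** At time 1 the bound 1/t controls a neighbourhood of the unit ball and [wsol_exterior] the rest,
    both independently of k; [wsol_le_powinv] carries the bound to later times. *)
Lemma evol_cutoff_uniform t : 1 <= t -> exists2 C, 0 <= C &
  forall k x, evol_cutoff k t x <= C * powinv 1 1 m (sqnorm x).
Proof.
move=> t1.
have m2 : (2 <= m)%N by rewrite (leq_trans _ dm)// ltnW.
pose A : R := 4 * m%:R * m.+1%:R.
have A0 : 0 <= A by rewrite !mulr_ge0.
pose D : R := 4 ^+ m * (1 + A * expR A).
have AA0 : 0 <= A * expR A by rewrite mulr_ge0// expR_ge0.
have D0 : 0 <= D by rewrite mulr_ge0 ?exprn_ge0//; lra.
have D1 k x : evol_cutoff k 1 x <= D * powinv 1 1 m (sqnorm x).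
  have x0 := sqnorm_ge0 x; have px := powinv11_gt0 m x.
  (* Below 3, 1 + |x|^2 <= 4; above it, 1 + |x|^2 <= 4 (|x|^2 - 1). The same factor 4^m serves both
     cases. *)
  have [x3|x3] := leP (sqnorm x) 3.
    apply: (@le_trans _ _ 1); first by rewrite -[leRHS]invr1 evol_cutoff_le_inv.
    have : 1 <= 4 ^+ m * powinv 1 1 m (sqnorm x).
      rewrite /powinv -exprMn mul1r exprn_ege1// ler_pdivlMr; lra.
    rewrite /D mulrAC => h.
    by apply: (le_trans h); rewrite ler_peMr//; lra.
  apply: (@le_trans _ _ (A * expR (A * 1) * powinv (-1) 1 m (sqnorm x))).
    apply: (wsol_exterior (evol_wsol sbm pm (adm_kcutoff k)) m2); last 2 first.
    - by rewrite ler01 lexx.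
    - lra.
    - move=> z z1; rewrite /cutoff (_ : Num.max _ _ = 0) ?mulr0//.
      by apply/max_idPl; rewrite expr1n subr_le0.
  have h : powinv (-1) 1 m (sqnorm x) <= 4 ^+ m * powinv 1 1 m (sqnorm x).
    rewrite /powinv -exprMn mul1r; apply: lerXn2r; rewrite ?nnegrE.
    + by rewrite invr_ge0; lra.
    + by rewrite mulr_ge0// invr_ge0; lra.
    rewrite -[leLHS]div1r ler_pdivrMr; last lra.
    by rewrite mulrAC ler_pdivlMr; lra.
  rewrite mulr1 /D [leRHS]mulrAC; apply: (@le_trans _ _ (A * expR A * (4 ^+ m * powinv 1 1 m (sqnorm x)))).
    by rewrite ler_wpM2l.
  have : 0 <= 4 ^+ m * powinv 1 1 m (sqnorm x) by apply: mulr_ge0; [exact: exprn_ge0|exact: ltW].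
  by set q := _ * powinv _ _ _ _; lra.
exists (D * expR ((2 * m%:R * m.+1%:R) * (t - 1))); first by rewrite mulr_ge0 ?expR_ge0.
move=> k x; have t10 : 0 <= t - 1 by lra.
have -> : evol_cutoff k t x = evol (evol_cutoff k 1) (t - 1) x.
  rewrite (evol_shift sbm pm)//; congr evol; lra.
by apply: wsol_le_powinv => //; exact: (evol_wsol sbm pm (adm_evol_cutoff k ler01)).
Qed.

Definition evol_infty_mass t : \bar R :=
  (\int[lebesgue_rV d]_x (evol_infty t x)%:E)%E.

Lemma cvg_evol_infty_mass t : 0 < t ->
  (\int[lebesgue_rV d]_x (evol_cutoff k t x)%:E)%E @[k --> \oo] --> evol_infty_mass t.
Proof.
move=> t0; apply: cvg_nondecreasing_integral.
- move=> k; apply/measurable_EFinP; apply: adm_measurable.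
  exact: (adm_evol_cutoff k (ltW t0)).
- by move=> k x; rewrite lee_fin evol_cutoff_ge0// ltW.
- move=> x a b ab; rewrite lee_fin.
  exact: (evol_cutoff_nondecreasing x (ltW t0)).
- by move=> x; apply: cvg_EFinr; exact: cvg_evol_infty.
Qed.

Lemma evol_infty_mass_lty t : 1 <= t -> (evol_infty_mass t < +oo)%E.
Proof.
move=> t1; have t0 : 0 < t by lra.
have [C C0 HC] := evol_cutoff_uniform t1.
have aC : adm m (fun x : 'rV[R]_d => C * powinv 1 1 m (sqnorm x)).
  apply: admZ => //; have := @adm_powinv R d m 1 ltr01 (lexx 1).
  by rewrite invr1.
apply: le_lt_trans (adm_lebesgue_lty dm aC); apply: ge0_le_integral => //.
- by move=> x _; rewrite lee_fin evol_infty_ge0.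
- by apply/measurable_EFinP; exact: measurable_evol_infty.
- by apply/measurable_EFinP; exact: adm_measurable aC.
- by move=> x _; rewrite lee_fin; apply: evol_infty_le.
Qed.

Lemma evol_infty_mass_nonincreasing s t : 0 < s -> s <= t ->
  (evol_infty_mass t <= evol_infty_mass s)%E.
Proof.
move=> s0 st; have t0 : 0 < t by lra.
apply: (lee_cvg_to (cvg_evol_infty_mass t0) (cvg_evol_infty_mass s0)).
near=> k; have ts0 : 0 <= t - s by lra.
have := mass_evol_le sbm pm d3 (adm_kcutoff k) (ltW s0) ts0.
by rewrite [s + _]addrC subrK.
Unshelve. all: by end_near. Qed.

Lemma evol_infty_mass_ge t : 0 < t ->
  ((expR (- 2) / 6)%:E * \int[lebesgue_rV d]_x (cutoff 1 x)%:E <= evol_infty_mass t)%E.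
Proof.
move=> t0; apply: le_trans (mass_evol_cutoff_ge sbm pm d3 (ltW t0)) _.
apply: le_trans (nondecreasing_le_cvge 1%N _ (cvg_evol_infty_mass t0)).
  rewrite /evol_cutoff; under [in leRHS]eq_integral do under eq_fun do rewrite mul1r.
  exact: lexx.
move=> a b ab; apply: ge0_le_integral => //.
- by move=> x _; rewrite lee_fin evol_cutoff_ge0// ltW.
- apply/measurable_EFinP; apply: adm_measurable; exact: (adm_evol_cutoff a (ltW t0)).
- apply/measurable_EFinP; apply: adm_measurable; exact: (adm_evol_cutoff b (ltW t0)).
- by move=> x _; rewrite lee_fin; exact: (evol_cutoff_nondecreasing x (ltW t0)).
Qed.

Lemma evol_infty_mass_cvg : exists2 kappa : R, 0 < kappa &
  evol_infty_mass t @[t --> +oo] --> kappa%:E.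
Proof.
(* Freezing time before 1 gives a function that is monotone on the whole line and finite
   everywhere. *)
pose f t := evol_infty_mass (Num.max t 1).
have max0 t : 0 < Num.max t (1 : R) by rewrite lt_max ltr01 orbT.
have max1 t : 1 <= Num.max t (1 : R) by rewrite le_max lexx orbT.
have nf : nonincreasing_fun f.
  by move=> a b ab; apply: evol_infty_mass_nonincreasing => //; rewrite ge_max !le_max ab lexx orbT.
have L := nonincreasing_cvge nf.
have I0 := @integral_cutoff_gt0 R d 1 ltr01.
have Ioo := adm_lebesgue_lty dm (@adm_cutoff R d m 1).
set K := (\int[_]_x _)%E in I0 Ioo.
have KE : K = (fine K)%:E by rewrite fineK// ge0_fin_numE// ltW.
set l := ereal_inf _ in L.
have lge : ((expR (- 2) / 6 * fine K)%:E <= l)%E.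
  apply: le_ereal_inf_tmp => _ [t _ <-].
  by apply: le_trans (evol_infty_mass_ge (max0 t)); rewrite -/K {2}KE.
have lle : (l <= f 1%R)%E by apply: ereal_inf_lbound; exists 1.
have K0 : 0 < fine K by rewrite -lte_fin -KE.
have e0 : 0 < expR (- 2) / 6 * fine K by rewrite mulr_gt0// divr_gt0// expR_gt0.
have lfin : l \is a fin_num.
  rewrite ge0_fin_numE; last by apply: le_trans lge; rewrite lee_fin ltW.
  by apply: le_lt_trans lle _; exact: evol_infty_mass_lty.
exists (fine l); first by rewrite -lte_fin fineK// (lt_le_trans _ lge)// lte_fin.
rewrite fineK//; apply: cvg_trans L; apply: near_eq_cvg.
near=> t; rewrite /f; congr evol_infty_mass; apply/max_idPl; near: t.
exact: nbhs_pinfty_ge.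
Unshelve. all: by end_near. Qed.

End maximal_solution.

(** * Euclidean balls *)

Section balls.
Context {R : realType} {d : nat}.
Implicit Types (r s u : R) (x : 'rV[R]_d).

Lemma eball_sqnorm r x : 0 < r -> eball r x <-> sqnorm x < r ^+ 2.
Proof.
move=> r0; rewrite /eball/= /enorm -/(sqnorm x).
rewrite -[X in _ < X](ger0_norm (ltW r0)) -sqrtr_sqr.
by rewrite ltr_sqrt// exprn_gt0.
Qed.

Lemma measurable_eball r : measurable (@eball R d r).
Proof.
have [r0|r0] := ltP 0 r.
  rewrite (_ : eball r = @sqnorm R d @^-1` [set y | y < r ^+ 2]); last first.
    by apply/seteqP; split=> x; rewrite eball_sqnorm.
  apply: measurable_open_mx; apply: open_comp => [x _|]; last exact: open_lt.
  exact: continuous_sqnorm.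
rewrite (_ : eball r = set0)//; apply/seteqP; split=> // x /= xr.
by have := lt_le_trans xr r0; rewrite ltNge sqrtr_ge0.
Qed.

(** An open ball is the increasing union of smaller ones; thus the supremum defining R_t is attained
    when finite. *)
Lemma eball_null (mu : {measure set 'rV[R]_d -> \bar R}) r :
  (forall s, s < r -> mu (eball s) = 0%E) -> mu (eball r) = 0%E.
Proof.
move=> mu0; pose s n := r - n.+1%:R^-1.
have sr n : s n < r by rewrite /s ltrBlDr ltrDl invr_gt0.
have E : eball r = \bigcup_n @eball R d (s n).
  apply/seteqP; split=> [x /= xr|x [n _] /= xs]; last exact: lt_trans xs (sr n).
  have e0 : 0 < r - enorm x by rewrite subr_gt0.
  have [n _ /(_ n (leqnn n)) /= hn] := near_infty_natSinv_lt (PosNum e0).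
  have xs : enorm x < s n by rewrite /s ltrBrDl -ltrBrDr; exact: hn.
  by exists n.
rewrite E; apply/eqP; rewrite -measure_le0.
have L : mu (eball (s n)) @[n --> \oo] --> mu (\bigcup_n eball (s n)).
  apply: nondecreasing_cvg_mu.
  - by move=> n; exact: measurable_eball.
  - by apply: bigcup_measurable => n _; exact: measurable_eball.
  - move=> a b ab; apply/subsetPset => x /= xs; apply: lt_le_trans xs _.
    by rewrite /s lerD2l lerN2 lef_pV2 ?posrE// ler_nat.
apply: (cvge_to_le L); near=> n; by rewrite mu0.
Unshelve. all: by end_near. Qed.

End balls.

(** * Void probability from a fixed initial measure *)

Section extinction.
Context {R : realType} {d : nat} {p : R} {d' : measure_display}
  {Omega : measurableType d'}.
Variables (X : R -> Omega -> @tempered R d p)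
  (P : R.-pker (@tempered R d p) ~> Omega) (m : nat).
Hypothesis sbm : is_super_brownian_motion X P.
Hypothesis pm : p <= 2 * m%:R.
Hypothesis d3 : (3 <= d)%N.
Hypothesis dm : (d <= m)%N.
Implicit Types (phi : 'rV[R]_d -> R) (t s r : R) (x : 'rV[R]_d).

Lemma void_radius_ge t r : 0 < r ->
  [set w | (r%:E <= void_radius X t w)%E] = [set w | X t w (eball r) = 0%E].
Proof.
move=> r0; apply/seteqP; split=> w /=; last first.
  move=> Xr; rewrite /void_radius le_max; apply/orP; right.
  by apply: ereal_sup_ubound; exists r.
rewrite /void_radius le_max => /orP[|rsup].
  by rewrite lee_fin => /(lt_le_trans r0); rewrite ltxx.
apply: eball_null => s sr.
have : (s%:E < r%:E)%E by rewrite lte_fin.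
move=> /lt_le_trans/(_ rsup)/ereal_sup_gt[_ [u [u0 Xu] <-]]; rewrite lte_fin => su.
apply/eqP; rewrite -measure_le0 -Xu; apply: le_measure; rewrite ?inE.
- exact: measurable_eball.
- exact: measurable_eball.
- by move=> x /= xs; exact: lt_trans xs su.
Qed.

(** The factor r^(-2) is the one of the parabolic scaling, so the solution started here is r^(-2)
    [evol_cutoff k] at (r^(-2) t, x/r): the radius 1 solution covers all radii. *)
Let scaled_cutoff r (k : nat) x : R :=
  r^-1 ^+ 2 * (k%:R * cutoff 1 (r^-1 *: x + 0)).

Let adm_scaled_cutoff r k : 0 < r -> adm m (scaled_cutoff r k).
Proof.
move=> r0; apply: admZ; first exact: sqr_ge0.
apply: (@adm_affine _ _ _ (fun z => k%:R * cutoff 1 z)); first by rewrite invr_gt0.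
by apply: admZ => //; exact: adm_cutoff.
Qed.

Let scaled_cutoff_ge0 r k x : 0 <= scaled_cutoff r k x.
Proof. by rewrite mulr_ge0 ?sqr_ge0// mulr_ge0// cutoff_ge0. Qed.

Let scaled_cutoff_nondecreasing r x : nondecreasing_seq (fun k => scaled_cutoff r k x).
Proof.
move=> a b ab; rewrite ler_wpM2l ?sqr_ge0// ler_wpM2r ?cutoff_ge0//.
by rewrite ler_nat.
Qed.

Let cvg_scaled_cutoff r x : 0 < r ->
  (scaled_cutoff r k x)%:E @[k --> \oo] --> ((cst +oo%E) \_ (eball r)) x.
Proof.
move=> r0; rewrite /scaled_cutoff addr0 patchE.
have rV : 0 < r^-1 ^+ 2 by rewrite exprn_gt0// invr_gt0.
have sE : (sqnorm (r^-1 *: x) < 1) = (sqnorm x < r ^+ 2).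
  by rewrite sqnormZ exprVn mulrC ltr_pdivrMr ?exprn_gt0// mul1r.
case: ifPn => [/set_mem|/negP xr].
  rewrite eball_sqnorm// -sE => xr; set y := cutoff _ _.
  have y0 : 0 < y by rewrite /y /cutoff lt_max expr1n subr_gt0 xr orbT.
  apply/cvgeryP; under eq_fun do rewrite mulrCA.
  have My0 : 0 < r^-1 ^+ 2 * y by rewrite mulr_gt0.
  apply/cvgryPge => A; near=> k; rewrite -ler_pdivrMr//; near: k.
  exact: nbhs_infty_ger.
rewrite (_ : (fun _ => _) = cst 0%E); first exact: cvg_cst.
apply/funext => k; rewrite /cutoff expr1n (_ : Num.max _ _ = 0) ?mulr0//.
apply/max_idPl; rewrite subr_le0 leNgt sE; apply/negP => h; apply: xr.
by apply/mem_set; rewrite eball_sqnorm.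
Unshelve. all: by end_near. Qed.

Lemma measurable_extinction t r : 0 <= t ->
  measurable [set w | X t w (eball r) = 0%E].
Proof.
move=> t0; rewrite -[X in measurable X]setTI.
exact: (measurable_ev_process sbm t0 (measurable_eball r) measurableT (emeasurable_set1 0%E)).
Qed.

(** The limit is exp(-(+oo) mu(B(r))), which the convention (+oo) 0 = 0 turns into the indicator of
    mu(B(r)) = 0. *)
Let cvg_extinction (mu : {measure set 'rV[R]_d -> \bar R}) r : 0 < r ->
  expeR (- \int[mu]_x (scaled_cutoff r k x)%:E)%E @[k --> \oo] -->
  (if mu (eball r) == 0 then 1 else 0)%E.
Proof.
move=> r0.
have L : (\int[mu]_x (scaled_cutoff r k x)%:E @[k --> \oo] -->
    \int[mu]_x ((cst +oo%E) \_ (eball r)) x)%E.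
  apply: cvg_nondecreasing_integral.
  - by move=> k; apply/measurable_EFinP; exact: adm_measurable (adm_scaled_cutoff k r0).
  - by move=> k x; rewrite lee_fin.
  - by move=> x a b ab; rewrite lee_fin; exact: scaled_cutoff_nondecreasing.
  - by move=> x; exact: cvg_scaled_cutoff.
rewrite -integral_mkcond integral_cst in L; last exact: measurable_eball.
have := cvg_expeRN _ _ L.
have -> : (if mu (eball r) == 0 then 1 else 0)%E = expeR (- (+oo * mu (eball r)))%E.
  case: ifPn => [/eqP ->|mu0]; first by rewrite mule0 oppe0 expeR0.
  by rewrite gt0_mulye// lt0e mu0/=.
apply.
- by move=> k; apply: integral_ge0 => x _; rewrite lee_fin.
- move=> a b ab; apply: ge0_le_integral => //.
  + by move=> x _; rewrite lee_fin.
  + by apply/measurable_EFinP; exact: adm_measurable (adm_scaled_cutoff a r0).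
  + by apply/measurable_EFinP; exact: adm_measurable (adm_scaled_cutoff b r0).
  + by move=> x _; rewrite lee_fin; exact: scaled_cutoff_nondecreasing.
Qed.

(** The Laplace functionals of the scaled cutoffs have two limits: by dominated convergence under
    the law, and by monotone convergence of the solutions. *)
Lemma extinction_prob (mu : @tempered R d p) t r : 0 < t -> 0 < r ->
  (P mu [set w | X t w (eball r) = 0] =
   expeR (- \int[mu]_x (r^-1 ^+ 2 * evol_infty (r^-1 ^+ 2 * t)%R (r^-1 *: x)%R)%:E))%E.
Proof.
move=> t0 r0; have t0' := ltW t0.
have c0 : 0 < r^-1 by rewrite invr_gt0.
have s0 : 0 < r^-1 ^+ 2 * t by rewrite mulr_gt0// exprn_gt0.
set E := [set w | _].
have L1 : (\int[P mu]_w expeR (- \int[X t w]_x (scaled_cutoff r k x)%:E) @[k --> \oo] -->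
    \int[P mu]_w (\1_E w)%:E)%E.
  apply: (@dominated_cvg _ _ _ (P mu) setT measurableT
    (fun k w => expeR (- \int[X t w]_x (scaled_cutoff r k x)%:E)%E) _ (EFin \o cst 1%R)).
  - move=> k; apply: (measurableT_comp (@measurable_expeR R)); apply: measurableT_comp => //.
    apply: (@measurable_integral_ev _ _ _ _ _ (fun w => tempered_measure (X t w))).
    + by move=> A mA; exact: (measurable_ev_process sbm t0' mA).
    + by apply/measurable_EFinP; exact: adm_measurable (adm_scaled_cutoff k r0).
    + by move=> x; rewrite lee_fin.
  - move=> w _; have := @cvg_extinction (X t w) r r0; rewrite indicE.
    have -> : (w \in E) = (X t w (eball r) == 0%E).
      by apply/idP/eqP => [/set_mem|h]; [|exact/mem_set].
    by case: eqP.
  - by [].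
  - apply/integrableP; split; first exact/measurable_EFinP.
    under eq_integral do rewrite /= normr1.
    by rewrite (integral_cst (P mu) measurableT 1%E) mul1e prob_kernel ltry.
  - move=> k w _; rewrite gee0_abs ?expeR_ge0//= -expeR0 lee_expeR.
    by rewrite oppe_le0; apply: integral_ge0 => x _; rewrite lee_fin.
rewrite integral_indic ?setIT in L1; last 2 first.
- exact: measurableT.
- exact: measurable_extinction.
apply: (cvg_unique _ L1) => //.
have -> : (fun k => \int[P mu]_w expeR (- \int[X t w]_x (scaled_cutoff r k x)%:E))%E =
    (fun k => expeR (- \int[mu]_x (r^-1 ^+ 2 *
       evol_cutoff k (r^-1 ^+ 2 * t)%R (r^-1 *: x)%R)%:E))%E.
  apply/funext => k; rewrite (evol_laplace sbm pm mu (adm_scaled_cutoff k r0) t0').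
  congr (expeR (- _)); apply: eq_integral => x _; congr (_%:E).
  rewrite /scaled_cutoff.
  rewrite (evol_affine0 sbm pm x 0 (phi := fun z => k%:R * cutoff 1 z))// ?addr0//.
  by apply: admZ => //; exact: adm_cutoff.
have ge0 k x : 0 <= r^-1 ^+ 2 * evol_cutoff k (r^-1 ^+ 2 * t) (r^-1 *: x).
  by rewrite mulr_ge0 ?sqr_ge0// (evol_cutoff_ge0 sbm pm)// ltW.
have nd x : nondecreasing_seq (fun k =>
    (r^-1 ^+ 2 * evol_cutoff k (r^-1 ^+ 2 * t) (r^-1 *: x))%:E).
  move=> a b ab; rewrite lee_fin ler_wpM2l ?sqr_ge0//.
  exact: (evol_cutoff_nondecreasing sbm pm _ (ltW s0)).
have mf k : measurable_fun setT (fun x : 'rV[R]_d =>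
    (r^-1 ^+ 2 * evol_cutoff k (r^-1 ^+ 2 * t) (r^-1 *: x))%:E).
  apply/measurable_EFinP; apply: (@adm_measurable _ _ m); apply: admZ; first exact: sqr_ge0.
  have := adm_affine 0 c0 (adm_evol_cutoff sbm pm k (ltW s0)).
  by congr adm; apply/funext => x; rewrite addr0.
apply: cvg_expeRN.
- by move=> k; apply: integral_ge0 => x _; rewrite lee_fin.
- move=> a b ab; apply: ge0_le_integral => //.
  + by move=> x _; rewrite lee_fin.
  + by move=> x _; exact: nd.
- apply: cvg_nondecreasing_integral => //.
  + move=> x; apply: cvg_EFinr; apply: cvgM; first exact: cvg_cst.
    exact: (cvg_evol_infty sbm pm).
Qed.

End extinction.

(** * Void probability from the Poisson random measure *)

Section void_probability.
Context {R : realType} {d : nat} {p : R} {d' : measure_display}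
  {Omega : measurableType d'}.
Variables (X : R -> Omega -> @tempered R d p)
  (P : R.-pker (@tempered R d p) ~> Omega)
  (Pi : probability (@tempered R d p) R) (m : nat).
Hypothesis sbm : is_super_brownian_motion X P.
Hypothesis PRM : is_PRM (lebesgue_rV d) Pi.
Hypothesis pm : p <= 2 * m%:R.
Hypothesis d3 : (3 <= d)%N.
Hypothesis dm : (d <= m)%N.
Implicit Types (t s r : R) (x : 'rV[R]_d).

(** Scaled time at least 1 puts [evol_infty] under an integrable majorant, as the Laplace functional
    of the Poisson measure requires; the substitution of r x for x produces r^d. *)
Lemma void_prob t r : 0 < t -> 0 < r -> 1 <= r^-1 ^+ 2 * t ->
  law_from P Pi [set w | (r%:E <= void_radius X t w)%E] =
  expeR (- ((r ^+ d)%:E * \int[lebesgue_rV d]_x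
    (1 - expR (- (r^-1 ^+ 2 * evol_infty (r^-1 ^+ 2 * t)%R x)))%:E))%E.
Proof.
move=> t0 r0 s1; have c0 : 0 < r^-1 by rewrite invr_gt0.
set s := r^-1 ^+ 2 * t in s1 *; have s0 : 0 < s by lra.
pose h x := r^-1 ^+ 2 * evol_infty s (r^-1 *: x).
have h0 x : 0 <= h x by rewrite mulr_ge0 ?sqr_ge0// (evol_infty_ge0 sbm pm).
have me := measurable_evol_infty sbm pm s0.
have maff : measurable_fun setT (fun x : 'rV[R]_d => r^-1 *: x).
  rewrite (_ : (fun _ => _) = (fun x : 'rV[R]_d => r^-1 *: x + 0)).
    exact: measurable_affine.
  by apply/funext => x; rewrite addr0.
have mh : measurable_fun setT h.
  by apply: measurable_funM => //; exact: (measurableT_comp me maff).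
have [C C0 HC] := evol_cutoff_uniform sbm pm d3 dm s1.
(* An admissible majorant of [h], integrable for Lebesgue measure and every tempered measure. *)
pose g x := r^-1 ^+ 2 * (C * powinv 1 1 m (sqnorm (r^-1 *: x + 0))).
have ag : adm m g.
  apply: admZ; first exact: sqr_ge0.
  apply: admZ => //.
  have := adm_affine 0 c0 (@adm_powinv R d m 1 ltr01 (lexx 1)).
  by rewrite invr1.
have hg x : h x <= g x.
  rewrite /h /g addr0 ler_wpM2l ?sqr_ge0//; apply: (evol_infty_le sbm pm) => // k.
have hlt (mu : {measure set 'rV[R]_d -> \bar R}) : (\int[mu]_x (g x)%:E < +oo)%E ->
    (\int[mu]_x (h x)%:E < +oo)%E.
  apply: le_lt_trans; apply: ge0_le_integral => //.
  - by move=> x _; rewrite lee_fin.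
  - exact/measurable_EFinP.
  - by apply/measurable_EFinP; exact: adm_measurable ag.
  - by move=> x _; rewrite lee_fin.
rewrite /law_from void_radius_ge//.
transitivity (\int[Pi]_mu expeR (- \int[mu]_x (h x)%:E))%E.
  apply: eq_integral => mu _; rewrite (extinction_prob sbm pm mu t0 r0)//.
rewrite (prm_laplace PRM mh h0); last 2 first.
- exact: hlt (adm_lebesgue_lty dm ag).
- by move=> mu; exact: hlt (adm_integral_lty mu pm ag).
congr (expeR (- _))%E.
pose f (x : 'rV[R]_d) := (1 - expR (- (r^-1 ^+ 2 * evol_infty s x)))%:E.
have mf : measurable_fun setT f.
  apply/measurable_EFinP; apply: measurable_funB => //.
  apply: measurableT_comp => //; apply: measurableT_comp => //.
  exact: measurable_funM.
have f0 x : (0 <= f x)%E.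
  rewrite lee_fin subr_ge0 -expR0 ler_expR oppr_le0 mulr_ge0 ?sqr_ge0//.
  exact: (evol_infty_ge0 sbm pm).
have := @lebesgue_affine R d r^-1 0 f c0 mf f0.
rewrite -exprVn invrK => <-; apply: eq_integral => x _.
by rewrite /f addr0.
Qed.

(** z (1 - z) <= 1 - e^(-z) <= z, where z = r^(-2) U_1 is at most 1/t; the powers r^d and r^(-2)
    combine into r^(d - 2). *)
Lemma void_exponent_bounds t r (M : R) : 0 < r -> 1 <= r^-1 ^+ 2 * t -> 1 <= t ->
  @evol_infty_mass R d (r^-1 ^+ 2 * t) = M%:E ->
  ((r ^+ (d - 2) * (1 - t^-1) * M)%:E <=
   (r ^+ d)%:E * \int[lebesgue_rV d]_x
    (1 - expR (- (r^-1 ^+ 2 * evol_infty (r^-1 ^+ 2 * t)%R x)))%:E <=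
   (r ^+ (d - 2) * M)%:E)%E.
Proof.
move=> r0 s1 t1; have t0 : 0 < t by lra.
have r2 : 0 < r^-1 ^+ 2 by rewrite exprn_gt0// invr_gt0.
set s := r^-1 ^+ 2 * t in s1 *; have s0 : 0 < s by lra.
move=> ME.
have me := measurable_evol_infty sbm pm s0.
have e0 (x : 'rV[R]_d) := evol_infty_ge0 sbm pm x s0.
have meE : measurable_fun setT (fun x : 'rV[R]_d => (evol_infty s x)%:E).
  exact/measurable_EFinP.
have rdE : r ^+ (d - 2) = r ^+ d * r^-1 ^+ 2.
  by rewrite exprVn -expfB ?(leq_trans _ d3)// gt_eqF.
have z0 x : 0 <= r^-1 ^+ 2 * evol_infty s x by rewrite mulr_ge0 ?sqr_ge0// e0.
have mz : measurable_fun setT (fun x : 'rV[R]_d =>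
    1 - expR (- (r^-1 ^+ 2 * evol_infty s x))).
  apply: measurable_funB => //.
  by apply: measurableT_comp => //; apply: measurableT_comp => //; exact: measurable_funM.
have h0 x : 0 <= 1 - expR (- (r^-1 ^+ 2 * evol_infty s x)).
  by rewrite subr_ge0 -expR0 ler_expR oppr_le0.
have zt x : r^-1 ^+ 2 * evol_infty s x <= t^-1.
  rewrite (@le_trans _ _ (r^-1 ^+ 2 * s^-1))//.
    by rewrite ler_pM2l// (evol_infty_le_inv sbm pm).
  by rewrite /s invfM mulrA divff ?mul1r// gt_eqF.
have tV1 : t^-1 <= 1 by rewrite invf_le1.
have scaled (c : R) : 0 <= c ->
    (\int[lebesgue_rV d]_x (c * evol_infty s x)%:E = (c * M)%:E)%E.
  move=> c0; rewrite EFinM -ME -ge0_integralZl// => x _.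
  by rewrite lee_fin e0.
have rd0 : (0 <= (r ^+ d)%:E)%E by rewrite lee_fin exprn_ge0// ltW.
have c0 : 0 <= r^-1 ^+ 2 * (1 - t^-1) by rewrite mulr_ge0 ?subr_ge0// ltW.
apply/andP; split.
  rewrite rdE (_ : _ * _ * M = r ^+ d * (r^-1 ^+ 2 * (1 - t^-1) * M)); last by rewrite !mulrA.
  rewrite EFinM lee_wpmul2l// -scaled//.
  apply: ge0_le_integral => //.
  - by move=> x _; rewrite lee_fin mulr_ge0// e0.
  - by apply/measurable_EFinP; exact: measurable_funM.
  - exact/measurable_EFinP.
  - move=> x _; rewrite lee_fin mulrAC.
    have := explin_ge 0 (z0 x); rewrite /explin expr0 invr1 !mul1r; apply: le_trans.
    by rewrite ler_wpM2l// lerD2l lerN2.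
rewrite rdE -mulrA EFinM lee_wpmul2l// -(scaled _ (ltW r2)).
apply: ge0_le_integral => //.
- by move=> x _; rewrite lee_fin.
- exact/measurable_EFinP.
- by apply/measurable_EFinP; exact: measurable_funM.
- move=> x _; rewrite lee_fin.
  by have := explin_le 0 (r^-1 ^+ 2 * evol_infty s x); rewrite /explin expr0 invr1 !mul1r.
Qed.

End void_probability.

Theorem theorem1p3 (R : realType) (d : nat) (p : R) (d' : measure_display)
    (Omega : measurableType d') (X : R -> Omega -> @tempered R d p)
    (P : R.-pker (@tempered R d p) ~> Omega)
    (Pi : probability (@tempered R d p) R) :
  (3 <= d)%N -> d%:R < p ->
  is_super_brownian_motion X P ->
  is_PRM (lebesgue_rV d) Pi ->
  exists kappa : R,
    [/\ 0 < kappa,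
        (\int[lebesgue_rV d]_x
           lne (P (tempered_dirac p x)
                  [set w | X t w (@eball R d 1) = 0]))%E
          @[t --> +oo] --> (- kappa)%:E &
        forall r : R, 0 < r ->
          law_from P Pi [set w | (r%:E <= void_radius X t w)%E]
            @[t --> +oo] --> (expR (- (kappa * r ^+ (d - 2))))%:E].
Proof.
move=> d3 dp sbm PRM.
(* Chosen for m >= d and m >= p; the successor compensates for the truncation. *)
pose m := maxn d (Num.truncn p).+1.
have dm : (d <= m)%N by rewrite leq_maxl.
have pm : p <= 2 * m%:R.
  have p0 : 0 <= p by apply: le_trans (ltW dp).
  have /andP[_ /ltW p1] := Num.Theory.truncn_itv p0.
  apply: (le_trans p1); apply: (@le_trans _ _ m%:R); first by rewrite ler_nat leq_maxr.
  by rewrite ler_peMl// ler1n.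
have [kappa kappa0 L] := evol_infty_mass_cvg sbm pm d3 dm.
exists kappa; split => //.
  rewrite EFinN; apply: cvg_trans (cvgeN L); apply: near_eq_cvg.
  near=> t; have t0 : 0 < t by near: t; exact: nbhs_pinfty_gt.
  rewrite -integral_ge0N; last by move=> x _; rewrite lee_fin (evol_infty_ge0 sbm pm).
  apply: eq_integral => x _.
  (* For r = 1 and a Dirac mass, the logarithm of the void probability is -U_1(t, x). *)
  rewrite (extinction_prob sbm pm _ t0 ltr01) expeRK.
  rewrite /= integral_dirac//; last first.
    apply/measurable_EFinP; rewrite invr1 expr1n.
    under eq_fun do rewrite !mul1r scale1r.
    exact: (measurable_evol_infty sbm pm).
  by rewrite diracT mul1e invr1 expr1n !mul1r scale1r.
move=> r r0; have c0 : 0 < r^-1 ^+ 2 by rewrite exprn_gt0// invr_gt0.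
have ct : r^-1 ^+ 2 * t @[t --> +oo] --> +oo.
  by apply: gt0_cvgMry => //; exact: cvg_id.
(* Scaled time also tends to +oo, so every radius sees the same limit [kappa], and r enters only
   through r^(d - 2). *)
have Lc : @evol_infty_mass R d (r^-1 ^+ 2 * t) @[t --> +oo] --> kappa%:E.
  exact: (cvg_comp _ _ ct L).
pose M (t : R) := fine (@evol_infty_mass R d (r^-1 ^+ 2 * t)).
have LM : M t @[t --> +oo] --> kappa by exact: (fine_cvg Lc).
pose J (t : R) := ((r ^+ d)%:E * \int[lebesgue_rV d]_x
    (1 - expR (- (r^-1 ^+ 2 * evol_infty (r^-1 ^+ 2 * t)%R x)))%:E)%E.
have bounds : \forall t \near +oo, ((r ^+ (d - 2) * (1 - t^-1) * M t)%:E <= J t <=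
    (r ^+ (d - 2) * M t)%:E)%E.
  near=> t.
  have t1 : 1 <= t by near: t; exact: nbhs_pinfty_ge.
  have s1 : 1 <= r^-1 ^+ 2 * t.
    by near: t; move/cvgryPge : ct => /(_ 1).
  have s0 : 0 < r^-1 ^+ 2 * t by lra.
  have ME : @evol_infty_mass R d (r^-1 ^+ 2 * t) = (M t)%:E.
    rewrite fineK// ge0_fin_numE; first exact: (evol_infty_mass_lty sbm pm d3 dm).
    by apply: integral_ge0 => x _; rewrite lee_fin (evol_infty_ge0 sbm pm).
  exact: (void_exponent_bounds sbm pm d3 r0 s1 t1 ME).
have LJ : J t @[t --> +oo] --> (kappa * r ^+ (d - 2))%:E.
  apply: (squeeze_cvge bounds); apply: cvg_EFinr.
    have -> : kappa * r ^+ (d - 2) = r ^+ (d - 2) * (1 - 0) * kappa by ring.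
    apply: cvgM => //; apply: cvgM; first exact: cvg_cst.
    apply: cvgB; first exact: cvg_cst.
    apply/gtr0_cvgV0; last exact: cvg_id.
    by near=> t; near: t; exact: nbhs_pinfty_gt.
  by rewrite mulrC; apply: cvgM => //; exact: cvg_cst.
have LE : expeR (- J t) @[t --> +oo] --> (expR (- (kappa * r ^+ (d - 2))))%:E.
  have c : {for kappa * r ^+ (d - 2), continuous (fun x : R => expR (- x))}.
    by apply: continuous_comp; [exact: opp_continuous|exact: continuous_expR].
  have fJ : \forall t \near +oo, J t \is a fin_num by case/fine_cvgP : LJ.
  have H : (expR (- fine (J t)))%:E @[t --> +oo] --> (expR (- (kappa * r ^+ (d - 2))))%:E.
    by apply: cvg_EFinr; exact: (cvg_comp _ _ (fine_cvg LJ) c).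
  apply: cvg_trans H; apply: near_eq_cvg; near=> t.
  have f : J t \is a fin_num by near: t.
  by rewrite -[in RHS](fineK f).
apply: cvg_trans LE; apply: near_eq_cvg; near=> t.
have t0 : 0 < t by near: t; exact: nbhs_pinfty_gt.
have s1 : 1 <= r^-1 ^+ 2 * t by near: t; move/cvgryPge : ct => /(_ 1).
by rewrite (void_prob sbm PRM pm d3 dm t0 r0 s1).
Unshelve. all: by end_near. Qed.
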